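(* Let $Q\subset\mathbb C$ be a convex locally closed set with $0\in Q$, let $E_Q$ be the weighted (LF)-space of entire functions described in the context, and let $g_0=e_\lambda$ for some $\lambda\in Q$. (i) For each integer $n\ge 0$ the space $\mathcal P_n(e_\lambda)$ is a proper closed $D_{0,g_0}$-invariant subspace of $E_Q$. (ii) For each proper closed $D_{0,g_0}$-invariant subspace $\mathcal P$ of $E_Q$ there is an integer $n\ge 0$ such that $\mathcal P=\mathcal P_n(e_\lambda)$. Here a subspace of $E_Q$ is called proper if it is different from $\{0\}$ and from $E_Q$.
   Context: A convex set $Q\subset\mathbb C$ is called locally closed here if it has a countable fundamental sequence of compact subsets, i.e. an increasing sequence $(Q_n)_{n\in\mathbb N}$ of compact subsets of $Q$ such that each compact subset of $Q$ is contained in some $Q_n$. With $0\in Q$, the sequence $(Q_n)$ is chosen with all $Q_n$ convex and $0\in Q_1$. For $\Omega\subset\mathbb C$ let $H_\Omega(z):=\sup_{t\in\Omega}\mathrm{Re}(tz)$, $z\in\mathbb C$, be its support function. Put $v_{n,k}(z):=H_{Q_n}(z)+|z|/k$ for $n,k\in\mathbb N$, and $$E_n:=\Big\{f\text{ entire}:\ \sup_{z\in\mathbb C}\frac{|f(z)|}{\exp v_{n,k}(z)}<+\infty\ \ \forall k\in\mathbb N\Big\},$$ a Fréchet space with these weighted sup-norms ($k\in\mathbb N$). Then $E_n$ embeds continuously in $E_{n+1}$, and $E_Q:=\bigcup_{n}E_n$ carries the locally convex inductive limit topology of the sequence $(E_n)$. For $g_0\in E_Q$ with $g_0(0)=1$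 the Pommiez operator $D_{0,g_0}$ is the continuous linear operator from $E_Q$ to itself given by $$D_{0,g_0}(f)(t):=\frac{f(t)-g_0(t)f(0)}{t}\ (t\ne 0),\qquad D_{0,g_0}(f)(0):=f'(0)-g_0'(0)f(0).$$ A subspace $\mathcal P$ is $D_{0,g_0}$-invariant if $D_{0,g_0}(\mathcal P)\subseteq\mathcal P$. For $\nu\in\mathbb C$, $e_\nu(z):=e^{\nu z}$; $e_\nu\in E_Q$ if and only if $\nu\in Q$. $\mathbb C[z]_n$ is the space of polynomials of degree at most $n$, and $\mathcal P_n(e_\lambda):=\{e_\lambda P: P\in\mathbb C[z]_n\}$. *)

(* Defs.v *)
From Stdlib Require Export Reals List.
From Coquelicot Require Export Coquelicot.

(* Stdlib real numbers with Coquelicot's complex numbers.  Sets are predicates;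
   functions C -> C are compared with Leibniz equality. *)

Open Scope C_scope.

Definition subset {T : Type} (A B : T -> Prop) : Prop := forall x, A x -> B x.
Definition same_set {T : Type} (A B : T -> Prop) : Prop := forall x, A x <-> B x.

Definition convex_set (A : C -> Prop) : Prop :=
  forall (x y : C) (t : R), A x -> A y -> (0 <= t <= 1)%R ->
    A (RtoC t * x + RtoC (1 - t) * y).

Definition compact_set {T : UniformSpace} (K : T -> Prop) : Prop :=
  forall F : (T -> Prop) -> Prop,
    (forall U, F U -> open U) ->
    (forall x, K x -> exists U, F U /\ U x) ->
    exists l : list (T -> Prop),
      (forall U, In U l -> F U) /\
      (forall x, K x -> exists U, In U l /\ U x).

(* Sequences (Q_n) with n >= 1 are indexed from 0: Qs n stands for Q_{n+1}. *)
Definition fundamental_sequence (Q : C -> Prop) (Qs : nat -> C -> Prop) : Prop :=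
  (forall n, compact_set (Qs n)) /\
  (forall n, subset (Qs n) Q) /\
  (forall n, subset (Qs n) (Qs (S n))) /\
  (forall K : C -> Prop, compact_set K -> subset K Q -> exists n, subset K (Qs n)).

Definition locally_closed (Q : C -> Prop) : Prop :=
  exists Qs, fundamental_sequence Q Qs.

Definition support_function (Omega : C -> Prop) (z : C) : Rbar :=
  Lub_Rbar (fun x : R => exists t : C, Omega t /\ x = Re (t * z)).

(* [real] loses nothing here: the support function of a nonempty compact set is
   finite.  The index k of the code stands for k+1 in |z|/k. *)
Definition weight (Qs : nat -> C -> Prop) (n k : nat) (z : C) : R :=
  (real (support_function (Qs n) z) + Cmod z / INR (S k))%R.

Definition weighted_norm (Qs : nat -> C -> Prop) (n k : nat) (f : C -> C) : Rbar :=
  Lub_Rbar (fun x : R => exists z : C, x = (Cmod (f z) / exp (weight Qs n k z))%R).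

Definition entire (f : C -> C) : Prop := forall z : C, ex_derive f z.

Definition E_step (Qs : nat -> C -> Prop) (n : nat) (f : C -> C) : Prop :=
  entire f /\ forall k, Rbar_lt (weighted_norm Qs n k f) p_infty.

Definition E_lim (Qs : nat -> C -> Prop) (f : C -> C) : Prop :=
  exists n, E_step Qs n f.

(* U contains a neighbourhood of 0 of the n-th step, whose topology is defined
   by the norms [weighted_norm Qs n k]. *)
Definition E_step_nbhs0 (Qs : nat -> C -> Prop) (n : nat) (U : (C -> C) -> Prop) : Prop :=
  exists (N : nat) (eps : R), (0 < eps)%R /\
    forall f, E_step Qs n f ->
      (forall k, (k <= N)%nat -> Rbar_lt (weighted_norm Qs n k f) eps) -> U f.

Definition absolutely_convex (U : (C -> C) -> Prop) : Prop :=
  forall (f g : C -> C) (a b : C), U f -> U g -> (Cmod a + Cmod b <= 1)%R ->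
    U (fun z => a * f z + b * g z).

(* Standard base of neighbourhoods of 0 of the locally convex inductive limit
   topology: the absolutely convex sets whose trace on every step is a
   neighbourhood of 0 there. *)
Definition lf_base0 (Qs : nat -> C -> Prop) (U : (C -> C) -> Prop) : Prop :=
  subset U (E_lim Qs) /\ absolutely_convex U /\ forall n, E_step_nbhs0 Qs n U.

Definition lf_open (Qs : nat -> C -> Prop) (V : (C -> C) -> Prop) : Prop :=
  subset V (E_lim Qs) /\
  forall f, V f -> exists U, lf_base0 Qs U /\
    forall g, U g -> V (fun z => f z + g z).

Definition lf_closed (Qs : nat -> C -> Prop) (P : (C -> C) -> Prop) : Prop :=
  subset P (E_lim Qs) /\ lf_open Qs (fun f => E_lim Qs f /\ ~ P f).

Definition linear_subspace (P : (C -> C) -> Prop) : Prop :=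
  P (fun _ => 0) /\
  (forall f g, P f -> P g -> P (fun z => f z + g z)) /\
  (forall (c : C) f, P f -> P (fun z => c * f z)).

Definition pommiez (g0 f : C -> C) (t : C) : C :=
  if Ceq_dec t 0 then C_derive f 0 - C_derive g0 0 * f 0
  else (f t - g0 t * f 0) / t.

Definition invariant_under (D : (C -> C) -> (C -> C)) (P : (C -> C) -> Prop) : Prop :=
  forall f, P f -> P (D f).

Definition proper_closed_invariant_subspace
    (Qs : nat -> C -> Prop) (g0 : C -> C) (P : (C -> C) -> Prop) : Prop :=
  subset P (E_lim Qs) /\
  linear_subspace P /\
  ~ same_set P (fun f => f = (fun _ => 0)) /\
  ~ same_set P (E_lim Qs) /\
  lf_closed Qs P /\
  invariant_under (pommiez g0) P.

Definition Cexp (z : C) : C := (exp (Re z) * cos (Im z), exp (Re z) * sin (Im z))%R.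

Definition e_ (nu : C) (z : C) : C := Cexp (nu * z).

Definition poly_le (n : nat) (p : C -> C) : Prop :=
  exists a : nat -> C, p = (fun z => sum_n (fun k => a k * z ^ k) n).

Definition exp_poly (n : nat) (lambda : C) (f : C -> C) : Prop :=
  exists p, poly_le n p /\ f = (fun z => e_ lambda z * p z).

(* Main.v *)
Require Import Defs.
From Stdlib Require Import Lra Lia Psatz Classical ClassicalEpsilon.
From Stdlib Require Import FunctionalExtensionality PropExtensionality.
From mathcomp Require classical_sets.
Open Scope C_scope.

(** Write f = e_lambda F. Then the Pommiez operator acts on F as the backward shift
    F |-> (F - F 0) / t, and the space of the e_lambda p becomes the space of the
    polynomials p of degree at most n ([pommiez_twist]). The support function of Q_n is
    replaced by that of Q_n - lambda, which is nonnegative for large n.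

    Part (i). A function is a polynomial of degree at most n when its (n+1)-st shift
    vanishes. The values of that shift are continuous functionals on every step, whence the
    space is closed ([exp_poly_closed]).

    Part (ii). Let P be closed, proper and invariant, and let g be a function outside P. In
    a fixed step some weighted norm, with weight v(t) = H(t) + delta |t|, separates g from P.
    By the Hahn-Banach theorem there is a functional phi, bounded for this norm on all
    functions of the plane that v dominates, with phi = 0 on P and phi g <> 0.
    The divided differences F[z, t] = (F t - F z) / (t - z), as functions of t, satisfy a
    resolvent identity, so invariance under the shift (the case z = 0) gives phi F[z, .] = 0
    for all F in P and all z. Let c z be the value of phi at 1 / (t - z), truncated near
    t = z. Up to a bounded error phi F[z, .] is - F z times c z, for every dominated entire
    function F ([divdiff_cauchy_transform]).

    If phi kills all monomials, it kills the exponentials e_mu and their divided differences,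
    for mu in a neighbourhood of Q_n - lambda ([killed_admissible]). So e_mu z times c z is
    bounded, and the choice of mu according to the direction of z gives
    c z = O(exp (- H z - delta |z| / 2)). For g, which grows more slowly,
    phi g[z, .] is therefore a bounded entire function of z, hence constant; comparing g with
    t g shows phi g = 0 ([vanishing_case]), which is absurd. So there is a first monomial t^N
    with phi t^N <> 0. The divided difference of t^(N+2) then bounds |c z| from below by a
    multiple of |z|^-(N+1). For F in P the product F z times c z is bounded, and F is a
    polynomial of degree at most N + 1 by Liouville's theorem ([polynomial_case]).
    Hence the untwisted elements of P are polynomials of bounded degree, and invariance
    leaves only the spaces of all polynomials up to some degree ([classification]).

    Entire functions are given by complex differentiability at each point, so the Taylor
    expansion with its estimates is derived first, from Goursat's theorem for
    parametrised squares ([entire_taylor]). *)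

Create HintDb pointwise.
Ltac fun_ring := apply functional_extensionality; intros ?; autounfold with pointwise; ring.

Lemma Cmod_minus_le (x y : C) : (Cmod (x - y) <= Cmod x + Cmod y)%R.
Proof.
  unfold Cminus. rewrite <- (Cmod_opp y). apply Cmod_triangle.
Qed.

Lemma Cmod_triangle_inv (x y : C) : (Cmod x - Cmod y <= Cmod (x - y))%R.
Proof.
  replace x with ((x - y) + y) at 1 by ring.
  generalize (Cmod_triangle (x - y) y). lra.
Qed.

Lemma Cmod_minus_sym (x y : C) : Cmod (x - y) = Cmod (y - x).
Proof.
  rewrite <- Cmod_opp. f_equal. ring.
Qed.

(** * Complex derivatives *)

(** The epsilon-delta form of the complex derivative. In [is_derive] the source and
    the target C carry different normed-module structures, and the generic rules
    for products and compositions ask for a single one. *)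
Definition has_cderiv (f : C -> C) (z l : C) : Prop :=
  forall eps : R, (0 < eps)%R -> exists d : R, (0 < d)%R /\
    forall t, (Cmod (t - z) < d)%R ->
      (Cmod (f t - f z - l * (t - z)) <= eps * Cmod (t - z))%R.

Lemma C_locally_iff (z : C) (P : C -> Prop) :
  locally (z : C_NormedModule) P <->
  exists d : R, (0 < d)%R /\ forall t, (Cmod (t - z) < d)%R -> P t.
Proof.
  split.
  - intros H. apply locally_norm_le_locally in H.
    destruct H as [d Hd]. exists d. split. apply cond_pos.
    intros t Ht. apply Hd. exact Ht.
  - intros [d [Hd H]]. apply locally_le_locally_norm.
    exists (mkposreal d Hd). intros t Ht. apply H. exact Ht.
Qed.

Lemma is_derive_cderiv (f : C -> C) (z l : C) :
  is_derive (K := C_AbsRing) (V := C_NormedModule) f z l <-> has_cderiv f z l.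
Proof.
  split.
  - intros [_ H] eps Heps.
    specialize (H z (fun P HP => HP) (mkposreal eps Heps)).
    destruct H as [d Hd]. exists d. split. apply cond_pos.
    intros t Ht. specialize (Hd t Ht). simpl in Hd.
    replace (f t - f z - l * (t - z)) with
      (minus (minus (f t) (f z)) (scal (minus t z) l : C_NormedModule)); [exact Hd|].
    unfold minus, plus, opp, scal; simpl. unfold mult; simpl. ring.
  - intros H. split. apply is_linear_scal_l.
    intros y Hy.
    assert (y = z) as ->.
    { symmetry. apply (is_filter_lim_locally_unique (V := AbsRing_NormedModule C_AbsRing)). exact Hy. }
    intros eps. destruct (H eps (cond_pos eps)) as [d [Hd Hd']].
    exists (mkposreal d Hd). intros t Ht. specialize (Hd' t Ht).
    assert (E : forall a b c : C, norm (minus (minus a b) (scal c l : C_NormedModule)) = Cmod (a - b - l * c)).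
    { intros a b c. change (Cmod (a + - b + - (c * l)) = Cmod (a - b - l * c)). f_equal. ring. }
    eapply Rle_trans; [|exact Hd']. right. exact (E (f t) (f z) (t - z)).
Qed.

Definition ccont (f : C -> C) (z : C) : Prop :=
  forall eps : R, (0 < eps)%R -> exists d : R, (0 < d)%R /\
    forall t, (Cmod (t - z) < d)%R -> (Cmod (f t - f z) < eps)%R.

Lemma continuous_C_iff {T : UniformSpace} (f : T -> C) (x : T) :
  continuous (T := T) (U := C_UniformSpace) f x <->
  forall eps : R, (0 < eps)%R -> locally x (fun y => (Cmod (f y - f x) < eps)%R).
Proof.
  split.
  - intros H e He. apply (H (fun w => (Cmod (w - f x) < e)%R)).
    apply (C_locally_iff (f x)). exists e. auto.
  - intros H P HP. apply (C_locally_iff (f x)) in HP. destruct HP as [e [He HP]].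
    change (locally x (fun y => P (f y))). generalize (H e He). apply filter_imp. intros y. apply HP.
Qed.

Lemma continuous_Cmult {T : UniformSpace} (f g : T -> C) (x : T) :
  continuous (T := T) (U := C_UniformSpace) f x ->
  continuous (T := T) (U := C_UniformSpace) g x ->
  continuous (T := T) (U := C_UniformSpace) (fun t => f t * g t) x.
Proof.
  rewrite !continuous_C_iff. intros Hf Hg e He.
  set (M := (Cmod (f x) + Cmod (g x) + 1)%R).
  assert (M1 : (1 <= M)%R).
  { unfold M. generalize (Cmod_ge_0 (f x)) (Cmod_ge_0 (g x)). lra. }
  set (e' := Rmin 1 (e / (2 * M))).
  assert (He' : (0 < e')%R).
  { apply Rmin_pos; [lra|]. apply Rdiv_lt_0_compat; lra. }
  assert (He2 : (2 * M * e' <= e)%R).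
  { apply Rle_trans with (2 * M * (e / (2 * M)))%R.
    - apply Rmult_le_compat_l; [lra|]. apply Rmin_r.
    - right. field. lra. }
  generalize (filter_and _ _ (Hf e' He') (Hg e' He')). apply filter_imp. intros t [A1 A2].
  replace (f t * g t - f x * g x) with
    ((f t - f x) * (g t - g x) + (f t - f x) * g x + f x * (g t - g x)) by ring.
  eapply Rle_lt_trans; [apply Cmod_triangle|].
  eapply Rle_lt_trans; [apply Rplus_le_compat_r; apply Cmod_triangle|].
  rewrite !Cmod_mult.
  assert (E1 : (e' <= 1)%R) by apply Rmin_l.
  generalize (Cmod_ge_0 (f x)) (Cmod_ge_0 (g x)) (Cmod_ge_0 (f t - f x)) (Cmod_ge_0 (g t - g x)).
  intros. unfold M in *. nra.
Qed.

Lemma ccont_continuous (f : C -> C) (z : C) :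
  ccont f z <-> continuous (T := C_UniformSpace) (U := C_UniformSpace) f z.
Proof.
  rewrite continuous_C_iff. split; intros H e He.
  - apply (C_locally_iff z). now apply H.
  - apply (C_locally_iff z (fun t => (Cmod (f t - f z) < e)%R)). now apply H.
Qed.

Lemma ccont_const (c z : C) : ccont (fun _ => c) z.
Proof.
  intros e He. exists 1%R. split; [lra|]. intros t _.
  replace (c - c) with (RtoC 0) by ring. rewrite Cmod_0. exact He.
Qed.

Lemma ccont_id (z : C) : ccont (fun t => t) z.
Proof. intros e He. exists e. auto. Qed.

Lemma ccont_plus (f g : C -> C) (z : C) :
  ccont f z -> ccont g z -> ccont (fun t => f t + g t) z.
Proof. rewrite !ccont_continuous. exact (continuous_plus (V := C_NormedModule) f g z). Qed.

Lemma ccont_mult (f g : C -> C) (z : C) :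
  ccont f z -> ccont g z -> ccont (fun t => f t * g t) z.
Proof. rewrite !ccont_continuous. apply (continuous_Cmult (T := C_UniformSpace)). Qed.

Lemma ccont_comp (f g : C -> C) (z : C) :
  ccont g z -> ccont f (g z) -> ccont (fun t => f (g t)) z.
Proof.
  intros Hg Hf e He. destruct (Hf e He) as [d [Hd H]].
  destruct (Hg d Hd) as [d' [Hd' H']]. exists d'. auto.
Qed.

Lemma ccont_inv (z : C) : z <> 0 -> ccont (fun t => / t) z.
Proof.
  intros Hz e He.
  assert (Hm : (0 < Cmod z)%R) by (apply Cmod_gt_0; exact Hz).
  exists (Rmin (Cmod z / 2) (e * (Cmod z * Cmod z / 2))).
  split. { apply Rmin_pos; [lra|]. apply Rmult_lt_0_compat; [lra|]. nra. }
  intros t Ht.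
  assert (A1 := Rlt_le_trans _ _ _ Ht (Rmin_l _ _)).
  assert (A2 := Rlt_le_trans _ _ _ Ht (Rmin_r _ _)).
  assert (B : (Cmod z / 2 < Cmod t)%R).
  { generalize (Cmod_triangle_inv z t). rewrite (Cmod_minus_sym z t). lra. }
  assert (Ht0 : t <> 0).
  { intros ->. rewrite Cmod_0 in B. lra. }
  replace (/ t - / z) with (- (t - z) / (t * z)) by (field; auto).
  rewrite Cmod_div by (apply Cmult_neq_0; auto).
  rewrite Cmod_opp, Cmod_mult.
  apply Rmult_lt_reg_r with (Cmod t * Cmod z)%R; [nra|].
  unfold Rdiv at 1. rewrite Rmult_assoc, Rinv_l by nra. rewrite Rmult_1_r.
  eapply Rlt_le_trans; [exact A2|].
  assert (Cmod z * Cmod z / 2 <= Cmod t * Cmod z)%R by nra. nra.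
Qed.

(** Caratheodory's form of the derivative turns the differentiation rules into
    the rules for continuity. *)
Lemma has_cderiv_quotient (f : C -> C) (z l : C) :
  has_cderiv f z l <->
  exists q, ccont q z /\ q z = l /\ forall t, f t - f z = q t * (t - z).
Proof.
  split.
  - intros H. exists (fun t => if Ceq_dec t z then l else (f t - f z) / (t - z)).
    split; [|split].
    + intros e He. destruct (H (e / 2)%R) as [d [Hd H']]; [lra|].
      exists d. split; [exact Hd|]. intros t Ht.
      destruct (Ceq_dec z z) as [_|n]; [|now elim n].
      destruct (Ceq_dec t z) as [->|n].
      { replace (l - l) with (RtoC 0) by ring. rewrite Cmod_0. exact He. }
      assert (N : t - z <> 0).
      { intros E. apply n. replace t with ((t - z) + z) by ring. rewrite E. ring. }
      assert (P : (0 < Cmod (t - z))%R) by (apply Cmod_gt_0; exact N).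
      specialize (H' t Ht).
      replace ((f t - f z) / (t - z) - l) with ((f t - f z - l * (t - z)) / (t - z))
        by (field; exact N).
      rewrite Cmod_div by exact N.
      apply Rmult_lt_reg_r with (Cmod (t - z)); [exact P|].
      unfold Rdiv at 1. rewrite Rmult_assoc, Rinv_l by lra. nra.
    + destruct (Ceq_dec z z) as [_|n]; [reflexivity|now elim n].
    + intros t. destruct (Ceq_dec t z) as [->|n]; [ring|].
      field. intros E. apply n. replace t with ((t - z) + z) by ring. rewrite E. ring.
  - intros [q [Hq [<- E]]] e He. destruct (Hq e He) as [d [Hd H]].
    exists d. split; [exact Hd|]. intros t Ht. rewrite E.
    replace (q t * (t - z) - q z * (t - z)) with ((q t - q z) * (t - z)) by ring.
    rewrite Cmod_mult. apply Rmult_le_compat_r; [apply Cmod_ge_0|].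
    left. auto.
Qed.

Lemma has_cderiv_ccont (f : C -> C) (z l : C) : has_cderiv f z l -> ccont f z.
Proof.
  intros H. apply has_cderiv_quotient in H. destruct H as [q [Hq [_ E]]].
  assert (K : ccont (fun t => q t * (t - z) + f z) z).
  { apply ccont_plus; [|apply ccont_const]. apply ccont_mult; [exact Hq|].
    apply ccont_plus; [apply ccont_id|apply ccont_const]. }
  intros e He. destruct (K e He) as [d [Hd H']]. exists d. split; [exact Hd|].
  intros t Ht. specialize (H' t Ht). rewrite <- !E in H'.
  replace (f t - f z) with (f t - f z + f z - (f z - f z + f z)) by ring. exact H'.
Qed.

Lemma has_cderiv_const (c z : C) : has_cderiv (fun _ => c) z 0.
Proof.
  apply has_cderiv_quotient. exists (fun _ => RtoC 0).
  split; [apply ccont_const|]. split; [reflexivity|]. intros t; ring.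
Qed.

Lemma has_cderiv_id (z : C) : has_cderiv (fun t => t) z 1.
Proof.
  apply has_cderiv_quotient. exists (fun _ => RtoC 1).
  split; [apply ccont_const|]. split; [reflexivity|]. intros t; ring.
Qed.

Lemma has_cderiv_plus (f g : C -> C) (z l m : C) :
  has_cderiv f z l -> has_cderiv g z m -> has_cderiv (fun t => f t + g t) z (l + m).
Proof.
  intros Hf Hg. apply has_cderiv_quotient in Hf, Hg.
  destruct Hf as [p [Hp [<- Ep]]]. destruct Hg as [q [Hq [<- Eq]]].
  apply has_cderiv_quotient. exists (fun t => p t + q t).
  split; [now apply ccont_plus|]. split; [reflexivity|].
  intros t. replace (f t + g t - (f z + g z)) with ((f t - f z) + (g t - g z)) by ring.
  rewrite Ep, Eq. ring.
Qed.

Lemma has_cderiv_mult (f g : C -> C) (z l m : C) :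
  has_cderiv f z l -> has_cderiv g z m ->
  has_cderiv (fun t => f t * g t) z (l * g z + f z * m).
Proof.
  intros Hf Hg. assert (Cg := has_cderiv_ccont _ _ _ Hg).
  apply has_cderiv_quotient in Hf, Hg.
  destruct Hf as [p [Hp [<- Ep]]]. destruct Hg as [q [Hq [<- Eq]]].
  apply has_cderiv_quotient. exists (fun t => p t * g t + f z * q t).
  split; [|split; [reflexivity|]].
  - apply ccont_plus; apply ccont_mult; auto. apply ccont_const.
  - intros t. replace (f t * g t - f z * g z) with ((f t - f z) * g t + f z * (g t - g z)) by ring.
    rewrite Ep, Eq. ring.
Qed.

Lemma has_cderiv_comp (f g : C -> C) (z l m : C) :
  has_cderiv g z m -> has_cderiv f (g z) l -> has_cderiv (fun t => f (g t)) z (l * m).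
Proof.
  intros Hg Hf. assert (Cg := has_cderiv_ccont _ _ _ Hg).
  apply has_cderiv_quotient in Hf, Hg.
  destruct Hf as [p [Hp [<- Ep]]]. destruct Hg as [q [Hq [<- Eq]]].
  apply has_cderiv_quotient. exists (fun t => p (g t) * q t).
  split; [|split; [reflexivity|]].
  - apply ccont_mult; auto. apply ccont_comp; auto.
  - intros t. rewrite Ep, Eq. ring.
Qed.

Lemma has_cderiv_inv (z : C) : z <> 0 -> has_cderiv (fun t => / t) z (- / (z * z)).
Proof.
  intros Hz e He.
  assert (K : ccont (fun t => - / z * / t) z).
  { apply ccont_mult; [apply ccont_const|now apply ccont_inv]. }
  assert (Hm : (0 < Cmod z)%R) by (apply Cmod_gt_0; exact Hz).
  destruct (K e He) as [d [Hd H]].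
  exists (Rmin d (Cmod z)). split; [now apply Rmin_pos|].
  intros t Ht.
  assert (A1 := Rlt_le_trans _ _ _ Ht (Rmin_l _ _)).
  assert (A2 := Rlt_le_trans _ _ _ Ht (Rmin_r _ _)).
  assert (Ht0 : t <> 0).
  { intros ->. revert A2. replace (0 - z) with (- z) by ring. rewrite Cmod_opp. lra. }
  replace (/ t - / z - - / (z * z) * (t - z)) with
    ((- / z * / t - - / z * / z) * (t - z)) by (field; auto).
  rewrite Cmod_mult. apply Rmult_le_compat_r; [apply Cmod_ge_0|]. left. auto.
Qed.

Lemma entire_cderiv (f : C -> C) : entire f <-> forall z, exists l, has_cderiv f z l.
Proof.
  split; intros H z; destruct (H z) as [l Hl]; exists l; now apply is_derive_cderiv.
Qed.

Lemma has_cderiv_C_derive (f : C -> C) (z l : C) : has_cderiv f z l -> C_derive f z = l.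
Proof. intros H. apply is_C_derive_unique. now apply is_derive_cderiv. Qed.

Lemma entire_C_derive (f : C -> C) (z : C) : entire f -> has_cderiv f z (C_derive f z).
Proof.
  intros H. apply entire_cderiv with (z := z) in H. destruct H as [l H].
  now rewrite (has_cderiv_C_derive _ _ _ H).
Qed.

Lemma entire_ccont (f : C -> C) (z : C) : entire f -> ccont f z.
Proof. intros H. eapply has_cderiv_ccont. now apply entire_C_derive. Qed.

Lemma entire_const (c : C) : entire (fun _ => c).
Proof. apply entire_cderiv. intros z. eexists. apply has_cderiv_const. Qed.

Lemma entire_id : entire (fun t => t).
Proof. apply entire_cderiv. intros z. eexists. apply has_cderiv_id. Qed.

Lemma entire_plus (f g : C -> C) : entire f -> entire g -> entire (fun t => f t + g t).
Proof.
  intros Hf Hg. apply entire_cderiv. intros z. eexists.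
  apply has_cderiv_plus; apply entire_C_derive; assumption.
Qed.

Lemma entire_mult (f g : C -> C) : entire f -> entire g -> entire (fun t => f t * g t).
Proof.
  intros Hf Hg. apply entire_cderiv. intros z. eexists.
  apply has_cderiv_mult; apply entire_C_derive; assumption.
Qed.

Lemma entire_comp (f g : C -> C) : entire f -> entire g -> entire (fun t => f (g t)).
Proof.
  intros Hf Hg. apply entire_cderiv. intros z. eexists.
  apply has_cderiv_comp; apply entire_C_derive; assumption.
Qed.

Lemma entire_pow (n : nat) : entire (fun t => t ^ n).
Proof.
  induction n as [|n IH]; [exact (entire_const 1)|].
  apply (entire_mult (fun t => t) (fun t => t ^ n)); [apply entire_id|exact IH].
Qed.

Lemma Cexp_plus (a b : C) : Cexp (a + b) = Cexp a * Cexp b.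
Proof.
  destruct a as [a1 a2], b as [b1 b2]. unfold Cexp, Cmult, Re, Im; simpl.
  rewrite exp_plus, cos_plus, sin_plus. f_equal; ring.
Qed.

Lemma Cexp_0 : Cexp 0 = 1.
Proof. unfold Cexp; simpl. rewrite exp_0, cos_0, sin_0. unfold RtoC. f_equal; ring. Qed.

Lemma Cmod_Cexp (z : C) : Cmod (Cexp z) = exp (Re z).
Proof.
  unfold Cexp, Cmod; simpl.
  replace (exp (Re z) * cos (Im z) * (exp (Re z) * cos (Im z) * 1) +
     exp (Re z) * sin (Im z) * (exp (Re z) * sin (Im z) * 1))%R
    with (Rsqr (exp (Re z)) * (Rsqr (sin (Im z)) + Rsqr (cos (Im z))))%R
    by (unfold Rsqr; ring).
  rewrite sin2_cos2, Rmult_1_r. apply sqrt_Rsqr. left. apply exp_pos.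
Qed.

Lemma derivable_pt_lim_0_bound (f : R -> R) (l eps : R) :
  derivable_pt_lim f 0 l -> (0 < eps)%R -> exists d, (0 < d)%R /\
  forall h, (Rabs h < d)%R -> (Rabs (f h - f 0 - l * h) <= eps * Rabs h)%R.
Proof.
  intros H He. destruct (H eps He) as [d Hd]. exists d. split; [apply cond_pos|].
  intros h Hh. destruct (Req_dec h 0) as [->|n].
  { replace (f 0 - f 0 - l * 0)%R with 0%R by ring. rewrite Rabs_R0. lra. }
  specialize (Hd h n Hh). rewrite Rplus_0_l in Hd.
  replace (f h - f 0 - l * h)%R with (((f h - f 0) / h - l) * h)%R by (field; exact n).
  rewrite Rabs_mult. apply Rmult_le_compat_r; [apply Rabs_pos|lra].
Qed.

Lemma Cmod_le_Rabs (z : C) : (Cmod z <= Rabs (Re z) + Rabs (Im z))%R.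
Proof.
  destruct z as [x y].
  replace (x, y) with (RtoC x + RtoC y * Ci)
    by (unfold RtoC, Ci, Cplus, Cmult; simpl; f_equal; ring).
  eapply Rle_trans; [apply Cmod_triangle|].
  rewrite Cmod_mult, Cmod_Ci, !Cmod_R. unfold Re, Im; simpl.
  replace (x + (y * 0 - 0 * 1))%R with x by ring.
  replace (0 + (y * 1 + 0 * 0))%R with y by ring. lra.
Qed.

Lemma im_le_Cmod (z : C) : (Rabs (Im z) <= Cmod z)%R.
Proof. eapply Rle_trans; [apply Rmax_r|]. apply Rmax_Cmod. Qed.

(** From the real derivatives of exp, sin and cos at 0; the functional equation
    carries the result to the other points. *)
Lemma has_cderiv_Cexp_0 : has_cderiv Cexp 0 1.
Proof.
  intros e He.
  set (e' := Rmin (e / 8) 1).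
  assert (He' : (0 < e')%R) by (apply Rmin_pos; lra).
  assert (e'8 : (8 * e' <= e)%R) by (generalize (Rmin_l (e / 8) 1); fold e'; lra).
  assert (e'1 : (e' <= 1)%R) by apply Rmin_r.
  destruct (derivable_pt_lim_0_bound exp 1 e' derivable_pt_lim_exp_0 He') as [d1 [Hd1 H1]].
  destruct (derivable_pt_lim_0_bound sin 1 e' derivable_pt_lim_sin_0 He') as [d2 [Hd2 H2]].
  destruct (derivable_pt_lim_0_bound cos 0 e' derivable_pt_lim_cos_0 He') as [d3 [Hd3 H3]].
  exists (Rmin (Rmin d1 d2) (Rmin d3 (e' / 2))). split.
  { repeat apply Rmin_pos; lra. }
  intros t Ht. rewrite Cexp_0.
  replace (t - 0) with t in * by ring.
  destruct t as [x y].
  assert (Bx := re_le_Cmod (x, y)). assert (By := im_le_Cmod (x, y)).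
  unfold Re, Im in Bx, By; simpl in Bx, By.
  set (m := Cmod (x, y)) in *.
  assert (L1 := Rlt_le_trans _ _ _ Ht (Rmin_l _ _)).
  assert (L2 := Rlt_le_trans _ _ _ Ht (Rmin_r _ _)).
  assert (La := Rlt_le_trans _ _ _ L1 (Rmin_l _ _)).
  assert (Lb := Rlt_le_trans _ _ _ L1 (Rmin_r _ _)).
  assert (Lc := Rlt_le_trans _ _ _ L2 (Rmin_l _ _)).
  assert (Ld := Rlt_le_trans _ _ _ L2 (Rmin_r _ _)).
  assert (K1 := H1 x (Rle_lt_trans _ _ _ Bx La)).
  assert (K2 := H2 y (Rle_lt_trans _ _ _ By Lb)).
  assert (K3 := H3 y (Rle_lt_trans _ _ _ By Lc)).
  rewrite exp_0 in K1. rewrite sin_0 in K2. rewrite cos_0 in K3.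
  assert (Mm : (0 <= m)%R) by apply Cmod_ge_0.
  assert (Ex : (Rabs (exp x - 1) <= e')%R).
  { replace (exp x - 1)%R with ((exp x - 1 - 1 * x) + x)%R by ring.
    eapply Rle_trans; [apply Rabs_triang|].
    assert (e' * Rabs x <= Rabs x)%R by (generalize (Rabs_pos x); nra). lra. }
  assert (E2 : (0 < exp x <= 2)%R).
  { split; [apply exp_pos|]. generalize (Rle_abs (exp x - 1)). lra. }
  eapply Rle_trans; [apply Cmod_le_Rabs|].
  unfold Cexp, Re, Im; simpl.
  replace (exp x * cos y + - (1) + - (1 * x - 0 * y))%R with
    (exp x * (cos y - 1 - 0 * y) + (exp x - 1 - 1 * x))%R by ring.
  replace (exp x * sin y + -0 + - (1 * y + 0 * x))%R with
    (exp x * (sin y - 0 - 1 * y) + (exp x - 1) * y)%R by ring.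
  eapply Rle_trans.
  { apply Rplus_le_compat; apply Rabs_triang. }
  rewrite !Rabs_mult. rewrite (Rabs_right (exp x)) by lra.
  generalize (Rabs_pos x) (Rabs_pos y) (Rabs_pos (exp x - 1)) (Rabs_pos (cos y - 1 - 0 * y))
    (Rabs_pos (sin y - 0 - 1 * y)). intros.
  assert (exp x * Rabs (cos y - 1 - 0 * y) <= 2 * (e' * m))%R.
  { apply Rmult_le_compat; try lra. nra. }
  assert (exp x * Rabs (sin y - 0 - 1 * y) <= 2 * (e' * m))%R.
  { apply Rmult_le_compat; try lra. nra. }
  assert (Rabs (exp x - 1) * Rabs y <= e' * m)%R.
  { apply Rmult_le_compat; try lra. }
  assert (e' * Rabs x <= e' * m)%R by nra.
  nra.
Qed.

Lemma has_cderiv_Cexp (z : C) : has_cderiv Cexp z (Cexp z).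
Proof.
  assert (H : has_cderiv (fun t => Cexp z * Cexp (t - z)) z
     (0 * Cexp (z - z) + Cexp z * (1 * (1 + 0)))).
  { apply (has_cderiv_mult (fun _ => Cexp z) (fun t => Cexp (t - z))); [apply has_cderiv_const|].
    apply (has_cderiv_comp Cexp (fun t => t - z)).
    - apply (has_cderiv_plus (fun t => t) (fun _ => - z)); [apply has_cderiv_id|apply has_cderiv_const].
    - replace (z - z) with (RtoC 0) by ring. apply has_cderiv_Cexp_0. }
  replace (0 * Cexp (z - z) + Cexp z * (1 * (1 + 0))) with (Cexp z) in H by ring.
  replace Cexp with (fun t => Cexp z * Cexp (t - z)) at 1; [exact H|].
  apply functional_extensionality; intros t. rewrite <- Cexp_plus. f_equal. ring.
Qed.

Lemma entire_Cexp : entire Cexp.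
Proof. apply entire_cderiv. intros z. eexists. apply has_cderiv_Cexp. Qed.

(** * Integrals along curves *)

(** Curves are integrated in C as a normed module over R, which has to be named
    because the canonical structure on C is the one over the complex numbers. *)
Definition is_CInt (f : R -> C) (a b : R) (l : C) : Prop :=
  is_RInt (V := C_R_NormedModule) f a b l.

Definition CInt (f : R -> C) (a b : R) : C :=
  RInt (V := C_R_CompleteNormedModule) f a b.

Definition curve_cont (f : R -> C) (x : R) : Prop :=
  continuous (T := R_UniformSpace) (U := C_UniformSpace) f x.

Definition curve_deriv (f : R -> C) (x : R) (l : C) : Prop :=
  is_derive (K := R_AbsRing) (V := C_R_NormedModule) f x l.

Lemma curve_cont_iff (f : R -> C) (x : R) :
  curve_cont f x <-> forall eps : R, (0 < eps)%R -> exists d : R, (0 < d)%R /\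
    forall y, (Rabs (y - x) < d)%R -> (Cmod (f y - f x) < eps)%R.
Proof.
  unfold curve_cont. rewrite continuous_C_iff. split; intros H e He.
  - destruct (H e He) as [d Hd]. exists d. split; [apply cond_pos|exact Hd].
  - destruct (H e He) as [d [Hd Hd']]. exists (mkposreal d Hd). exact Hd'.
Qed.

Lemma curve_deriv_iff (f : R -> C) (x : R) (l : C) :
  curve_deriv f x l <-> forall eps : R, (0 < eps)%R -> exists d : R, (0 < d)%R /\
    forall y, (Rabs (y - x) < d)%R ->
      (Cmod (f y - f x - l * RtoC (y - x)) <= eps * Rabs (y - x))%R.
Proof.
  assert (E : forall (a b : C_R_NormedModule) (c : R),
    norm (minus (minus a b) (scal c (l : C_R_NormedModule))) = Cmod ((a : C) - b - l * RtoC c)).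
  { intros a b c. etransitivity; [symmetry; apply Cmod_norm|]. apply f_equal.
    apply injective_projections; unfold minus; simpl; unfold plus, opp; simpl;
    [change (scal c (fst l)) with (c * fst l)%R|change (scal c (snd l)) with (c * snd l)%R]; ring. }
  split.
  - intros [_ H] eps Heps.
    specialize (H x (fun P HP => HP) (mkposreal eps Heps)).
    destruct H as [d Hd]. exists d. split; [apply cond_pos|].
    intros t Ht. specialize (Hd t Ht). eapply Rle_trans; [|exact Hd].
    right. symmetry. exact (E (f t) (f x) (t - x)%R).
  - intros H. split; [apply is_linear_scal_l|].
    intros y Hy.
    assert (y = x) as ->.
    { symmetry. apply is_filter_lim_locally_unique. exact Hy. }
    intros eps. destruct (H eps (cond_pos eps)) as [d [Hd Hd']].
    exists (mkposreal d Hd). intros t Ht. specialize (Hd' t Ht).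
    eapply Rle_trans; [|exact Hd']. right. exact (E (f t) (f x) (t - x)%R).
Qed.

Lemma curve_deriv_cont (f : R -> C) (x : R) (l : C) : curve_deriv f x l -> curve_cont f x.
Proof.
  intros H. exact (ex_derive_continuous (V := C_R_NormedModule) f x (ex_intro _ l H)).
Qed.

Lemma curve_deriv_comp (g : C -> C) (f : R -> C) (x : R) (l m : C) :
  curve_deriv f x l -> has_cderiv g (f x) m -> curve_deriv (fun t => g (f t)) x (m * l).
Proof.
  intros Hf Hg. assert (Hc := curve_deriv_cont _ _ _ Hf).
  rewrite curve_deriv_iff in Hf |- *. rewrite curve_cont_iff in Hc.
  intros e He.
  set (N := (Cmod l + Cmod m + 1)%R).
  assert (HN : (1 <= N)%R) by (unfold N; generalize (Cmod_ge_0 l) (Cmod_ge_0 m); lra).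
  set (e' := Rmin 1 (e / (2 * N))).
  assert (He' : (0 < e')%R).
  { apply Rmin_pos; [lra|]. apply Rdiv_lt_0_compat; lra. }
  assert (He2 : (2 * N * e' <= e)%R).
  { apply Rle_trans with (2 * N * (e / (2 * N)))%R.
    - apply Rmult_le_compat_l; [lra|]. apply Rmin_r.
    - right. field. lra. }
  assert (He1 : (e' <= 1)%R) by apply Rmin_l.
  destruct (Hg e' He') as [d1 [Hd1 H1]].
  destruct (Hf e' He') as [d2 [Hd2 H2]].
  destruct (Hc d1 Hd1) as [d3 [Hd3 H3]].
  exists (Rmin d2 d3). split; [now apply Rmin_pos|]. intros y Hy.
  assert (A2 := H2 y (Rlt_le_trans _ _ _ Hy (Rmin_l _ _))).
  assert (A3 := H1 _ (H3 y (Rlt_le_trans _ _ _ Hy (Rmin_r _ _)))).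
  replace (g (f y) - g (f x) - m * l * RtoC (y - x)) with
    ((g (f y) - g (f x) - m * (f y - f x)) + m * (f y - f x - l * RtoC (y - x))) by ring.
  eapply Rle_trans; [apply Cmod_triangle|]. rewrite Cmod_mult.
  assert (A4 : (Cmod (f y - f x) <= N * Rabs (y - x))%R).
  { replace (f y - f x) with ((f y - f x - l * RtoC (y - x)) + l * RtoC (y - x)) by ring.
    eapply Rle_trans; [apply Cmod_triangle|]. rewrite Cmod_mult, Cmod_R.
    generalize (Rabs_pos (y - x)) (Cmod_ge_0 m). unfold N. intros. nra. }
  assert (Cmod m * Cmod (f y - f x - l * RtoC (y - x)) <= N * (e' * Rabs (y - x)))%R.
  { apply Rmult_le_compat; try apply Cmod_ge_0; auto. unfold N. generalize (Cmod_ge_0 l). lra. }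
  assert (e' * Cmod (f y - f x) <= e' * (N * Rabs (y - x)))%R by (apply Rmult_le_compat_l; lra).
  generalize (Rabs_pos (y - x)). intros. nra.
Qed.

Lemma curve_deriv_affine (a b : C) (x : R) :
  curve_deriv (fun t => a + RtoC t * b) x b.
Proof.
  apply curve_deriv_iff. intros e He. exists 1%R. split; [lra|]. intros y _.
  replace (a + RtoC y * b - (a + RtoC x * b) - b * RtoC (y - x)) with (RtoC 0)
    by (rewrite RtoC_minus; ring).
  rewrite Cmod_0. apply Rmult_le_pos; [lra|apply Rabs_pos].
Qed.

Lemma curve_cont_comp (g : C -> C) (f : R -> C) (x : R) :
  curve_cont f x -> ccont g (f x) -> curve_cont (fun t => g (f t)) x.
Proof.
  intros Hf Hg. rewrite curve_cont_iff in Hf |- *. intros e He.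
  destruct (Hg e He) as [d [Hd H]]. destruct (Hf d Hd) as [d' [Hd' H']].
  exists d'. auto.
Qed.

Lemma curve_cont_const (c : C) (x : R) : curve_cont (fun _ => c) x.
Proof. apply continuous_const. Qed.

Lemma curve_cont_plus (f g : R -> C) (x : R) :
  curve_cont f x -> curve_cont g x -> curve_cont (fun t => f t + g t) x.
Proof. exact (continuous_plus (V := C_R_NormedModule) f g x). Qed.

Lemma curve_cont_mult (f g : R -> C) (x : R) :
  curve_cont f x -> curve_cont g x -> curve_cont (fun t => f t * g t) x.
Proof. apply continuous_Cmult. Qed.

Definition curve_cont_on (f : R -> C) (a b : R) : Prop :=
  forall x, (a <= x <= b)%R -> curve_cont f x.

Lemma CInt_correct (f : R -> C) (a b : R) :
  (a <= b)%R -> curve_cont_on f a b -> is_CInt f a b (CInt f a b).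
Proof.
  intros Hab H. apply (RInt_correct (V := C_R_CompleteNormedModule)).
  apply (ex_RInt_continuous (V := C_R_CompleteNormedModule)).
  intros x Hx. rewrite Rmin_left, Rmax_right in Hx by exact Hab. apply H. exact Hx.
Qed.

Lemma is_CInt_unique (f : R -> C) (a b : R) (l : C) : is_CInt f a b l -> CInt f a b = l.
Proof. apply (is_RInt_unique (V := C_R_CompleteNormedModule)). Qed.

Lemma CInt_ext (f g : R -> C) (a b : R) :
  (a <= b)%R -> (forall x, (a <= x <= b)%R -> f x = g x) -> CInt f a b = CInt g a b.
Proof.
  intros Hab H. apply (RInt_ext (V := C_R_CompleteNormedModule)).
  intros x Hx. rewrite Rmin_left, Rmax_right in Hx by exact Hab. apply H.
  destruct Hx. split; left; assumption.
Qed.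

Lemma CInt_Chasles (f : R -> C) (a b c : R) :
  (a <= b <= c)%R -> curve_cont_on f a c -> CInt f a c = CInt f a b + CInt f b c.
Proof.
  intros Hab H. apply is_CInt_unique.
  apply (is_RInt_Chasles (V := C_R_NormedModule) f a b c); apply CInt_correct; try apply Hab;
  intros x Hx; apply H; lra.
Qed.

Lemma CInt_plus (f g : R -> C) (a b : R) :
  (a <= b)%R -> curve_cont_on f a b -> curve_cont_on g a b ->
  CInt (fun x => f x + g x) a b = CInt f a b + CInt g a b.
Proof.
  intros Hab Hf Hg. apply is_CInt_unique.
  apply (is_RInt_plus (V := C_R_NormedModule) f g); now apply CInt_correct.
Qed.

Lemma CInt_scal (c : C) (f : R -> C) (a b : R) :
  (a <= b)%R -> curve_cont_on f a b -> CInt (fun x => c * f x) a b = c * CInt f a b.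
Proof.
  intros Hab Hf. apply is_CInt_unique.
  assert (H := CInt_correct f a b Hab Hf).
  assert (H1 := is_RInt_fct_extend_fst (U := R_NormedModule) (V := R_NormedModule) f a b _ H).
  assert (H2 := is_RInt_fct_extend_snd (U := R_NormedModule) (V := R_NormedModule) f a b _ H).
  set (I := CInt f a b) in *.
  unfold is_CInt, C_R_NormedModule.
  apply (is_RInt_fct_extend_pair (U := R_NormedModule) (V := R_NormedModule)); simpl.
  - apply (is_RInt_minus (V := R_NormedModule) (fun t => (fst c * fst (f t))%R)
             (fun t => (snd c * snd (f t))%R)).
    + exact (is_RInt_scal (V := R_NormedModule) _ a b (fst c) _ H1).
    + exact (is_RInt_scal (V := R_NormedModule) _ a b (snd c) _ H2).
  - apply (is_RInt_plus (V := R_NormedModule) (fun t => (fst c * snd (f t))%R)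
             (fun t => (snd c * fst (f t))%R)).
    + exact (is_RInt_scal (V := R_NormedModule) _ a b (fst c) _ H2).
    + exact (is_RInt_scal (V := R_NormedModule) _ a b (snd c) _ H1).
Qed.

Lemma CInt_bound (f : R -> C) (a b M : R) :
  (a <= b)%R -> curve_cont_on f a b -> (forall x, (a <= x <= b)%R -> (Cmod (f x) <= M)%R) ->
  (Cmod (CInt f a b) <= (b - a) * M)%R.
Proof.
  intros Hab Hf HM. rewrite Cmod_norm.
  apply (norm_RInt_le_const (V := C_R_NormedModule) f a b).
  - exact Hab.
  - intros x Hx. eapply Rle_trans; [|exact (HM x Hx)]. right. symmetry. apply Cmod_norm.
  - now apply CInt_correct.
Qed.

Lemma CInt_minus_bound (f g : R -> C) (a b M : R) :
  (a <= b)%R -> curve_cont_on f a b -> curve_cont_on g a b ->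
  (forall x, (a <= x <= b)%R -> (Cmod (f x - g x) <= M)%R) ->
  (Cmod (CInt f a b - CInt g a b) <= (b - a) * M)%R.
Proof.
  intros Hab Hf Hg HM.
  assert (Hg' : curve_cont_on (fun x => - (1) * g x) a b).
  { intros x Hx. apply (curve_cont_mult (fun _ => - (1))); [apply curve_cont_const|now apply Hg]. }
  replace (CInt f a b - CInt g a b) with (CInt (fun x => f x + - (1) * g x) a b).
  - apply CInt_bound; [exact Hab| |].
    + intros x Hx. apply curve_cont_plus; [now apply Hf|now apply Hg'].
    + intros x Hx. replace (f x + - (1) * g x) with (f x - g x) by ring. now apply HM.
  - rewrite CInt_plus, CInt_scal by assumption. ring.
Qed.

Lemma CInt_derive (f df : R -> C) (a b : R) :
  (a <= b)%R -> (forall x, (a <= x <= b)%R -> curve_deriv f x (df x)) ->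
  curve_cont_on df a b -> CInt df a b = f b - f a.
Proof.
  intros Hab Hd Hc. apply is_CInt_unique.
  apply (is_RInt_derive (V := C_R_CompleteNormedModule) f df a b);
  intros x Hx; rewrite Rmin_left, Rmax_right in Hx by exact Hab.
  - now apply Hd.
  - now apply Hc.
Qed.

(** * Goursat's theorem *)

(** Nested squares, each of them one quarter of the preceding one, shrink to (X, Y).
    The predicate B is that of being a bad square. *)
Lemma square_bisection (B : R -> R -> R -> Prop) :
  B 0%R 0%R 1%R ->
  (forall x y h, (0 < h)%R -> (0 <= x)%R -> (x + h <= 1)%R -> (0 <= y)%R -> (y + h <= 1)%R ->
     B x y h -> B x y (h / 2)%R \/ B (x + h / 2)%R y (h / 2)%R \/
     B x (y + h / 2)%R (h / 2)%R \/ B (x + h / 2)%R (y + h / 2)%R (h / 2)%R) ->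
  exists X Y, (0 <= X <= 1)%R /\ (0 <= Y <= 1)%R /\
    forall eta, (0 < eta)%R -> exists x y h, (0 < h < eta)%R /\
      (0 <= x)%R /\ (x + h <= 1)%R /\ (0 <= y)%R /\ (y + h <= 1)%R /\
      (x <= X <= x + h)%R /\ (y <= Y <= y + h)%R /\ B x y h.
Proof.
  intros B0 Hstep.
  set (good := fun (n : nat) (s : R * R) =>
    (0 <= fst s)%R /\ (fst s + / 2 ^ n <= 1)%R /\ (0 <= snd s)%R /\ (snd s + / 2 ^ n <= 1)%R /\
    B (fst s) (snd s) (/ 2 ^ n)%R).
  set (next := fun (n : nat) (s s' : R * R) =>
    good (S n) s' /\ (fst s <= fst s')%R /\ (snd s <= snd s')%R /\
    (fst s' + / 2 ^ S n <= fst s + / 2 ^ n)%R /\ (snd s' + / 2 ^ S n <= snd s + / 2 ^ n)%R).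
  assert (P2 : forall n, (0 < / 2 ^ n)%R).
  { intros n. apply Rinv_0_lt_compat. apply pow_lt. lra. }
  assert (H2 : forall n, (/ 2 ^ S n = / 2 ^ n / 2)%R).
  { intros n. simpl. rewrite Rinv_mult. field. apply pow_nonzero. lra. }
  assert (Hn : forall n s, exists s', good n s -> next n s s').
  { intros n [x y]. destruct (classic (good n (x, y))) as [G|G].
    2:{ exists (x, y). intros G'. now elim G. }
    destruct G as (Gx & Gx' & Gy & Gy' & GB). cbn [fst snd] in Gx, Gx', Gy, Gy', GB.
    assert (P := P2 n). unfold next, good. rewrite !H2.
    destruct (Hstep x y (/ 2 ^ n)%R P Gx Gx' Gy Gy' GB) as [K|[K|[K|K]]].
    - exists (x, y); cbn [fst snd]; intros _. repeat split; try lra. exact K.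
    - exists (x + / 2 ^ n / 2, y)%R; cbn [fst snd]; intros _. repeat split; try lra. exact K.
    - exists (x, y + / 2 ^ n / 2)%R; cbn [fst snd]; intros _. repeat split; try lra. exact K.
    - exists (x + / 2 ^ n / 2, y + / 2 ^ n / 2)%R; cbn [fst snd]; intros _. repeat split; try lra. exact K. }
  set (F := fun n s => proj1_sig (constructive_indefinite_description _ (Hn n s))).
  assert (HF : forall n s, good n s -> next n s (F n s)).
  { intros n s. exact (proj2_sig (constructive_indefinite_description _ (Hn n s))). }
  set (u := fix u n := match n with O => (0%R, 0%R) | S m => F m (u m) end).
  assert (Hu : forall n, good n (u n)).
  { induction n as [|n IH].
    - unfold good; simpl. rewrite Rinv_1. repeat split; try lra. exact B0.
    - simpl. apply HF. exact IH. }
  assert (Hu' : forall n, next n (u n) (u (S n))) by (intros n; apply (HF n (u n)); apply Hu).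
  assert (mono : forall n k, (fst (u n) <= fst (u (n + k)%nat))%R /\ (snd (u n) <= snd (u (n + k)%nat))%R /\
    (fst (u (n + k)%nat) + / 2 ^ (n + k) <= fst (u n) + / 2 ^ n)%R /\
    (snd (u (n + k)%nat) + / 2 ^ (n + k) <= snd (u n) + / 2 ^ n)%R).
  { intros n k. induction k as [|k IH].
    - rewrite Nat.add_0_r. lra.
    - rewrite Nat.add_succ_r. generalize (Hu' (n + k)%nat). unfold next. lra. }
  assert (ub : forall n m, (fst (u m) <= fst (u n) + / 2 ^ n)%R /\ (snd (u m) <= snd (u n) + / 2 ^ n)%R).
  { intros n m. destruct (Nat.le_ge_cases n m) as [L|L].
    - generalize (mono n (m - n)%nat). replace (n + (m - n))%nat with m by lia.
      generalize (P2 m). lra.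
    - generalize (mono m (n - m)%nat). replace (m + (n - m))%nat with n by lia.
      generalize (P2 n). lra. }
  destruct (completeness (fun r => exists n, r = fst (u n))) as [X [HX1 HX2]].
  { exists (fst (u O) + / 2 ^ 0)%R. intros r [n ->]. apply ub. }
  { now exists (fst (u O)), O. }
  destruct (completeness (fun r => exists n, r = snd (u n))) as [Y [HY1 HY2]].
  { exists (snd (u O) + / 2 ^ 0)%R. intros r [n ->]. apply ub. }
  { now exists (snd (u O)), O. }
  assert (IX : forall n, (fst (u n) <= X <= fst (u n) + / 2 ^ n)%R).
  { intros n. split; [apply HX1; eauto|]. apply HX2. intros r [m ->]. apply ub. }
  assert (IY : forall n, (snd (u n) <= Y <= snd (u n) + / 2 ^ n)%R).
  { intros n. split; [apply HY1; eauto|]. apply HY2. intros r [m ->]. apply ub. }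
  exists X, Y. split; [|split].
  - generalize (IX O) (Hu O). unfold good. simpl. lra.
  - generalize (IY O) (Hu O). unfold good. simpl. lra.
  - intros eta Heta.
    destruct (pow_lt_1_zero (/ 2)) with (y := eta) as [n Hn'].
    { rewrite Rabs_right; lra. }
    { exact Heta. }
    specialize (Hn' n (Nat.le_refl n)). rewrite pow_inv in Hn'.
    rewrite Rabs_right in Hn' by (generalize (P2 n); lra).
    exists (fst (u n)), (snd (u n)), (/ 2 ^ n)%R.
    generalize (P2 n) (Hu n) (IX n) (IY n). unfold good. tauto.
Qed.

Definition edge1 (g : C -> C) (T T1 : R -> R -> C) (a b y : R) : C :=
  CInt (fun x => g (T x y) * T1 x y) a b.
Definition edge2 (g : C -> C) (T T2 : R -> R -> C) (x c d : R) : C :=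
  CInt (fun y => g (T x y) * T2 x y) c d.
Definition contour (g : C -> C) (T T1 T2 : R -> R -> C) (x y h : R) : C :=
  edge1 g T T1 x (x + h) y + edge2 g T T2 (x + h) y (y + h)
  - edge1 g T T1 x (x + h) (y + h) - edge2 g T T2 x y (y + h).

(** A parametrised square rather than a rectangle in the plane: the contraction of
    a circle to a point has this form, so that Goursat's argument applies to it
    directly and gives the invariance of the integral. *)
Record smooth_square (T T1 T2 : R -> R -> C) (L : R) : Prop := {
  sq_d1 : forall x y, curve_deriv (fun x => T x y) x (T1 x y);
  sq_d2 : forall x y, curve_deriv (fun y => T x y) y (T2 x y);
  sq_c1 : forall x y, curve_cont (fun x => T1 x y) x;
  sq_c2 : forall x y, curve_cont (fun y => T2 x y) y;
  sq_L : (0 < L)%R;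
  sq_b1 : forall x y, (0 <= x <= 1)%R -> (0 <= y <= 1)%R -> (Cmod (T1 x y) <= L)%R;
  sq_b2 : forall x y, (0 <= x <= 1)%R -> (0 <= y <= 1)%R -> (Cmod (T2 x y) <= L)%R }.

Lemma curve_deriv_lipschitz (f df : R -> C) (L a b : R) :
  (a <= b)%R -> (forall x, curve_deriv f x (df x)) -> (forall x, curve_cont df x) ->
  (forall x, (a <= x <= b)%R -> (Cmod (df x) <= L)%R) ->
  forall u v, (a <= u <= b)%R -> (a <= v <= b)%R -> (Cmod (f v - f u) <= L * Rabs (v - u))%R.
Proof.
  intros Hab Hd Hc HL.
  assert (K : forall u v, (a <= u)%R -> (u <= v)%R -> (v <= b)%R -> (Cmod (f v - f u) <= L * (v - u))%R).
  { intros u v Hu Huv Hv. rewrite <- (CInt_derive f df u v).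
    - rewrite Rmult_comm. apply CInt_bound; [exact Huv| |].
      + intros x _. apply Hc.
      + intros x Hx. apply HL. lra.
    - exact Huv.
    - intros x _. apply Hd.
    - intros x _. apply Hc. }
  intros u v Hu Hv. destruct (Rle_dec u v) as [H|H].
  - rewrite Rabs_right by lra. apply K; lra.
  - rewrite Cmod_minus_sym, Rabs_minus_sym, Rabs_right by lra. apply K; lra.
Qed.

Section Goursat_lemmas.

Context {T T1 T2 : R -> R -> C} {L : R} (HT : smooth_square T T1 T2 L).

Lemma square_lipschitz (x y X Y : R) :
  (0 <= x <= 1)%R -> (0 <= y <= 1)%R -> (0 <= X <= 1)%R -> (0 <= Y <= 1)%R ->
  (Cmod (T x y - T X Y) <= L * (Rabs (x - X) + Rabs (y - Y)))%R.
Proof.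
  intros Hx Hy HX HY.
  replace (T x y - T X Y) with ((T x y - T X y) + (T X y - T X Y)) by ring.
  eapply Rle_trans; [apply Cmod_triangle|]. rewrite Rmult_plus_distr_l.
  apply Rplus_le_compat.
  - apply (curve_deriv_lipschitz (fun x => T x y) (fun x => T1 x y) L 0 1); try lra.
    + intros; apply (sq_d1 _ _ _ _ HT).
    + intros; apply (sq_c1 _ _ _ _ HT).
    + intros; now apply (sq_b1 _ _ _ _ HT).
  - apply (curve_deriv_lipschitz (fun y => T X y) (fun y => T2 X y) L 0 1); try lra.
    + intros; apply (sq_d2 _ _ _ _ HT).
    + intros; apply (sq_c2 _ _ _ _ HT).
    + intros; now apply (sq_b2 _ _ _ _ HT).
Qed.

Lemma edge1_cont (g : C -> C) (a b y : R) :
  (forall x, (a <= x <= b)%R -> ccont g (T x y)) ->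
  curve_cont_on (fun x => g (T x y) * T1 x y) a b.
Proof.
  intros H x Hx. apply curve_cont_mult.
  - apply (curve_cont_comp g (fun x => T x y)); [|now apply H].
    eapply curve_deriv_cont. apply (sq_d1 _ _ _ _ HT).
  - apply (sq_c1 _ _ _ _ HT).
Qed.

Lemma edge2_cont (g : C -> C) (x c d : R) :
  (forall y, (c <= y <= d)%R -> ccont g (T x y)) ->
  curve_cont_on (fun y => g (T x y) * T2 x y) c d.
Proof.
  intros H y Hy. apply curve_cont_mult.
  - apply (curve_cont_comp g (fun y => T x y)); [|now apply H].
    eapply curve_deriv_cont. apply (sq_d2 _ _ _ _ HT).
  - apply (sq_c2 _ _ _ _ HT).
Qed.

Lemma contour_split (g : C -> C) (x y h : R) :
  (0 < h)%R ->
  (forall u v, (x <= u <= x + h)%R -> (y <= v <= y + h)%R -> ccont g (T u v)) ->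
  contour g T T1 T2 x y h =
    contour g T T1 T2 x y (h / 2) + contour g T T1 T2 (x + h / 2) y (h / 2)
    + contour g T T1 T2 x (y + h / 2) (h / 2)
    + contour g T T1 T2 (x + h / 2) (y + h / 2) (h / 2).
Proof.
  intros Hh Hg. unfold contour.
  replace (x + h / 2 + h / 2)%R with (x + h)%R by field.
  replace (y + h / 2 + h / 2)%R with (y + h)%R by field.
  assert (A : forall v, (y <= v <= y + h)%R ->
    edge1 g T T1 x (x + h) v = edge1 g T T1 x (x + h / 2) v + edge1 g T T1 (x + h / 2) (x + h) v).
  { intros v Hv. apply CInt_Chasles; [lra|]. apply edge1_cont. intros; now apply Hg. }
  assert (B : forall u, (x <= u <= x + h)%R ->
    edge2 g T T2 u y (y + h) = edge2 g T T2 u y (y + h / 2) + edge2 g T T2 u (y + h / 2) (y + h)).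
  { intros u Hu. apply CInt_Chasles; [lra|]. apply edge2_cont. intros; now apply Hg. }
  rewrite !A, !B by lra. ring.
Qed.

(** An affine function has a primitive, so the four edges telescope. *)
Lemma contour_affine (p a b : C) (x y h : R) :
  (0 < h)%R -> contour (fun t => a + b * (t - p)) T T1 T2 x y h = 0.
Proof.
  intros Hh.
  set (Psi := fun t => a * t + / 2 * b * ((t - p) * (t - p))).
  assert (dPsi : forall t, has_cderiv Psi t (a + b * (t - p))).
  { intros t.
    assert (D : has_cderiv (fun t => t - p) t (1 + 0)).
    { apply (has_cderiv_plus (fun t => t) (fun _ => - p)); [apply has_cderiv_id|apply has_cderiv_const]. }
    replace (a + b * (t - p)) with
      ((0 * t + a * 1) + (0 * ((t - p) * (t - p)) + / 2 * b * ((1 + 0) * (t - p) + (t - p) * (1 + 0))))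
      by (field; intros E; injection E; lra).
    apply (has_cderiv_plus (fun t => a * t)).
    - apply (has_cderiv_mult (fun _ => a) (fun t => t)); [apply has_cderiv_const|apply has_cderiv_id].
    - apply (has_cderiv_mult (fun _ => / 2 * b) (fun t => (t - p) * (t - p))); [apply has_cderiv_const|].
      now apply (has_cderiv_mult (fun t => t - p) (fun t => t - p)). }
  assert (cg : forall t, ccont (fun t => a + b * (t - p)) t).
  { intros t. apply ccont_plus; [apply ccont_const|]. apply ccont_mult; [apply ccont_const|].
    apply ccont_plus; [apply ccont_id|apply ccont_const]. }
  assert (A : forall c d v, (c <= d)%R ->
    edge1 (fun t => a + b * (t - p)) T T1 c d v = Psi (T d v) - Psi (T c v)).
  { intros c d v Hcd. unfold edge1. apply (CInt_derive (fun x => Psi (T x v))); [exact Hcd| |].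
    - intros u _. apply (curve_deriv_comp Psi (fun u => T u v)); [apply (sq_d1 _ _ _ _ HT)|apply dPsi].
    - apply (edge1_cont (fun t => a + b * (t - p))). intros; apply cg. }
  assert (B : forall c d u, (c <= d)%R ->
    edge2 (fun t => a + b * (t - p)) T T2 u c d = Psi (T u d) - Psi (T u c)).
  { intros c d u Hcd. unfold edge2. apply (CInt_derive (fun y => Psi (T u y))); [exact Hcd| |].
    - intros v _. apply (curve_deriv_comp Psi (fun v => T u v)); [apply (sq_d2 _ _ _ _ HT)|apply dPsi].
    - apply (edge2_cont (fun t => a + b * (t - p))). intros; apply cg. }
  unfold contour. rewrite !A, !B by lra. ring.
Qed.

Lemma contour_diff_bound (f g : C -> C) (x y h M : R) :
  (0 < h)%R -> (0 <= x)%R -> (x + h <= 1)%R -> (0 <= y)%R -> (y + h <= 1)%R ->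
  (forall u v, (x <= u <= x + h)%R -> (y <= v <= y + h)%R -> ccont f (T u v)) ->
  (forall u v, (x <= u <= x + h)%R -> (y <= v <= y + h)%R -> ccont g (T u v)) ->
  (forall u v, (x <= u <= x + h)%R -> (y <= v <= y + h)%R ->
     (Cmod (f (T u v) - g (T u v)) <= M)%R) ->
  (Cmod (contour f T T1 T2 x y h - contour g T T1 T2 x y h) <= 4 * (h * (M * L)))%R.
Proof.
  intros Hh Hx Hx' Hy Hy' Cf Cg HM.
  assert (A : forall v, (y <= v <= y + h)%R ->
    (Cmod (edge1 f T T1 x (x + h) v - edge1 g T T1 x (x + h) v) <= h * (M * L))%R).
  { intros v Hv. unfold edge1. replace h with (x + h - x)%R at 3 by ring.
    apply CInt_minus_bound; [lra| | |].
    - apply edge1_cont. intros; now apply Cf.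
    - apply edge1_cont. intros; now apply Cg.
    - intros u Hu. replace (f (T u v) * T1 u v - g (T u v) * T1 u v)
        with ((f (T u v) - g (T u v)) * T1 u v) by ring.
      rewrite Cmod_mult. apply Rmult_le_compat; try apply Cmod_ge_0; [now apply HM|].
      apply (sq_b1 _ _ _ _ HT); lra. }
  assert (B : forall u, (x <= u <= x + h)%R ->
    (Cmod (edge2 f T T2 u y (y + h) - edge2 g T T2 u y (y + h)) <= h * (M * L))%R).
  { intros u Hu. unfold edge2. replace h with (y + h - y)%R at 3 by ring.
    apply CInt_minus_bound; [lra| | |].
    - apply edge2_cont. intros; now apply Cf.
    - apply edge2_cont. intros; now apply Cg.
    - intros v Hv. replace (f (T u v) * T2 u v - g (T u v) * T2 u v)
        with ((f (T u v) - g (T u v)) * T2 u v) by ring.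
      rewrite Cmod_mult. apply Rmult_le_compat; try apply Cmod_ge_0; [now apply HM|].
      apply (sq_b2 _ _ _ _ HT); lra. }
  unfold contour.
  set (a1 := edge1 f _ _ _ _ y). set (b1 := edge1 g _ _ _ _ y).
  set (a2 := edge2 f _ _ (x + h) _ _). set (b2 := edge2 g _ _ (x + h) _ _).
  set (a3 := edge1 f _ _ _ _ (y + h)). set (b3 := edge1 g _ _ _ _ (y + h)).
  set (a4 := edge2 f _ _ x _ _). set (b4 := edge2 g _ _ x _ _).
  replace (a1 + a2 - a3 - a4 - (b1 + b2 - b3 - b4)) with
    ((a1 - b1) + (a2 - b2) - (a3 - b3) - (a4 - b4)) by ring.
  assert (K1 := A y ltac:(lra)). assert (K2 := B (x + h)%R ltac:(lra)).
  assert (K3 := A (y + h)%R ltac:(lra)). assert (K4 := B x ltac:(lra)).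
  fold a1 b1 in K1. fold a2 b2 in K2. fold a3 b3 in K3. fold a4 b4 in K4.
  generalize (Cmod_minus_le (a1 - b1 + (a2 - b2) - (a3 - b3)) (a4 - b4))
    (Cmod_minus_le (a1 - b1 + (a2 - b2)) (a3 - b3)) (Cmod_triangle (a1 - b1) (a2 - b2)). lra.
Qed.

(** If the integral has modulus eta > 0, bisection finds squares of side h, shrinking
    to one point, over which it is at least eta h^2. Near the image of that point g is
    affine up to o(h) on a contour of length O(h), and the affine part contributes
    nothing, so the integral is o(h^2): a contradiction. *)
Theorem goursat (g : C -> C) :
  (forall x y, (0 <= x <= 1)%R -> (0 <= y <= 1)%R -> exists l, has_cderiv g (T x y) l) ->
  contour g T T1 T2 0 0 1 = 0.
Proof.
  intros Hg. apply NNPP. intros Hne.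
  assert (Cg : forall x y, (0 <= x <= 1)%R -> (0 <= y <= 1)%R -> ccont g (T x y)).
  { intros x y Hx Hy. destruct (Hg x y Hx Hy) as [l Hl]. exact (has_cderiv_ccont _ _ _ Hl). }
  set (J := contour g T T1 T2) in *.
  assert (HJ : (0 < Cmod (J 0 0 1))%R) by (apply Cmod_gt_0; exact Hne).
  set (eta := Cmod (J 0 0 1)%R) in *.
  destruct (square_bisection (fun x y h => eta * (h * h) <= Cmod (J x y h))%R)
    as (X & Y & HX & HY & Hlim).
  - unfold eta. right. ring.
  - intros x y h Hh Hx Hx' Hy Hy' HB.
    apply NNPP. intros N. apply not_or_and in N. destruct N as [N1 N].
    apply not_or_and in N. destruct N as [N2 N]. apply not_or_and in N. destruct N as [N3 N4].
    apply Rnot_le_lt in N1, N2, N3, N4. revert HB. apply Rlt_not_le.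
    unfold J at 1. rewrite contour_split; [|exact Hh|intros; apply Cg; lra]. fold J.
    eapply Rle_lt_trans; [apply Cmod_triangle|].
    eapply Rle_lt_trans; [apply Rplus_le_compat_r, Cmod_triangle|].
    eapply Rle_lt_trans; [apply Rplus_le_compat_r, Rplus_le_compat_r, Cmod_triangle|].
    lra.
  - destruct (Hg X Y HX HY) as [l Hl].
    assert (LP := sq_L _ _ _ _ HT).
    set (e := (eta / (16 * (L * L)))%R).
    assert (He : (0 < e)%R).
    { apply Rdiv_lt_0_compat; [exact HJ|]. nra. }
    destruct (Hl e He) as [d [Hd Hd']].
    destruct (Hlim (d / (2 * L))%R) as (x & y & h & [Hh Hh'] & Hx & Hx' & Hy & Hy' & IX & IY & HB).
    { apply Rdiv_lt_0_compat; lra. }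
    assert (Hh2 : (2 * L * h < d)%R).
    { apply Rmult_lt_reg_l with (/ (2 * L))%R; [apply Rinv_0_lt_compat; lra|].
      rewrite <- Rmult_assoc, Rinv_l, Rmult_1_l by lra. rewrite Rmult_comm. exact Hh'. }
    assert (K : (Cmod (J x y h - contour (fun t => g (T X Y) + l * (t - T X Y))%C T T1 T2 x y h)
                 <= 4 * (h * (e * (2 * L * h) * L)))%R).
    { apply contour_diff_bound; try assumption.
      - intros; apply Cg; lra.
      - intros. apply ccont_plus; [apply ccont_const|]. apply ccont_mult; [apply ccont_const|].
        apply ccont_plus; [apply ccont_id|apply ccont_const].
      - intros u v Hu Hv.
        assert (D : (Cmod (T u v - T X Y) <= 2 * L * h)%R).
        { eapply Rle_trans; [apply square_lipschitz; lra|].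
          replace (2 * L * h)%R with (L * (h + h))%R by ring.
          apply Rmult_le_compat_l; [lra|].
          apply Rplus_le_compat; apply Rabs_le; lra. }
        replace (g (T u v) - (g (T X Y) + l * (T u v - T X Y))) with
          (g (T u v) - g (T X Y) - l * (T u v - T X Y)) by ring.
        eapply Rle_trans; [apply Hd'; lra|]. apply Rmult_le_compat_l; lra. }
    rewrite contour_affine in K by exact Hh.
    replace (J x y h - 0) with (J x y h) in K by ring.
    replace (4 * (h * (e * (2 * L * h) * L)))%R with (eta / 2 * (h * h))%R in K
      by (unfold e; field; lra).
    assert (0 < h * h)%R by nra. nra.
Qed.

End Goursat_lemmas.

(** * Cauchy's formula and Taylor expansion *)

Fixpoint csum (u : nat -> C) (n : nat) : C :=
  match n with O => 0 | S m => csum u m + u m end.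

Lemma csum_ext (u v : nat -> C) (n : nat) :
  (forall k, (k < n)%nat -> u k = v k) -> csum u n = csum v n.
Proof.
  induction n as [|n IH]; intros H; [reflexivity|]. simpl. rewrite IH, H; auto.
Qed.

Lemma csum_plus (u v : nat -> C) (n : nat) :
  csum (fun k => u k + v k) n = csum u n + csum v n.
Proof. induction n as [|n IH]; simpl; [ring|]. rewrite IH. ring. Qed.

Lemma csum_scal (c : C) (u : nat -> C) (n : nat) :
  csum (fun k => c * u k) n = c * csum u n.
Proof. induction n as [|n IH]; simpl; [ring|]. rewrite IH. ring. Qed.

Lemma csum_sum_n (u : nat -> C) (n : nat) : sum_n u n = csum u (S n).
Proof.
  induction n as [|n IH].
  - rewrite sum_O. simpl. ring.
  - rewrite sum_Sn, IH. reflexivity.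
Qed.

Lemma Cneq_minus (t z : C) : t <> z -> t - z <> 0.
Proof. intros N E. apply N. replace t with ((t - z) + z) by ring. rewrite E. ring. Qed.

Definition tau_i : C := RtoC (2 * PI) * Ci.

Lemma tau_i_neq_0 : tau_i <> 0.
Proof.
  unfold tau_i. apply Cmult_neq_0.
  - intros E. apply RtoC_inj in E. generalize PI_RGT_0. lra.
  - intros E. injection E. lra.
Qed.

Definition circle (r y : R) : C := RtoC r * Cexp (RtoC y * tau_i).

Lemma Cmod_circle (r y : R) : (0 <= r)%R -> Cmod (circle r y) = r.
Proof.
  intros Hr. unfold circle. rewrite Cmod_mult, Cmod_Cexp, Cmod_R, Rabs_right by lra.
  replace (Re (RtoC y * tau_i)) with 0%R; [rewrite exp_0; ring|].
  unfold tau_i, Re; simpl. ring.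
Qed.

Lemma circle_neq_0 (r y : R) : (0 < r)%R -> circle r y <> 0.
Proof.
  intros Hr. apply Cmod_gt_0. rewrite Cmod_circle; lra.
Qed.

Lemma Cexp_tau_i (n : nat) : Cexp (RtoC (INR n) * tau_i) = 1.
Proof.
  unfold Cexp.
  replace (Re (RtoC (INR n) * tau_i)) with 0%R by (unfold tau_i, Re; simpl; ring).
  replace (Im (RtoC (INR n) * tau_i)) with (0 + 2 * INR n * PI)%R by (unfold tau_i, Im; simpl; ring).
  rewrite cos_period, sin_period, exp_0, cos_0, sin_0. unfold RtoC. f_equal; ring.
Qed.

Lemma circle_closed (r : R) : circle r 1 = circle r 0.
Proof.
  unfold circle. f_equal. replace (RtoC 1 * tau_i) with (RtoC (INR 1) * tau_i) by (simpl; ring).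
  rewrite Cexp_tau_i. replace (RtoC 0 * tau_i) with (RtoC 0) by ring. now rewrite Cexp_0.
Qed.

Lemma curve_deriv_exp (c : C) (y : R) :
  curve_deriv (fun y => Cexp (RtoC y * c)) y (Cexp (RtoC y * c) * c).
Proof.
  apply (curve_deriv_comp Cexp (fun y => RtoC y * c)); [|apply has_cderiv_Cexp].
  assert (H := curve_deriv_affine 0 c y).
  replace (fun t : R => RtoC t * c) with (fun t : R => 0 + RtoC t * c); [exact H|].
  fun_ring.
Qed.

Lemma curve_deriv_scal (c : C) (f : R -> C) (x : R) (l : C) :
  curve_deriv f x l -> curve_deriv (fun t => c * f t) x (c * l).
Proof.
  intros H. apply (curve_deriv_comp (fun t => c * t) f); [exact H|].
  assert (K := has_cderiv_mult _ _ (f x) _ _ (has_cderiv_const c (f x)) (has_cderiv_id (f x))).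
  cbv beta in K. replace (0 * f x + c * 1) with c in K by ring. exact K.
Qed.

Lemma curve_deriv_circle (r y : R) : curve_deriv (circle r) y (tau_i * circle r y).
Proof.
  unfold circle. replace (tau_i * (RtoC r * Cexp (RtoC y * tau_i))) with
    (RtoC r * (Cexp (RtoC y * tau_i) * tau_i)) by ring.
  apply curve_deriv_scal, curve_deriv_exp.
Qed.

Lemma curve_cont_circle (r y : R) : curve_cont (circle r) y.
Proof. eapply curve_deriv_cont, curve_deriv_circle. Qed.

Lemma has_cderiv_affine (a b t : C) : has_cderiv (fun t => a + b * t) t b.
Proof.
  assert (K := has_cderiv_plus _ _ _ _ _ (has_cderiv_const a t)
    (has_cderiv_mult _ _ t _ _ (has_cderiv_const b t) (has_cderiv_id t))).
  cbv beta in K. replace (0 + (0 * t + b * 1)) with b in K by ring. exact K.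
Qed.

Lemma Cmod_tau_i : Cmod tau_i = (2 * PI)%R.
Proof.
  unfold tau_i. rewrite Cmod_mult, Cmod_Ci, Cmod_R, Rabs_right; [ring|].
  generalize PI_RGT_0. lra.
Qed.

(** The homothety with centre z deforms the circle of radius r. The edges y = 0 and
    y = 1 of this square run along the same path, because the circle closes up, and
    cancel; there remain the circle and its image. *)
Lemma circle_homotopy (g : C -> C) (z : C) (r s : R) :
  (0 < r)%R -> (0 < s <= 1)%R ->
  (forall u y, (s <= u <= 1)%R -> (0 <= y <= 1)%R ->
     exists l, has_cderiv g (z + RtoC u * (circle r y - z)) l) ->
  CInt (fun y => g (circle r y) * (tau_i * circle r y)) 0 1 =
  CInt (fun y => g (z + RtoC s * (circle r y - z)) * (RtoC s * (tau_i * circle r y))) 0 1.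
Proof.
  intros Hr Hs Hg.
  set (sc := fun x : R => (s + (1 - s) * x)%R).
  set (T := fun x y : R => z + RtoC (sc x) * (circle r y - z)).
  set (T1 := fun x y : R => RtoC (1 - s) * (circle r y - z)).
  set (T2 := fun x y : R => RtoC (sc x) * (tau_i * circle r y)).
  assert (Hsc : forall x, (0 <= x <= 1)%R -> (s <= sc x <= 1)%R) by (intros; unfold sc; nra).
  assert (HT : smooth_square T T1 T2 (r + Cmod z + 2 * PI * r)).
  { generalize PI_RGT_0 (Cmod_ge_0 z); intros HPI Hz. split.
    - intros x y. unfold T, T1.
      replace (fun x : R => z + RtoC (sc x) * (circle r y - z)) with
        (fun x : R => (z + RtoC s * (circle r y - z)) + RtoC x * (RtoC (1 - s) * (circle r y - z))).
      { apply curve_deriv_affine. }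
      apply functional_extensionality; intros t. unfold sc.
      rewrite RtoC_plus, RtoC_mult. ring.
    - intros x y. unfold T, T2.
      apply (curve_deriv_comp (fun t => z + RtoC (sc x) * (t - z)) (circle r)).
      + apply curve_deriv_circle.
      + replace (fun t : C => z + RtoC (sc x) * (t - z)) with
          (fun t : C => (z - RtoC (sc x) * z) + RtoC (sc x) * t).
        { apply has_cderiv_affine. }
        fun_ring.
    - intros x y. apply curve_cont_const.
    - intros x y. unfold T2. apply curve_cont_mult; [apply curve_cont_const|].
      apply curve_cont_mult; [apply curve_cont_const|apply curve_cont_circle].
    - nra.
    - intros x y Hx Hy. unfold T1. rewrite Cmod_mult, Cmod_R, Rabs_right by lra.
      generalize (Cmod_minus_le (circle r y) z) (Cmod_ge_0 (circle r y - z)).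
      rewrite Cmod_circle by lra. intros. nra.
    - intros x y Hx Hy. unfold T2. specialize (Hsc x Hx).
      rewrite !Cmod_mult, Cmod_R, Rabs_right, Cmod_tau_i, Cmod_circle by lra.
      assert (0 <= 2 * PI * r)%R by nra. nra. }
  assert (K := goursat HT g).
  unfold contour in K. rewrite !Rplus_0_l in K.
  unfold edge1, edge2, T, T1, T2 in K. rewrite circle_closed in K.
  assert (E1 : sc 1%R = 1%R) by (unfold sc; ring).
  assert (E0 : sc 0%R = s) by (unfold sc; ring).
  rewrite E1, E0 in K.
  assert (K' := K (fun x y Hx Hy => Hg _ _ (Hsc x Hx) Hy)). clear K.
  assert (cancel : forall e A B : C, e + A - e - B = 0 -> A = B).
  { intros e A B E. replace A with (B + (e + A - e - B)) by ring. rewrite E. ring. }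
  apply cancel in K'.
  rewrite <- K'. apply CInt_ext; [lra|]. intros y _. rewrite !Cmult_1_l. f_equal. f_equal. ring.
Qed.

Lemma CInt_const (c : C) : CInt (fun _ => c) 0 1 = c.
Proof.
  rewrite (CInt_derive (fun y => 0 + RtoC y * c)); [ring|lra| |].
  - intros y _. apply curve_deriv_affine.
  - intros y _. apply curve_cont_const.
Qed.

Lemma le_mult_pos_eq_0 (x : C) (M : R) :
  (forall e, (0 < e)%R -> (Cmod x <= e * M)%R) -> x = 0.
Proof.
  intros H. apply Cmod_eq_0. apply Rle_antisym; [|apply Cmod_ge_0].
  destruct (Rle_dec M 0) as [HM|HM].
  - generalize (H 1%R Rlt_0_1). lra.
  - apply Rnot_le_lt in HM. apply Rnot_lt_le. intros Hx.
    generalize (H (Cmod x / (2 * M))%R ltac:(apply Rdiv_lt_0_compat; lra)).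
    replace (Cmod x / (2 * M) * M)%R with (Cmod x / 2)%R by (field; lra). lra.
Qed.

Lemma circle_minus_bound (r y : R) (z : C) :
  (Cmod z < r)%R -> (r - Cmod z <= Cmod (circle r y - z))%R.
Proof.
  intros Hz. generalize (Cmod_triangle_inv (circle r y) z).
  rewrite Cmod_circle; [lra|]. generalize (Cmod_ge_0 z). lra.
Qed.

Lemma circle_minus_neq_0 (r y : R) (z : C) :
  (Cmod z < r)%R -> circle r y - z <> 0.
Proof.
  intros Hz. apply Cmod_gt_0. generalize (circle_minus_bound r y z Hz). lra.
Qed.

Definition cauchy_kernel (r : R) (z : C) (y : R) : C := circle r y * / (circle r y - z).

Lemma cauchy_kernel_bound (r : R) (z : C) (y : R) :
  (Cmod z < r)%R -> (Cmod (cauchy_kernel r z y) <= r / (r - Cmod z))%R.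
Proof.
  intros Hz. assert (B := circle_minus_bound r y z Hz).
  unfold cauchy_kernel. rewrite Cmod_mult, Cmod_inv by now apply circle_minus_neq_0.
  assert (0 < r)%R by (generalize (Cmod_ge_0 z); lra).
  rewrite Cmod_circle by lra. apply Rmult_le_compat_l; [lra|].
  apply Rinv_le_contravar; lra.
Qed.

Lemma curve_cont_inv (f : R -> C) (y : R) :
  curve_cont f y -> f y <> 0 -> curve_cont (fun t => / f t) y.
Proof. intros H N. apply (curve_cont_comp (fun t => / t) f); [exact H|now apply ccont_inv]. Qed.

Lemma curve_cont_cauchy_kernel (r : R) (z : C) (y : R) :
  (Cmod z < r)%R -> curve_cont (cauchy_kernel r z) y.
Proof.
  intros Hz. unfold cauchy_kernel. apply curve_cont_mult; [apply curve_cont_circle|].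
  apply curve_cont_inv; [|now apply circle_minus_neq_0].
  apply curve_cont_plus; [apply curve_cont_circle|apply curve_cont_const].
Qed.

(** In [circle_homotopy] for f t / (t - z) the ratio s of the homothety cancels between
    dt and t - z; as s tends to 0 the values of f on the small curve tend to f z. *)
Lemma cauchy_formula_kernel (f : C -> C) (r : R) (z : C) :
  entire f -> (Cmod z < r)%R ->
  CInt (fun y => f (circle r y) * cauchy_kernel r z y) 0 1 =
  f z * CInt (cauchy_kernel r z) 0 1.
Proof.
  intros Hf Hz.
  assert (Hr : (0 < r)%R) by (generalize (Cmod_ge_0 z); lra).
  set (I := CInt (fun y => f (circle r y) * cauchy_kernel r z y) 0 1).
  assert (Cf : forall (s : R) y, curve_cont (fun y => f (z + RtoC s * (circle r y - z))) y).
  { intros s y. apply (curve_cont_comp f); [|now apply entire_ccont].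
    apply curve_cont_plus; [apply curve_cont_const|].
    apply curve_cont_mult; [apply curve_cont_const|].
    apply curve_cont_plus; [apply curve_cont_circle|apply curve_cont_const]. }
  assert (Ck : forall y, curve_cont (cauchy_kernel r z) y) by (intros; now apply curve_cont_cauchy_kernel).
  assert (Cf1 : forall y, curve_cont (fun y => f (circle r y)) y).
  { intros y. apply (curve_cont_comp f); [apply curve_cont_circle|now apply entire_ccont]. }
  assert (E : forall s, (0 < s <= 1)%R ->
    I = CInt (fun y => f (z + RtoC s * (circle r y - z)) * cauchy_kernel r z y) 0 1).
  { intros s Hs.
    assert (Hs0 : RtoC s <> 0) by (intros E; apply RtoC_inj in E; lra).
    assert (K := circle_homotopy (fun t => f t * / (t - z)) z r s Hr Hs). cbv beta in K.
    assert (Q : tau_i * I =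
      tau_i * CInt (fun y => f (z + RtoC s * (circle r y - z)) * cauchy_kernel r z y) 0 1).
    2:{ rewrite <- (Cmult_1_l I), <- (Cinv_l tau_i tau_i_neq_0), <- Cmult_assoc, Q.
        field. apply tau_i_neq_0. }
    unfold I. rewrite <- !CInt_scal; try lra.
    2:{ intros y _. apply curve_cont_mult; auto. }
    2:{ intros y _. apply curve_cont_mult; auto. }
    transitivity (CInt (fun y => f (circle r y) * / (circle r y - z) * (tau_i * circle r y)) 0 1).
    { apply CInt_ext; [lra|]. intros y _. unfold cauchy_kernel. ring. }
    rewrite K.
    - apply CInt_ext; [lra|]. intros y _. unfold cauchy_kernel.
      assert (N := circle_minus_neq_0 r y z Hz).
      replace (z + RtoC s * (circle r y - z) - z) with (RtoC s * (circle r y - z)) by ring.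
      field. auto.
    - intros u y Hu Hy.
      assert (N : z + RtoC u * (circle r y - z) - z <> 0).
      { replace (z + RtoC u * (circle r y - z) - z) with (RtoC u * (circle r y - z)) by ring.
        apply Cmult_neq_0; [intros E; apply RtoC_inj in E; lra|now apply circle_minus_neq_0]. }
      eexists. apply (has_cderiv_mult f (fun t => / (t - z))); [now apply entire_C_derive|].
      apply (has_cderiv_comp (fun t => / t) (fun t => t - z)).
      + apply (has_cderiv_plus (fun t => t) (fun _ => - z)); [apply has_cderiv_id|apply has_cderiv_const].
      + now apply has_cderiv_inv. }
  assert (D : I - f z * CInt (cauchy_kernel r z) 0 1 = 0).
  { apply (le_mult_pos_eq_0 _ (r / (r - Cmod z))). intros e He.
    destruct (entire_ccont f z Hf e He) as [d [Hd Hd']].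
    set (s := Rmin 1 (d / (4 * r))).
    assert (Hs : (0 < s <= 1)%R).
    { split; [apply Rmin_pos; [lra|apply Rdiv_lt_0_compat; lra]|apply Rmin_l]. }
    assert (Hs' : (s * (4 * r) <= d)%R).
    { apply Rle_trans with (d / (4 * r) * (4 * r))%R.
      - apply Rmult_le_compat_r; [lra|apply Rmin_r].
      - right. field. lra. }
    rewrite (E s Hs). rewrite <- CInt_scal; [|lra|intros y _; auto].
    replace (e * (r / (r - Cmod z)))%R with ((1 - 0) * (e * (r / (r - Cmod z))))%R by ring.
    apply CInt_minus_bound; [lra| | |].
    - intros y _. apply curve_cont_mult; auto.
    - intros y _. apply curve_cont_mult; [apply curve_cont_const|auto].
    - intros y _.
      replace (f (z + RtoC s * (circle r y - z)) * cauchy_kernel r z y - f z * cauchy_kernel r z y)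
        with ((f (z + RtoC s * (circle r y - z)) - f z) * cauchy_kernel r z y) by ring.
      rewrite Cmod_mult. apply Rmult_le_compat; try apply Cmod_ge_0;
        [|now apply cauchy_kernel_bound].
      left. apply Hd'.
      replace (z + RtoC s * (circle r y - z) - z) with (RtoC s * (circle r y - z)) by ring.
      rewrite Cmod_mult, Cmod_R, Rabs_right by lra.
      generalize (Cmod_minus_le (circle r y) z) (Cmod_ge_0 (circle r y - z)).
      rewrite Cmod_circle by lra. intros. nra. }
  replace I with (I - f z * CInt (cauchy_kernel r z) 0 1 + f z * CInt (cauchy_kernel r z) 0 1) by ring.
  rewrite D. ring.
Qed.

Definition taylor_coef (f : C -> C) (r : R) (k : nat) : C :=
  CInt (fun y => f (circle r y) * (/ circle r y) ^ k) 0 1.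

Lemma curve_cont_pow (f : R -> C) (y : R) (k : nat) :
  curve_cont f y -> curve_cont (fun t => f t ^ k) y.
Proof.
  intros H. apply (curve_cont_comp (fun t => t ^ k) f); [exact H|].
  apply entire_ccont, entire_pow.
Qed.

Lemma taylor_coef_cont (f : C -> C) (r : R) (k : nat) (y : R) :
  entire f -> (0 < r)%R -> curve_cont (fun y => f (circle r y) * (/ circle r y) ^ k) y.
Proof.
  intros Hf Hr. apply curve_cont_mult.
  - apply (curve_cont_comp f); [apply curve_cont_circle|now apply entire_ccont].
  - apply curve_cont_pow, curve_cont_inv; [apply curve_cont_circle|now apply circle_neq_0].
Qed.

Lemma cauchy_kernel_expansion (f : C -> C) (r : R) (z : C) (N : nat) :
  entire f -> (Cmod z < r)%R ->
  CInt (fun y => f (circle r y) * cauchy_kernel r z y) 0 1 =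
  csum (fun k => taylor_coef f r k * z ^ k) N +
  CInt (fun y => (z * / circle r y) ^ N * (f (circle r y) * cauchy_kernel r z y)) 0 1.
Proof.
  intros Hf Hz.
  assert (Hr : (0 < r)%R) by (generalize (Cmod_ge_0 z); lra).
  assert (Cf1 : forall y, curve_cont (fun y => f (circle r y)) y).
  { intros y. apply (curve_cont_comp f); [apply curve_cont_circle|now apply entire_ccont]. }
  assert (CC : forall n y, curve_cont (fun y => (z * / circle r y) ^ n * (f (circle r y) * cauchy_kernel r z y)) y).
  { intros n y. apply curve_cont_mult.
    - apply (curve_cont_pow (fun y => z * / circle r y)). apply curve_cont_mult; [apply curve_cont_const|].
      apply curve_cont_inv; [apply curve_cont_circle|now apply circle_neq_0].
    - apply curve_cont_mult; [auto|now apply curve_cont_cauchy_kernel]. }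
  induction N as [|N IH].
  - simpl. rewrite Cplus_0_l. apply CInt_ext; [lra|]. intros y _. ring.
  - rewrite IH. simpl csum. rewrite <- Cplus_assoc. f_equal.
    rewrite (Cmult_comm (taylor_coef f r N)). unfold taylor_coef.
    rewrite <- CInt_scal; [|lra|intros y _; now apply taylor_coef_cont].
    rewrite <- CInt_plus; [|lra| |intros y _; apply CC].
    + apply CInt_ext; [lra|]. intros y _. unfold cauchy_kernel.
      assert (N1 := circle_minus_neq_0 r y z Hz). assert (N2 := circle_neq_0 r y Hr).
      rewrite !Cpow_mult_l. simpl Cpow. field. auto.
    + intros y _. apply curve_cont_mult; [apply curve_cont_const|now apply taylor_coef_cont].
Qed.

Lemma cauchy_remainder_bound (f : C -> C) (r M : R) (z : C) (N : nat) :
  entire f -> (Cmod z < r)%R -> (forall y, (0 <= y <= 1)%R -> (Cmod (f (circle r y)) <= M)%R) ->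
  (Cmod (CInt (fun y => (z * / circle r y) ^ N * (f (circle r y) * cauchy_kernel r z y))%C 0 1)
   <= (Cmod z / r) ^ N * (M * (r / (r - Cmod z))))%R.
Proof.
  intros Hf Hz HM.
  assert (Hr : (0 < r)%R) by (generalize (Cmod_ge_0 z); lra).
  rewrite <- (Rmult_1_l ((Cmod z / r) ^ N * _)%R).
  replace 1%R with (1 - 0)%R at 2 by ring.
  apply CInt_bound; [lra| |].
  - intros y _. apply curve_cont_mult.
    + apply (curve_cont_pow (fun y => z * / circle r y)). apply curve_cont_mult; [apply curve_cont_const|].
      apply curve_cont_inv; [apply curve_cont_circle|now apply circle_neq_0].
    + apply curve_cont_mult; [|now apply curve_cont_cauchy_kernel].
      apply (curve_cont_comp f); [apply curve_cont_circle|now apply entire_ccont].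
  - intros y Hy. rewrite !Cmod_mult, Cmod_pow, Cmod_mult, Cmod_inv by now apply circle_neq_0.
    rewrite Cmod_circle by lra. apply Rmult_le_compat_l.
    + apply pow_le. apply Rmult_le_pos; [apply Cmod_ge_0|]. left. now apply Rinv_0_lt_compat.
    + apply Rmult_le_compat; try apply Cmod_ge_0; [|now apply cauchy_kernel_bound].
      now apply HM.
Qed.

Lemma eq_of_geometric (x y : C) (q M : R) :
  (0 <= q < 1)%R -> (0 <= M)%R -> (forall n, (Cmod (x - y) <= q ^ S n * M)%R) -> x = y.
Proof.
  intros Hq HM H. replace x with ((x - y) + y) by ring.
  rewrite (le_mult_pos_eq_0 (x - y) M); [ring|]. intros e He.
  destruct (pow_lt_1_zero q) with (y := e) as [n Hn]; [rewrite Rabs_right; lra|exact He|].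
  specialize (Hn (S n) ltac:(lia)). rewrite Rabs_right in Hn by (apply Rle_ge, pow_le; lra).
  eapply Rle_trans; [apply (H n)|]. apply Rmult_le_compat_r; lra.
Qed.

Lemma Cmod_ratio (z : C) (r : R) : (Cmod z < r)%R -> (0 <= Cmod z / r < 1)%R.
Proof.
  intros Hz. assert (P := Cmod_ge_0 z). split.
  - apply Rmult_le_pos; [exact P|]. left. apply Rinv_0_lt_compat. lra.
  - apply Rmult_lt_reg_r with r; [lra|]. unfold Rdiv. rewrite Rmult_assoc, Rinv_l; lra.
Qed.

Lemma taylor_coef_homothety (f : C -> C) (r s : R) (k : nat) :
  entire f -> (0 < r)%R -> (0 < s <= 1)%R -> taylor_coef f (s * r) k = taylor_coef f r k.
Proof.
  intros Hf Hr Hs.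
  assert (Hs0 : RtoC s <> 0) by (intros E; apply RtoC_inj in E; lra).
  assert (K := circle_homotopy (fun t => f t * (/ t) ^ S k) 0 r s Hr Hs). cbv beta in K.
  assert (Q : tau_i * taylor_coef f (s * r) k = tau_i * taylor_coef f r k).
  2:{ rewrite <- (Cmult_1_l (taylor_coef f (s * r) k)), <- (Cinv_l tau_i tau_i_neq_0), <- Cmult_assoc, Q.
      field. apply tau_i_neq_0. }
  unfold taylor_coef.
  rewrite <- !CInt_scal; try lra; try (intros y _; apply taylor_coef_cont; [exact Hf|nra]).
  assert (N := fun y => circle_neq_0 r y Hr).
  symmetry. etransitivity; [|etransitivity; [apply K|]].
  - apply CInt_ext; [lra|]. intros y _. simpl Cpow. field. apply N.
  - intros u y Hu Hy.
    assert (N1 : 0 + RtoC u * (circle r y - 0) <> 0).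
    { replace (0 + RtoC u * (circle r y - 0)) with (RtoC u * circle r y) by ring.
      apply Cmult_neq_0; [intros E; apply RtoC_inj in E; lra|apply N]. }
    eexists. apply (has_cderiv_mult f (fun t => (/ t) ^ S k)); [now apply entire_C_derive|].
    apply (has_cderiv_comp (fun t => t ^ S k) (fun t => / t)); [now apply has_cderiv_inv|].
    apply entire_C_derive, entire_pow.
  - apply CInt_ext; [lra|]. intros y _.
    replace (0 + RtoC s * (circle r y - 0)) with (RtoC s * circle r y) by ring.
    replace (circle (s * r) y) with (RtoC s * circle r y) by (unfold circle; rewrite RtoC_mult; ring).
    simpl Cpow. field. auto.
Qed.

Lemma taylor_coef_radius (f : C -> C) (r : R) (k : nat) :
  entire f -> (0 < r)%R -> taylor_coef f r k = taylor_coef f 1 k.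
Proof.
  intros Hf Hr. destruct (Rle_dec r 1) as [H|H].
  - rewrite <- (Rmult_1_r r) at 1. apply taylor_coef_homothety; [exact Hf|lra|lra].
  - symmetry. replace 1%R with (/ r * r)%R at 1 by (field; lra).
    apply taylor_coef_homothety; [exact Hf|exact Hr|].
    split; [now apply Rinv_0_lt_compat|]. rewrite <- Rinv_1. apply Rinv_le_contravar; lra.
Qed.

Lemma taylor_coef_bound (f : C -> C) (r M : R) (k : nat) :
  entire f -> (0 < r)%R -> (forall y, (0 <= y <= 1)%R -> (Cmod (f (circle r y)) <= M)%R) ->
  (Cmod (taylor_coef f 1 k) * r ^ k <= M)%R.
Proof.
  intros Hf Hr HM. rewrite <- (taylor_coef_radius f r k Hf Hr).
  apply Rmult_le_reg_r with (/ r ^ k)%R; [apply Rinv_0_lt_compat, pow_lt, Hr|].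
  rewrite Rmult_assoc, Rinv_r, Rmult_1_r by (apply pow_nonzero; lra).
  replace (M * / r ^ k)%R with ((1 - 0) * (M * / r ^ k))%R by ring.
  apply CInt_bound; [lra|intros y _; now apply taylor_coef_cont|].
  intros y Hy. rewrite Cmod_mult, Cmod_pow, Cmod_inv, Cmod_circle, pow_inv
    by (try lra; now apply circle_neq_0).
  apply Rmult_le_compat_r; [left; apply Rinv_0_lt_compat, pow_lt, Hr|now apply HM].
Qed.

(** The coefficient does not depend on the radius, and it is at most r^-(k+1). *)
Lemma taylor_coef_one (r : R) (k : nat) :
  (0 < r)%R -> taylor_coef (fun _ => 1) r (S k) = 0.
Proof.
  intros Hr. rewrite taylor_coef_radius by (try apply entire_const; exact Hr).
  apply (le_mult_pos_eq_0 _ 1). intros e He. set (m := Cmod _).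
  assert (L : (1 <= 1 + / e)%R) by (assert (P := Rinv_0_lt_compat e He); lra).
  assert (B : (m * (1 + / e) ^ S k <= 1)%R).
  { apply taylor_coef_bound; [apply entire_const|lra|]. intros y _. rewrite Cmod_1. lra. }
  assert (Pm : (0 <= m)%R) by apply Cmod_ge_0.
  assert (G : (1 <= (1 + / e) ^ k)%R) by now apply pow_R1_Rle.
  simpl in B. assert (K : (m * (1 + / e) <= 1)%R).
  { eapply Rle_trans; [|exact B]. apply Rmult_le_compat_l; [exact Pm|]. nra. }
  assert (Q : (m * / e <= 1)%R) by nra.
  apply Rmult_le_reg_r with (/ e)%R; [now apply Rinv_0_lt_compat|].
  replace (e * 1 * / e)%R with 1%R by (field; lra). exact Q.
Qed.

Lemma cauchy_kernel_mean (r : R) (z : C) :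
  (Cmod z < r)%R -> CInt (cauchy_kernel r z) 0 1 = 1.
Proof.
  intros Hz. assert (P := Cmod_ge_0 z).
  apply (eq_of_geometric _ _ (Cmod z / r) (1 * (r / (r - Cmod z)))).
  - now apply Cmod_ratio.
  - rewrite Rmult_1_l. apply Rmult_le_pos; [lra|]. left. apply Rinv_0_lt_compat. lra.
  - intros n.
    assert (K := cauchy_kernel_expansion (fun _ => 1) r z (S n) (entire_const 1) Hz).
    assert (B := cauchy_remainder_bound (fun _ => 1) r 1 z (S n) (entire_const 1) Hz).
    assert (S1 : csum (fun k => taylor_coef (fun _ => 1) r k * z ^ k) (S n) = 1).
    { clear K B. induction n as [|n IH].
      - simpl. unfold taylor_coef. simpl.
        rewrite (CInt_ext _ (fun _ => 1)) by (try lra; intros; ring).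
        rewrite CInt_const. ring.
      - change (csum (fun k => taylor_coef (fun _ => 1) r k * z ^ k) (S n) +
          taylor_coef (fun _ => 1) r (S n) * z ^ S n = 1).
        rewrite IH, taylor_coef_one by lra. ring. }
    rewrite S1 in K.
    rewrite (CInt_ext _ (cauchy_kernel r z)) in K by (try lra; intros; ring).
    rewrite K.
    match goal with |- (Cmod (?a + ?I - ?b) <= _)%R => replace (a + I - b) with I by ring end.
    apply B. intros t _. rewrite Cmod_1. lra.
Qed.

(** Both estimates come from one bound M on the circle of radius r: the first from the
    integral for the coefficients, the second from the remainder of the geometric
    series. All later use of analyticity goes through them. *)
Theorem entire_taylor (f : C -> C) :
  entire f -> exists a : nat -> C, forall r M, (0 < r)%R ->
    (forall y, (0 <= y <= 1)%R -> (Cmod (f (circle r y)) <= M)%R) ->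
    (forall n, (Cmod (a n) * r ^ n <= M)%R) /\
    forall (N : nat) (z : C), (2 * Cmod z <= r)%R ->
      (Cmod (f z - csum (fun k => a k * z ^ k)%C N) <= 2 * M * (Cmod z / r) ^ N)%R.
Proof.
  intros Hf. exists (taylor_coef f 1). intros r M Hr HM.
  assert (HM0 : (0 <= M)%R).
  { eapply Rle_trans; [apply Cmod_ge_0|]. apply (HM 0%R). lra. }
  split.
  - intros n. now apply taylor_coef_bound.
  - intros N z Hz.
    assert (P := Cmod_ge_0 z). assert (Hz' : (Cmod z < r)%R) by lra.
    assert (K1 := cauchy_formula_kernel f r z Hf Hz').
    rewrite cauchy_kernel_mean, (cauchy_kernel_expansion f r z N Hf Hz') in K1 by exact Hz'.
    rewrite Cmult_1_r in K1. rewrite <- K1.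
    rewrite (csum_ext _ (fun k => taylor_coef f 1 k * z ^ k))
      by (intros k _; now rewrite taylor_coef_radius).
    match goal with |- (Cmod (?A + ?I - ?A) <= _)%R => replace (A + I - A) with I by ring end.
    eapply Rle_trans; [apply (cauchy_remainder_bound f r M z N Hf Hz' HM)|].
    rewrite (Rmult_comm (2 * M)). apply Rmult_le_compat_l.
    + apply pow_le. now apply Cmod_ratio.
    + rewrite (Rmult_comm 2). apply Rmult_le_compat_l; [exact HM0|].
      apply Rmult_le_reg_r with (r - Cmod z)%R; [lra|].
      unfold Rdiv. rewrite Rmult_assoc, Rinv_l; lra.
Qed.

Lemma entire_bounded_circle (f : C -> C) (r : R) :
  entire f -> exists M, forall y, (0 <= y <= 1)%R -> (Cmod (f (circle r y)) <= M)%R.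
Proof.
  intros Hf.
  destruct (continuity_ab_maj (fun y => Cmod (f (circle r y))) 0 1 Rle_0_1) as [m [Hm _]].
  - intros y _. apply continuity_pt_filterlim.
    assert (H : curve_cont (fun y => f (circle r y)) y).
    { apply (curve_cont_comp f); [apply curve_cont_circle|now apply entire_ccont]. }
    rewrite curve_cont_iff in H.
    apply (filterlim_locally (U := R_UniformSpace)). intros e.
    destruct (H e (cond_pos e)) as [d [Hd Hd']]. exists (mkposreal d Hd).
    intros y' Hy'. specialize (Hd' y' Hy').
    apply Rabs_def1; unfold minus, plus, opp; simpl.
    + generalize (Cmod_triangle_inv (f (circle r y')) (f (circle r y))). lra.
    + generalize (Cmod_triangle_inv (f (circle r y)) (f (circle r y'))). rewrite Cmod_minus_sym. lra.
  - exists (Cmod (f (circle r m))). exact Hm.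
Qed.

(** * Divided differences of entire functions *)

Lemma entire_translate (f : C -> C) (z : C) : entire f -> entire (fun u => f (z + u)).
Proof.
  intros H. apply (entire_comp f (fun u => z + u)); [exact H|].
  apply entire_plus; [apply entire_const|apply entire_id].
Qed.

Lemma has_cderiv_ext_loc (f g : C -> C) (z l : C) (d : R) :
  (0 < d)%R -> (forall t, (Cmod (t - z) < d)%R -> f t = g t) ->
  has_cderiv f z l -> has_cderiv g z l.
Proof.
  intros Hd E H e He. destruct (H e He) as [d' [Hd' H']].
  exists (Rmin d d'). split; [now apply Rmin_pos|]. intros t Ht.
  rewrite <- (E t), <- (E z).
  - apply H'. eapply Rlt_le_trans; [exact Ht|apply Rmin_r].
  - replace (z - z) with (RtoC 0) by ring. now rewrite Cmod_0.
  - eapply Rlt_le_trans; [exact Ht|apply Rmin_l].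
Qed.

Lemma ccont_minus (f g : C -> C) (z : C) :
  ccont f z -> ccont g z -> ccont (fun t => f t - g t) z.
Proof.
  intros Hf Hg. apply ccont_plus; [exact Hf|].
  intros e He. destruct (Hg e He) as [d [Hd H]]. exists d. split; [exact Hd|].
  intros t Ht. replace (- g t - - g z) with (- (g t - g z)) by ring. rewrite Cmod_opp. auto.
Qed.

Lemma ccont_closed_bound (f : C -> C) (z : C) (M d : R) :
  (0 < d)%R -> ccont f z -> (forall t, t <> z -> (Cmod (t - z) < d)%R -> (Cmod (f t) <= M)%R) ->
  (Cmod (f z) <= M)%R.
Proof.
  intros Hd Hf HM. apply le_epsilon. intros e He.
  destruct (Hf e He) as [d' [Hd' H]].
  set (t := z + RtoC (Rmin d d' / 2)).
  assert (Hm : (0 < Rmin d d')%R) by now apply Rmin_pos.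
  assert (Et : Cmod (t - z) = (Rmin d d' / 2)%R).
  { unfold t. replace (z + RtoC (Rmin d d' / 2) - z) with (RtoC (Rmin d d' / 2)) by ring.
    rewrite Cmod_R, Rabs_right; lra. }
  assert (Nt : t <> z).
  { intros E. rewrite E in Et. replace (z - z) with (RtoC 0) in Et by ring. rewrite Cmod_0 in Et. lra. }
  generalize (Rmin_l d d') (Rmin_r d d'). intros.
  assert (K1 := HM t Nt ltac:(lra)). assert (K2 := H t ltac:(lra)).
  generalize (Cmod_triangle_inv (f z) (f t)). rewrite Cmod_minus_sym. lra.
Qed.

(** Lets identities between divided differences be checked after multiplication by
    t - z, without looking at the removable point. *)
Lemma ccont_cancel (f g : C -> C) (z : C) :
  ccont f z -> ccont g z -> (forall t, (t - z) * f t = (t - z) * g t) -> forall t, f t = g t.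
Proof.
  intros Hf Hg E t.
  assert (K : forall t, t <> z -> f t - g t = 0).
  { intros s Hs. assert (N := Cneq_minus _ _ Hs).
    replace (f s - g s) with (/ (s - z) * ((s - z) * f s - (s - z) * g s)) by (field; exact N).
    rewrite E. ring. }
  replace (f t) with (f t - g t + g t) by ring.
  destruct (Ceq_dec t z) as [->|N]; [|rewrite K by exact N; ring].
  replace (f z - g z) with (RtoC 0); [ring|]. symmetry. apply Cmod_eq_0.
  apply Rle_antisym; [|apply Cmod_ge_0].
  apply (ccont_closed_bound (fun t => f t - g t) z 0 1); [lra|now apply ccont_minus|].
  intros s Hs _. rewrite K by exact Hs. rewrite Cmod_0. lra.
Qed.

(** The divided difference F[z, t]. For z = 0 it is the backward shift, which is the
    Pommiez operator for the constant function 1. *)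
Definition divdiff (z : C) (F : C -> C) (t : C) : C :=
  if Ceq_dec t z then C_derive F z else (F t - F z) / (t - z).

Lemma divdiff_spec (z : C) (F : C -> C) (t : C) : (t - z) * divdiff z F t = F t - F z.
Proof.
  unfold divdiff. destruct (Ceq_dec t z) as [->|N]; [ring|]. field. now apply Cneq_minus.
Qed.

Lemma local_expansion (F : C -> C) (z : C) : entire F ->
  exists (a : nat -> C) (M : R), (0 <= M)%R /\ forall N u, (Cmod u <= 1)%R ->
    (Cmod (F (z + u)%C - csum (fun k => a k * u ^ k)%C N) <= M * Cmod u ^ N)%R.
Proof.
  intros HF. destruct (entire_taylor _ (entire_translate F z HF)) as [a Ha].
  destruct (entire_bounded_circle _ 2 (entire_translate F z HF)) as [M HM].
  assert (HM0 : (0 <= M)%R) by (eapply Rle_trans; [apply Cmod_ge_0|apply (HM 0%R); lra]).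
  exists a, (2 * M)%R. split; [lra|]. intros N u Hu. assert (P := Cmod_ge_0 u).
  eapply Rle_trans; [apply (proj2 (Ha 2%R M Rlt_0_2 HM)); lra|].
  apply Rmult_le_compat_l; [lra|]. apply pow_incr. lra.
Qed.

(** At z the derivative is the Taylor coefficient of order 2; elsewhere this is the
    rule for quotients. *)
Lemma entire_divdiff (z : C) (F : C -> C) : entire F -> entire (divdiff z F).
Proof.
  intros HF. apply entire_cderiv. intros t0.
  destruct (Ceq_dec t0 z) as [->|N].
  - destruct (local_expansion F z HF) as (a & M & HM & T).
    assert (E0 : F z = a 0%nat).
    { assert (K := T 1%nat 0 ltac:(rewrite Cmod_0; lra)). simpl in K. rewrite Cmod_0 in K.
      replace (z + 0) with z in K by ring.
      replace (F z) with (F z - (0 + a 0%nat * 1) + a 0%nat) by ring.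
      rewrite (Cmod_eq_0 (F z - (0 + a 0%nat * 1))); [ring|].
      generalize (Cmod_ge_0 (F z - (0 + a 0%nat * 1))). lra. }
    (* the remainder of order n + 2 is below e |t - z|^(n+1) near z *)
    assert (T' : forall n e, (0 < e)%R -> exists d, (0 < d)%R /\ forall t, (Cmod (t - z) < d)%R ->
      (Cmod (F t - csum (fun k => a k * (t - z) ^ k)%C (S (S n))) <= e * Cmod (t - z) ^ S n)%R).
    { intros n e He. exists (Rmin 1 (e / (M + 1))).
      split; [apply Rmin_pos; [lra|apply Rdiv_lt_0_compat; lra]|]. intros t Ht.
      assert (L1 := Rlt_le_trans _ _ _ Ht (Rmin_l _ _)).
      assert (L2 := Rlt_le_trans _ _ _ Ht (Rmin_r _ _)).
      assert (K := T (S (S n)) (t - z) ltac:(lra)).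
      replace (z + (t - z)) with t in K by ring. eapply Rle_trans; [exact K|].
      assert (P := Cmod_ge_0 (t - z)).
      change (Cmod (t - z) ^ S (S n))%R with (Cmod (t - z) * Cmod (t - z) ^ S n)%R.
      rewrite <- Rmult_assoc. apply Rmult_le_compat_r; [now apply pow_le|].
      apply Rlt_div_r in L2; [nra|lra]. }
    assert (E1 : C_derive F z = a 1%nat).
    { apply has_cderiv_C_derive. intros e He. destruct (T' 0%nat e He) as [d [Hd K]].
      exists d. split; [exact Hd|]. intros t Ht. specialize (K t Ht). simpl in K.
      rewrite Rmult_1_r in K. rewrite E0.
      replace (F t - a 0%nat - a 1%nat * (t - z)) with
        (F t - (0 + a 0%nat * 1 + a 1%nat * ((t - z) * 1))) by ring. exact K. }
    exists (a 2%nat). intros e He. destruct (T' 1%nat e He) as [d [Hd K]].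
    exists d. split; [exact Hd|]. intros t Ht. specialize (K t Ht). simpl in K.
    unfold divdiff at 2. destruct (Ceq_dec z z) as [_|n]; [|now elim n].
    unfold divdiff. destruct (Ceq_dec t z) as [->|N].
    { replace (C_derive F z - C_derive F z - a 2%nat * (z - z)) with (RtoC 0) by ring.
      rewrite Cmod_0. apply Rmult_le_pos; [lra|apply Cmod_ge_0]. }
    assert (Nz := Cneq_minus _ _ N).
    assert (Pz : (0 < Cmod (t - z))%R) by (apply Cmod_gt_0; exact Nz).
    rewrite E1, E0.
    replace ((F t - a 0%nat) / (t - z) - a 1%nat - a 2%nat * (t - z)) with
      ((F t - (0 + a 0%nat * 1 + a 1%nat * ((t - z) * 1) + a 2%nat * ((t - z) * ((t - z) * 1)))) / (t - z))
      by (field; exact Nz).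
    rewrite Cmod_div by exact Nz. apply Rle_div_l; [exact Pz|]. lra.
  - assert (Nz := Cneq_minus _ _ N).
    eexists. apply (has_cderiv_ext_loc (fun t => (F t + - F z) * / (t - z)) _ t0 _ (Cmod (t0 - z))).
    + apply Cmod_gt_0. exact Nz.
    + intros t Ht. unfold divdiff. destruct (Ceq_dec t z) as [->|_]; [|reflexivity].
      rewrite Cmod_minus_sym in Ht. lra.
    + apply (has_cderiv_mult (fun t => F t + - F z) (fun t => / (t - z))).
      * apply has_cderiv_plus; [now apply entire_C_derive|apply has_cderiv_const].
      * apply (has_cderiv_comp (fun t => / t) (fun t => t - z)).
        -- apply (has_cderiv_plus (fun t => t) (fun _ => - z)); [apply has_cderiv_id|apply has_cderiv_const].
        -- now apply has_cderiv_inv.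
Qed.

Lemma divdiff_unique (z : C) (F G : C -> C) :
  entire F -> ccont G z -> (forall t, (t - z) * G t = F t - F z) -> divdiff z F = G.
Proof.
  intros HF HG E. apply functional_extensionality.
  apply (ccont_cancel _ _ z); [now apply entire_ccont, entire_divdiff|exact HG|].
  intros t. now rewrite divdiff_spec, E.
Qed.

(** The recursion for second divided differences. It says that the operators
    [divdiff z] form the resolvent family of the backward shift, up to a change of
    parameter; this is how information about [divdiff 0] reaches all z. *)
Lemma divdiff_resolvent (z w : C) (F : C -> C) :
  entire F ->
  forall t, (w - z) * divdiff w (divdiff z F) t = divdiff w F t - divdiff z F t.
Proof.
  intros HF.
  assert (C0 : forall G s, entire G -> ccont G s) by (intros; now apply entire_ccont).
  assert (E1 := entire_divdiff z F HF). assert (E2 := entire_divdiff w F HF).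
  assert (E3 := entire_divdiff w _ E1).
  assert (CL : forall s, ccont (fun t => (w - z) * divdiff w (divdiff z F) t) s).
  { intros s. apply ccont_mult; [apply ccont_const|auto]. }
  assert (CR : forall s, ccont (fun t => divdiff w F t - divdiff z F t) s).
  { intros s. apply ccont_minus; auto. }
  assert (Cl : forall s, ccont (fun t => t - z) s).
  { intros s. apply ccont_minus; [apply ccont_id|apply ccont_const]. }
  apply (ccont_cancel _ _ z); [apply CL|apply CR|].
  apply (ccont_cancel _ _ w);
    [apply (ccont_mult (fun t => t - z)); [apply Cl|apply CL]|
     apply (ccont_mult (fun t => t - z)); [apply Cl|apply CR]|].
  intros t.
  replace ((t - w) * ((t - z) * ((w - z) * divdiff w (divdiff z F) t))) with
    ((w - z) * (t - z) * ((t - w) * divdiff w (divdiff z F) t)) by ring.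
  rewrite divdiff_spec.
  replace ((w - z) * (t - z) * (divdiff z F t - divdiff z F w)) with
    ((w - z) * ((t - z) * divdiff z F t) - (t - z) * ((w - z) * divdiff z F w)) by ring.
  rewrite !divdiff_spec.
  replace ((t - w) * ((t - z) * (divdiff w F t - divdiff z F t))) with
    ((t - z) * ((t - w) * divdiff w F t) - (t - w) * ((t - z) * divdiff z F t)) by ring.
  rewrite !divdiff_spec. ring.
Qed.

Lemma divdiff_mult_id (z : C) (F : C -> C) :
  entire F -> divdiff z (fun t => t * F t) = (fun t => F t + z * divdiff z F t).
Proof.
  intros HF. apply divdiff_unique.
  - now apply (entire_mult (fun t => t)); [apply entire_id|].
  - apply ccont_plus; [now apply entire_ccont|]. apply ccont_mult; [apply ccont_const|].
    now apply entire_ccont, entire_divdiff.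
  - intros t. replace ((t - z) * (F t + z * divdiff z F t)) with
      ((t - z) * F t + z * ((t - z) * divdiff z F t)) by ring. rewrite divdiff_spec. ring.
Qed.

Lemma divdiff_plus (z : C) (F G : C -> C) :
  entire F -> entire G -> divdiff z (fun t => F t + G t) = (fun t => divdiff z F t + divdiff z G t).
Proof.
  intros HF HG. apply divdiff_unique.
  - now apply entire_plus.
  - apply ccont_plus; now apply entire_ccont, entire_divdiff.
  - intros t. replace ((t - z) * (divdiff z F t + divdiff z G t)) with
      ((t - z) * divdiff z F t + (t - z) * divdiff z G t) by ring. rewrite !divdiff_spec. ring.
Qed.

Lemma divdiff_scal (z c : C) (F : C -> C) :
  entire F -> divdiff z (fun t => c * F t) = (fun t => c * divdiff z F t).
Proof.
  intros HF. apply divdiff_unique.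
  - apply (entire_mult (fun _ => c)); [apply entire_const|exact HF].
  - apply ccont_mult; [apply ccont_const|]. now apply entire_ccont, entire_divdiff.
  - intros t. replace ((t - z) * (c * divdiff z F t)) with (c * ((t - z) * divdiff z F t)) by ring.
    rewrite divdiff_spec. ring.
Qed.

Lemma divdiff_const (z c : C) : divdiff z (fun _ => c) = (fun _ => 0).
Proof.
  apply divdiff_unique; [apply entire_const|apply ccont_const|]. intros t. ring.
Qed.

(** The circle of radius 2 leaves room for the disc of radius 1 in the Taylor estimate. *)
Lemma divdiff_bound_near (z : C) (F : C -> C) (M : R) :
  entire F -> (forall s, Cmod (s - z) = 2%R -> (Cmod (F s) <= M)%R) ->
  forall t, (Cmod (t - z) < 1)%R -> (Cmod (divdiff z F t) <= M)%R.
Proof.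
  intros HF HM.
  destruct (entire_taylor _ (entire_translate F z HF)) as [a Ha].
  destruct (Ha 2%R M Rlt_0_2) as [_ Ha2].
  { intros y _. apply HM. replace (z + circle 2 y - z) with (circle 2 y) by ring.
    apply Cmod_circle. lra. }
  assert (E0 : F z = a 0%nat).
  { assert (K := Ha2 1%nat 0 ltac:(rewrite Cmod_0; lra)). rewrite Cmod_0 in K. simpl csum in K.
    replace (z + 0) with z in K by ring.
    replace (F z - (0 + a 0%nat * 1)) with (F z - a 0%nat) in K by ring.
    replace (F z) with (F z - a 0%nat + a 0%nat) by ring.
    rewrite (Cmod_eq_0 (F z - a 0%nat)); [ring|].
    generalize (Cmod_ge_0 (F z - a 0%nat)). simpl in K. lra. }
  assert (K : forall t, t <> z -> (Cmod (t - z) < 1)%R -> (Cmod (divdiff z F t) <= M)%R).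
  { intros t N Ht. unfold divdiff. destruct (Ceq_dec t z) as [Z|_]; [contradiction|].
    assert (Nz := Cneq_minus _ _ N).
    assert (Pz : (0 < Cmod (t - z))%R) by (apply Cmod_gt_0; exact Nz).
    rewrite Cmod_div by exact Nz. apply Rle_div_l; [exact Pz|].
    assert (Q := Ha2 1%nat (t - z) ltac:(lra)). simpl csum in Q.
    replace (z + (t - z)) with t in Q by ring.
    replace (F t - (0 + a 0%nat * 1)) with (F t - F z) in Q by (rewrite E0; ring).
    eapply Rle_trans; [exact Q|]. right. simpl. field. }
  intros t Ht. destruct (Ceq_dec t z) as [->|N]; [|now apply K].
  apply (ccont_closed_bound _ z M 1); [lra|now apply entire_ccont, entire_divdiff|exact K].
Qed.

(** The Taylor remainder of order n + 1, bounded on circles of radius r, is O(1/r). *)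
Lemma liouville (F : C -> C) (n : nat) (rho B : R) :
  entire F -> (forall z, (rho <= Cmod z)%R -> (Cmod (F z) <= B * Cmod z ^ n)%R) ->
  exists a : nat -> C, forall z, F z = csum (fun k => a k * z ^ k) (S n).
Proof.
  intros HF HB. destruct (entire_taylor F HF) as [a Ha]. exists a. intros z.
  assert (Pz := Cmod_ge_0 z).
  set (S := csum (fun k => a k * z ^ k) (S n)).
  replace (F z) with (F z - S + S) by ring.
  rewrite (le_mult_pos_eq_0 (F z - S) (2 * B * Cmod z ^ Datatypes.S n)); [ring|].
  intros e He.
  set (r := Rmax (Rmax 1 rho) (Rmax (2 * Cmod z) (/ e))).
  assert (r1 : (1 <= r)%R) by (unfold r; eapply Rle_trans; [apply Rmax_l|apply Rmax_l]).
  assert (r2 : (rho <= r)%R) by (unfold r; eapply Rle_trans; [apply Rmax_r|apply Rmax_l]).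
  assert (r3 : (2 * Cmod z <= r)%R) by (unfold r; eapply Rle_trans; [apply Rmax_l|apply Rmax_r]).
  assert (r4 : (/ e <= r)%R) by (unfold r; eapply Rle_trans; [apply Rmax_r|apply Rmax_r]).
  clearbody r.
  destruct (Ha r (B * r ^ n)%R ltac:(lra)) as [_ K].
  { intros y _. rewrite <- (Cmod_circle r y) at 2 by lra. apply HB. rewrite Cmod_circle; lra. }
  eapply Rle_trans; [apply (K (Datatypes.S n) z r3)|].
  assert (HB0 : (0 <= B)%R).
  { assert (Q := HB (RtoC r) ltac:(rewrite Cmod_R, Rabs_right; lra)).
    rewrite Cmod_R, Rabs_right in Q by lra.
    assert (0 < r ^ n)%R by (apply pow_lt; lra).
    generalize (Cmod_ge_0 (F (RtoC r))). nra. }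
  replace (2 * (B * r ^ n) * (Cmod z / r) ^ Datatypes.S n)%R with
    (/ r * (2 * B * Cmod z ^ Datatypes.S n))%R.
  - apply Rmult_le_compat_r.
    + apply Rmult_le_pos; [lra|now apply pow_le].
    + rewrite <- (Rinv_inv e). apply Rinv_le_contravar; [now apply Rinv_0_lt_compat|exact r4].
  - unfold Rdiv. rewrite Rpow_mult_distr, pow_inv. simpl. field. split; [apply pow_nonzero; lra|lra].
Qed.

(** On small circles of radius r the function is O(r^(n+1)), so its n-th Taylor
    coefficient is O(r). *)
Lemma entire_flat_zero (F : C -> C) :
  entire F -> (forall n, exists g, ccont g 0 /\ forall z, F z = z ^ n * g z) -> forall z, F z = 0.
Proof.
  intros HF Hflat. destruct (entire_taylor F HF) as [a Ha].
  assert (A0 : forall n, a n = 0).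
  { intros n. destruct (Hflat (S n)) as [g [Hg E]].
    destruct (Hg 1%R Rlt_0_1) as [d [Hd Hd']].
    apply (le_mult_pos_eq_0 _ (Cmod (g 0) + 1)). intros e He.
    set (r := Rmin e (d / 2)).
    assert (Hr : (0 < r)%R) by (apply Rmin_pos; lra).
    assert (Hrd : (r < d)%R) by (generalize (Rmin_r e (d / 2)); fold r; lra).
    destruct (Ha r ((Cmod (g 0) + 1) * r ^ S n)%R Hr) as [K _].
    { intros y _. rewrite E, Cmod_mult, Cmod_pow, Cmod_circle, Rmult_comm by lra.
      apply Rmult_le_compat_r; [apply pow_le; lra|].
      assert (Q := Hd' (circle r y)). replace (circle r y - 0) with (circle r y) in Q by ring.
      rewrite Cmod_circle in Q by lra. specialize (Q Hrd).
      generalize (Cmod_triangle_inv (g (circle r y)) (g 0)). lra. }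
    specialize (K n). simpl in K.
    assert (Pr : (0 < r ^ n)%R) by now apply pow_lt.
    assert (K2 : (Cmod (a n) <= r * (Cmod (g 0%R) + 1))%R).
    { apply Rmult_le_reg_r with (r ^ n)%R; [exact Pr|]. lra. }
    eapply Rle_trans; [exact K2|]. apply Rmult_le_compat_r; [|apply Rmin_l].
    generalize (Cmod_ge_0 (g 0)). lra. }
  intros z. assert (Pz := Cmod_ge_0 z). set (r := (2 * Cmod z + 1)%R).
  destruct (entire_bounded_circle F r HF) as [M HM].
  destruct (Ha r M ltac:(unfold r; lra) HM) as [_ K].
  apply (eq_of_geometric _ _ (Cmod z / r) (2 * M)).
  - apply Cmod_ratio. unfold r. lra.
  - assert (0 <= M)%R by (eapply Rle_trans; [apply Cmod_ge_0|apply (HM 0%R); lra]). lra.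
  - intros n. assert (Q := K (S n) z ltac:(unfold r; lra)).
    replace (csum (fun k => a k * z ^ k) (S n)) with (RtoC 0) in Q; [lra|].
    symmetry. clear Q. induction (S n) as [|m IH]; [reflexivity|]. simpl. rewrite IH, A0. ring.
Qed.

(** * The Hahn-Banach theorem *)

Section HahnBanach.

Context {A : Type}.

Definition fplus (f g : A -> C) : A -> C := fun z => f z + g z.
Definition fscal (c : C) (f : A -> C) : A -> C := fun z => c * f z.
Definition fzero : A -> C := fun _ => 0.
#[local] Hint Unfold fplus fscal fzero : pointwise.

Record seminorm_on (X : (A -> C) -> Prop) (p : (A -> C) -> R) : Prop := {
  sn_plus_in : forall f g, X f -> X g -> X (fplus f g);
  sn_scal_in : forall c f, X f -> X (fscal c f);
  sn_plus : forall f g, X f -> X g -> (p (fplus f g) <= p f + p g)%R;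
  sn_scal : forall c f, X f -> (p (fscal c f) <= Cmod c * p f)%R }.

(** A pair (f, r) in such a cone asserts that the functional to be constructed is
    below r at f: the strict epigraph of a linear functional is of this kind. With
    cones in place of functionals, a chain has its union as an upper bound. *)
Record separating_cone (X : (A -> C) -> Prop) (E : (A -> C) * R -> Prop) : Prop := {
  co_in : forall f r, E (f, r) -> X f;
  co_plus : forall f g r s, E (f, r) -> E (g, s) -> E (fplus f g, (r + s)%R);
  co_scal : forall c f r, (0 < c)%R -> E (f, r) -> E (fscal (RtoC c) f, (c * r)%R);
  co_pos : forall r, E (fzero, r) -> (0 < r)%R }.

(** Zorn's lemma. The members of a chain are considered after adding E0, so that the
    empty chain needs no separate treatment. *)
Lemma maximal_cone (X : (A -> C) -> Prop) (E0 : (A -> C) * R -> Prop) :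
  separating_cone X E0 -> exists E, separating_cone X E /\ (forall x, E0 x -> E x) /\
    forall E', separating_cone X E' -> (forall x, E x -> E' x) -> forall x, E' x -> E x.
Proof.
  intros H0.
  set (P := fun E : (A -> C) * R -> Prop => separating_cone X (fun x => E x \/ E0 x)).
  destruct (@classical_sets.Zorn_bigcup _ P) as [E [HE Hmax]].
  - intros F HF Htot. unfold P.
    assert (dir : forall x y, (classical_sets.bigcup F (fun E => E) x \/ E0 x) ->
       (classical_sets.bigcup F (fun E => E) y \/ E0 y) ->
       exists E, separating_cone X (fun x => E x \/ E0 x) /\ (E x \/ E0 x) /\ (E y \/ E0 y) /\
         forall z, (E z \/ E0 z) -> (classical_sets.bigcup F (fun E => E) z \/ E0 z)).
    { intros x y [[E1 F1 X1]|X1] [[E2 F2 X2]|X2].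
      - destruct (Htot E1 E2 F1 F2) as [S|S].
        + exists E2. split; [now apply HF|]. split; [left; now apply S|]. split; [now left|].
          intros z [Z|Z]; [left; now exists E2|now right].
        + exists E1. split; [now apply HF|]. split; [now left|]. split; [left; now apply S|].
          intros z [Z|Z]; [left; now exists E1|now right].
      - exists E1. split; [now apply HF|]. split; [now left|]. split; [now right|].
        intros z [Z|Z]; [left; now exists E1|now right].
      - exists E2. split; [now apply HF|]. split; [now right|]. split; [now left|].
        intros z [Z|Z]; [left; now exists E2|now right].
      - exists E0. split.
        { destruct H0 as [c1 c2 c3 c4]. split.
          - intros f r [Z|Z]; eauto.
          - intros f g r s [Z|Z] [Z'|Z']; left; eauto.
          - intros c f r Hc [Z|Z]; left; eauto.
          - intros r [Z|Z]; eauto. }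
        split; [now left|]. split; [now left|]. intros z [Z|Z]; now right. }
    split.
    + intros f r Hf. destruct (dir _ _ Hf Hf) as (E & HE & E1 & _). exact (co_in _ _ HE _ _ E1).
    + intros f g r s Hf Hg. destruct (dir _ _ Hf Hg) as (E & HE & E1 & E2 & S).
      apply S. exact (co_plus _ _ HE _ _ _ _ E1 E2).
    + intros c f r Hc Hf. destruct (dir _ _ Hf Hf) as (E & HE & E1 & _ & S).
      apply S. exact (co_scal _ _ HE _ _ _ Hc E1).
    + intros r Hf. destruct (dir _ _ Hf Hf) as (E & HE & E1 & _). exact (co_pos _ _ HE _ E1).
  - exists (fun x => E x \/ E0 x). split; [exact HE|]. split; [now right|].
    intros E' HE' HS x Hx. left. apply NNPP. intros Hn.
    apply (Hmax E').
    + split; [|intros K; exact (Hn (K x Hx))]. intros y Hy. apply HS. now left.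
    + unfold P. replace (fun y => E' y \/ E0 y) with E'; [exact HE'|].
      apply functional_extensionality; intros y.
      apply propositional_extensionality. split; [now left|].
      intros [Y|Y]; [exact Y|]. apply HS. now right.
Qed.

(** A maximal cone is a half space. Otherwise E and (f, r) would generate a larger cone;
    it meets the pairs (0, s) only for s > 0, because s <= 0 would put some (-f, s')
    with s' <= -r into E. The margin eps leaves the boundary undecided. *)
Lemma cone_dichotomy (X : (A -> C) -> Prop) (E : (A -> C) * R -> Prop) :
  (forall c f, X f -> X (fscal c f)) ->
  (forall f g, X f -> X g -> X (fplus f g)) ->
  separating_cone X E -> (forall r, (0 < r)%R -> E (fzero, r)) ->
  (forall E', separating_cone X E' -> (forall x, E x -> E' x) -> forall x, E' x -> E x) ->
  forall f r eps, X f -> (0 < eps)%R ->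
    E (f, (r + eps)%R) \/ E (fscal (- (1)) f, (- r + eps)%R).
Proof.
  intros Xs Xp HE Hpos Hmax f r eps Hf Heps.
  apply NNPP. intros N. apply not_or_and in N. destruct N as [N1 N2].
  set (E' := fun x : (A -> C) * R => exists t g s, (0 <= t)%R /\ E (g, s) /\
     x = (fplus g (fscal (RtoC t) f), (s + t * r)%R)).
  apply N1. apply (Hmax E').
  2:{ intros [g s] Hx. exists 0%R, g, s. split; [lra|]. split; [exact Hx|].
      f_equal; [fun_ring|ring]. }
  2:{ exists 1%R, fzero, eps. split; [lra|]. split; [now apply Hpos|].
      f_equal; [fun_ring|ring]. }
  split.
  - intros g s (t & g' & s' & Ht & Hg' & Eq). injection Eq as -> ->.
    apply Xp; [exact (co_in _ _ HE _ _ Hg')|now apply Xs].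
  - intros f1 f2 r1 r2 (t1 & g1 & s1 & T1 & G1 & Eq1) (t2 & g2 & s2 & T2 & G2 & Eq2).
    injection Eq1 as -> ->. injection Eq2 as -> ->.
    exists (t1 + t2)%R, (fplus g1 g2), (s1 + s2)%R. split; [lra|].
    split; [exact (co_plus _ _ HE _ _ _ _ G1 G2)|].
    rewrite RtoC_plus. f_equal; [fun_ring|ring].
  - intros c g s Hc (t & g' & s' & Ht & Hg' & Eq). injection Eq as -> ->.
    exists (c * t)%R, (fscal (RtoC c) g'), (c * s')%R. split; [nra|].
    split; [exact (co_scal _ _ HE _ _ _ Hc Hg')|].
    rewrite RtoC_mult. f_equal; [fun_ring|ring].
  - intros s (t & g & s' & Ht & Hg & Eq). injection Eq as Eg ->.
    assert (Eg' : forall z, g z = - (RtoC t * f z)).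
    { intros z. assert (Z : RtoC 0 = g z + RtoC t * f z) by exact (f_equal (fun h => h z) Eg).
      transitivity ((g z + RtoC t * f z) - RtoC t * f z); [ring|]. rewrite <- Z. ring. }
    destruct (Req_dec t 0) as [->|Ht0].
    + replace (s' + 0 * r)%R with s' by ring. apply (co_pos _ _ HE).
      replace fzero with g; [exact Hg|].
      apply functional_extensionality; intros z. rewrite Eg'. unfold fzero. ring.
    + (* -f lies over s' / t, which must exceed -r *)
      apply Rnot_le_lt. intros Hle. apply N2.
      assert (Hit : (0 < / t)%R) by (apply Rinv_0_lt_compat; lra).
      assert (Q := co_scal _ _ HE _ _ _ Hit Hg).
      assert (Le : (/ t * s' <= - r)%R).
      { apply Rmult_le_reg_l with t; [lra|]. rewrite <- Rmult_assoc, Rinv_r by lra. lra. }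
      replace (fscal (- (1)) f) with (fplus (fscal (RtoC (/ t)) g) fzero).
      * replace (- r + eps)%R with (/ t * s' + (- r + eps - / t * s'))%R by ring.
        apply (co_plus _ _ HE); [exact Q|]. apply Hpos. lra.
      * apply functional_extensionality; intros z. unfold fplus, fscal, fzero.
        rewrite Eg', RtoC_inv by lra. field. intros Z; apply RtoC_inj in Z; lra.
Qed.

(** Start from the cone of all (f, r) for which r + t exceeds p (f + t G), for some
    t >= 0. It contains (f, r) for r > p f, and (-G, r) for r > -1. The boundary of a
    maximal cone above it is the graph of a real-linear u with u <= p and u G >= 1, and
    phi f = u f - i u (i f) is complex linear with the same bound. *)
Theorem hahn_banach (X : (A -> C) -> Prop) (p : (A -> C) -> R) (G : A -> C) :
  seminorm_on X p -> X G -> (1 <= p G)%R ->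
  exists phi : (A -> C) -> C,
    (forall f g, X f -> X g -> phi (fplus f g) = phi f + phi g) /\
    (forall c f, X f -> phi (fscal c f) = c * phi f) /\
    (forall f, X f -> (Cmod (phi f) <= p f)%R) /\ phi G <> 0.
Proof.
  intros [Xp Xs psub phom] XG HG.
  assert (X0 : X fzero).
  { replace fzero with (fscal 0 G); [now apply Xs|].
    fun_ring. }
  assert (p0 : p fzero = 0%R).
  { assert (E0 : fscal 0 fzero = fzero).
    { fun_ring. }
    assert (E2 : fplus fzero fzero = fzero).
    { fun_ring. }
    assert (H1 := phom 0 fzero X0). rewrite E0, Cmod_0 in H1.
    assert (H2 := psub fzero fzero X0 X0). rewrite E2 in H2. lra. }
  set (E0 := fun x : (A -> C) * R => X (fst x) /\ exists t, (0 <= t)%R /\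
     (p (fplus (fst x) (fscal (RtoC t) G)) < snd x + t)%R).
  destruct (maximal_cone X E0) as (E & HE & HE0 & Hmax).
  { split.
    - intros f r [H _]. exact H.
    - intros f g r s [Hf [t [Ht Hp]]] [Hg [t' [Ht' Hp']]]. cbn [fst snd] in *.
      split; [now apply Xp|]. exists (t + t')%R. split; [lra|]. cbn [fst snd].
      replace (fplus (fplus f g) (fscal (RtoC (t + t')) G)) with
        (fplus (fplus f (fscal (RtoC t) G)) (fplus g (fscal (RtoC t') G))).
      2:{ apply functional_extensionality; intros z. unfold fplus, fscal. rewrite RtoC_plus. ring. }
      eapply Rle_lt_trans; [apply psub; apply Xp; auto|]. lra.
    - intros c f r Hc [Hf [t [Ht Hp]]]. cbn [fst snd] in *.
      split; [now apply Xs|]. exists (c * t)%R. split; [nra|]. cbn [fst snd].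
      replace (fplus (fscal (RtoC c) f) (fscal (RtoC (c * t)) G)) with
        (fscal (RtoC c) (fplus f (fscal (RtoC t) G))).
      2:{ apply functional_extensionality; intros z. unfold fplus, fscal. rewrite RtoC_mult. ring. }
      eapply Rle_lt_trans; [apply phom; apply Xp; auto|].
      rewrite Cmod_R, Rabs_right by lra. nra.
    - intros r [_ [t [Ht Hp]]]. cbn [fst snd] in *.
      replace (fplus fzero (fscal (RtoC t) G)) with (fscal (RtoC t) G) in Hp
        by fun_ring.
      destruct (Req_dec t 0) as [->|Ht0].
      + assert (H := phom 0 G XG).
        replace (fscal 0 G) with fzero in Hp by
          (fun_ring). lra.
      + assert (K := phom (RtoC (/ t)) (fscal (RtoC t) G) (Xs _ _ XG)).
        replace (fscal (RtoC (/ t)) (fscal (RtoC t) G)) with G in K.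
        2:{ apply functional_extensionality; intros z. unfold fscal. rewrite RtoC_inv by lra.
            field. intros Z; apply RtoC_inj in Z; lra. }
        rewrite Cmod_R, Rabs_right in K by (left; apply Rinv_0_lt_compat; lra).
        assert (t <= p (fscal (RtoC t) G))%R.
        { apply Rmult_le_reg_l with (/ t)%R; [apply Rinv_0_lt_compat; lra|].
          rewrite Rinv_l by exact Ht0. lra. }
        lra. }
  assert (Ep : forall f r, X f -> (p f < r)%R -> E (f, r)).
  { intros f r Hf Hr. apply HE0. split; [exact Hf|]. exists 0%R. split; [lra|].
    cbn [fst snd]. replace (fplus f (fscal 0 G)) with f; [lra|].
    fun_ring. }
  assert (Epos : forall r, (0 < r)%R -> E (fzero, r)) by (intros r Hr; apply Ep; [exact X0|lra]).
  assert (Dich := cone_dichotomy X E Xs Xp HE Epos Hmax).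
  assert (Eup : forall f r s, E (f, r) -> (r < s)%R -> E (f, s)).
  { intros f r s H Hrs. replace f with (fplus f fzero)
      by fun_ring.
    replace s with (r + (s - r))%R by ring. apply (co_plus _ _ HE); [exact H|]. apply Epos. lra. }
  assert (Eneg : forall f r s, E (f, r) -> E (fscal (- (1)) f, s) -> (0 < r + s)%R).
  { intros f r s H1 H2. apply (co_pos _ _ HE).
    replace fzero with (fplus f (fscal (- (1)) f))
      by fun_ring.
    now apply (co_plus _ _ HE). }
  (* u f is the height of the boundary of E above f *)
  assert (Hu : forall f, exists u, X f -> (forall r, (u < r)%R -> E (f, r)) /\ (forall r, E (f, r) -> (u <= r)%R)).
  { intros f. destruct (classic (X f)) as [Hf|Hf]; [|exists 0%R; intros H; contradiction].
    destruct (completeness (fun r => E (f, (- r)%R))) as [m [Hm1 Hm2]].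
    - exists (p (fscal (- (1)) f) + 1)%R. intros r Hr.
      assert (Q := Ep (fscal (- (1)) f) (p (fscal (- (1)) f) + 1)%R (Xs _ _ Hf) ltac:(lra)).
      assert (K := Eneg _ _ _ Hr Q). lra.
    - exists (- (p f + 1))%R. rewrite Ropp_involutive. apply Ep; [exact Hf|lra].
    - exists (- m)%R. intros _. split.
      + intros r Hr. apply NNPP. intros N. apply (Rlt_irrefl m).
        apply Rle_lt_trans with (- r)%R; [|lra]. apply Hm2. intros s Hs.
        apply Rnot_lt_le. intros Hlt. apply N. apply (Eup f (- s)%R); [exact Hs|lra].
      + intros r Hr. assert (K : (- r <= m)%R) by (apply Hm1; now rewrite Ropp_involutive). lra. }
  set (u := fun f => proj1_sig (constructive_indefinite_description _ (Hu f))).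
  assert (u1 : forall f, X f -> forall r, (u f < r)%R -> E (f, r)).
  { intros f Hf. apply (proj2_sig (constructive_indefinite_description _ (Hu f)) Hf). }
  assert (u2 : forall f, X f -> forall r, E (f, r) -> (u f <= r)%R).
  { intros f Hf. apply (proj2_sig (constructive_indefinite_description _ (Hu f)) Hf). }
  clearbody u.
  assert (uneg : forall f, X f -> u (fscal (- (1)) f) = (- u f)%R).
  { intros f Hf. apply Rle_antisym; apply le_epsilon; intros e He.
    - destruct (Dich f (u f - e / 2)%R (e / 4)%R Hf ltac:(lra)) as [K|K].
      + apply u2 in K; [lra|exact Hf].
      + apply u2 in K; [lra|now apply Xs].
    - assert (Q1 := u1 f Hf (u f + e / 2)%R ltac:(lra)).
      assert (Q2 := u1 _ (Xs (- (1)) _ Hf) (u (fscal (- (1)) f) + e / 2)%R ltac:(lra)).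
      assert (K := Eneg _ _ _ Q1 Q2). lra. }
  assert (usub : forall f g, X f -> X g -> (u (fplus f g) <= u f + u g)%R).
  { intros f g Hf Hg. apply le_epsilon. intros e He. apply u2; [now apply Xp|].
    replace (u f + u g + e)%R with ((u f + e / 2) + (u g + e / 2))%R by field.
    apply (co_plus _ _ HE); apply u1; auto; lra. }
  assert (uadd : forall f g, X f -> X g -> u (fplus f g) = (u f + u g)%R).
  { intros f g Hf Hg. apply Rle_antisym; [now apply usub|].
    assert (K := usub (fplus f g) (fscal (- (1)) g) (Xp _ _ Hf Hg) (Xs _ _ Hg)).
    rewrite uneg in K by exact Hg.
    replace (fplus (fplus f g) (fscal (- (1)) g)) with f in K
      by fun_ring. lra. }
  assert (uscal_le : forall c f, (0 < c)%R -> X f -> (u (fscal (RtoC c) f) <= c * u f)%R).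
  { intros c f Hc Hf. apply le_epsilon. intros e He. apply u2; [now apply Xs|].
    replace (c * u f + e)%R with (c * (u f + e / c))%R by (field; lra).
    apply (co_scal _ _ HE); [exact Hc|]. apply u1; [exact Hf|].
    assert (0 < e / c)%R by (apply Rdiv_lt_0_compat; lra). lra. }
  assert (uscal_pos : forall c f, (0 < c)%R -> X f -> u (fscal (RtoC c) f) = (c * u f)%R).
  { intros c f Hc Hf. apply Rle_antisym; [now apply uscal_le|].
    assert (Hic : (0 < / c)%R) by now apply Rinv_0_lt_compat.
    assert (K := uscal_le (/ c)%R (fscal (RtoC c) f) Hic (Xs _ _ Hf)).
    replace (fscal (RtoC (/ c)) (fscal (RtoC c) f)) with f in K.
    2:{ apply functional_extensionality; intros z. unfold fscal. rewrite RtoC_inv by lra.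
        field. intros Z; apply RtoC_inj in Z; lra. }
    apply Rmult_le_reg_l with (/ c)%R; [exact Hic|].
    rewrite <- Rmult_assoc, Rinv_l; lra. }
  assert (uscal : forall (c : R) f, X f -> u (fscal (RtoC c) f) = (c * u f)%R).
  { intros c f Hf. destruct (Rtotal_order c 0) as [Hc|[->|Hc]].
    - replace (fscal (RtoC c) f) with (fscal (RtoC (- c)) (fscal (- (1)) f)).
      + rewrite uscal_pos, uneg by (try lra; auto). ring.
      + apply functional_extensionality; intros z. unfold fscal. rewrite RtoC_opp. ring.
    - replace (fscal 0 f) with (fplus f (fscal (- (1)) f))
        by fun_ring.
      rewrite uadd, uneg by auto. ring.
    - now apply uscal_pos. }
  assert (ule : forall f, X f -> (u f <= p f)%R).
  { intros f Hf. apply le_epsilon. intros e He. apply u2; [exact Hf|]. apply Ep; [exact Hf|lra]. }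
  assert (uG : (1 <= u G)%R).
  { assert (K : (u (fscal (- (1)) G) <= -1)%R).
    { apply le_epsilon. intros e He. apply u2; [now apply Xs|]. apply HE0.
      split; [now apply Xs|]. exists 1%R. split; [lra|]. cbn [fst snd].
      replace (fplus (fscal (- (1)) G) (fscal 1 G)) with fzero
        by fun_ring.
      rewrite p0. lra. }
    rewrite uneg in K by exact XG. lra. }
  set (phi := fun f => RtoC (u f) - Ci * RtoC (u (fscal Ci f))).
  assert (phi_add : forall f g, X f -> X g -> phi (fplus f g) = phi f + phi g).
  { intros f g Hf Hg. unfold phi.
    replace (fscal Ci (fplus f g)) with (fplus (fscal Ci f) (fscal Ci g))
      by fun_ring.
    rewrite !uadd, !RtoC_plus by auto. ring. }
  assert (Ci2 : Ci * Ci = - (1)).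
  { unfold Ci, Cmult, Copp, RtoC; simpl. f_equal; ring. }
  assert (phi_scal : forall c f, X f -> phi (fscal c f) = c * phi f).
  { intros c f Hf.
    assert (Ec : c = RtoC (fst c) + RtoC (snd c) * Ci).
    { destruct c as [a b]. unfold RtoC, Ci, Cplus, Cmult; simpl. f_equal; ring. }
    unfold phi.
    replace (fscal c f) with (fplus (fscal (RtoC (fst c)) f) (fscal (RtoC (snd c)) (fscal Ci f))).
    2:{ apply functional_extensionality; intros z. unfold fplus, fscal. rewrite Ec at 3. ring. }
    replace (fscal Ci (fplus (fscal (RtoC (fst c)) f) (fscal (RtoC (snd c)) (fscal Ci f))))
      with (fplus (fscal (RtoC (fst c)) (fscal Ci f)) (fscal (RtoC (- snd c)) f)).
    2:{ apply functional_extensionality; intros z. unfold fplus, fscal.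
        replace (Ci * (RtoC (fst c) * f z + RtoC (snd c) * (Ci * f z))) with
          (RtoC (fst c) * (Ci * f z) + RtoC (snd c) * (Ci * Ci) * f z) by ring.
        rewrite Ci2, RtoC_opp. ring. }
    rewrite !uadd, !uscal, !RtoC_plus, !RtoC_mult, RtoC_opp by auto.
    rewrite Ec at 5.
    set (a := RtoC (fst c)). set (b := RtoC (snd c)).
    set (v := RtoC (u f)). set (w := RtoC (u (fscal Ci f))).
    replace ((a + b * Ci) * (v - Ci * w)) with (a * v - a * Ci * w + b * Ci * v - b * (Ci * Ci) * w) by ring.
    rewrite Ci2. ring. }
  exists phi. split; [exact phi_add|]. split; [exact phi_scal|]. split.
  - intros f Hf.
    destruct (Ceq_dec (phi f) 0) as [E1|N].
    + rewrite E1, Cmod_0. assert (K := psub f (fscal (- (1)) f) Hf (Xs _ _ Hf)).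
      replace (fplus f (fscal (- (1)) f)) with fzero in K
        by fun_ring.
      assert (K' := phom (- (1)) f Hf). rewrite Cmod_opp, Cmod_1 in K'. lra.
    + (* rotate f so that phi takes a positive value on it *)
      assert (Pm : (0 < Cmod (phi f))%R) by (apply Cmod_gt_0; exact N).
      set (c := RtoC (Cmod (phi f)) / phi f).
      assert (Hc : Cmod c = 1%R).
      { unfold c. rewrite Cmod_div by exact N. rewrite Cmod_R, Rabs_right by lra. field. lra. }
      assert (E1 : phi (fscal c f) = RtoC (Cmod (phi f))).
      { rewrite phi_scal by exact Hf. unfold c. field. exact N. }
      assert (E2 : Re (phi (fscal c f)) = u (fscal c f)).
      { unfold phi, Re; simpl. ring. }
      rewrite E1 in E2. unfold Re in E2; simpl in E2. rewrite E2.
      eapply Rle_trans; [apply ule; now apply Xs|].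
      eapply Rle_trans; [now apply phom|]. rewrite Hc. lra.
  - intros E1. assert (E2 : Re (phi G) = u G) by (unfold phi, Re; simpl; ring).
    rewrite E1 in E2. unfold Re in E2; simpl in E2. lra.
Qed.

End HahnBanach.

(** * Functionals on weighted spaces *)

(** What is used of the support function H of a bounded set K that contains 0. *)
Record support_weight (K : C -> Prop) (R0 : R) (H : C -> R) : Prop := {
  sw_zero : K 0;
  sw_bound : forall s, K s -> (Cmod s <= R0)%R;
  sw_upper : forall s z, K s -> (Re (s * z) <= H z)%R;
  sw_approx : forall z eta, (0 < eta)%R -> exists s, K s /\ (H z - eta < Re (s * z))%R }.

Definition dominated (H : C -> R) (e M : R) (F : C -> C) : Prop :=
  forall t, (Cmod (F t) <= M * exp (H t + e * Cmod t))%R.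

Lemma exp_le (x y : R) : (x <= y)%R -> (exp x <= exp y)%R.
Proof. intros [L| ->]; [left; now apply exp_increasing|right; reflexivity]. Qed.

Lemma pow_le_exp (i : nat) (eta : R) : (0 < eta)%R ->
  exists B, (0 < B)%R /\ forall x, (0 <= x)%R -> (x ^ i <= B * exp (eta * x))%R.
Proof.
  revert eta. induction i as [|i IH]; intros eta Heta.
  - exists 1%R. split; [lra|]. intros x Hx. simpl. rewrite Rmult_1_l.
    rewrite <- exp_0 at 1. apply exp_le. nra.
  - destruct (IH (eta / 2)%R ltac:(lra)) as [B [HB K]].
    exists (B * (2 / eta))%R. split; [apply Rmult_lt_0_compat; [exact HB|apply Rdiv_lt_0_compat; lra]|].
    intros x Hx.
    assert (L : (x <= 2 / eta * exp (eta / 2 * x))%R).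
    { assert (Q := exp_ineq1_le (eta / 2 * x)).
      apply Rmult_le_reg_l with (eta / 2)%R; [lra|].
      replace (eta / 2 * (2 / eta * exp (eta / 2 * x)))%R with (exp (eta / 2 * x)) by (field; lra). lra. }
    simpl. rewrite Rmult_comm.
    replace (eta * x)%R with (eta / 2 * x + eta / 2 * x)%R by field. rewrite exp_plus.
    replace (B * (2 / eta) * (exp (eta / 2 * x) * exp (eta / 2 * x)))%R with
      ((B * exp (eta / 2 * x)) * (2 / eta * exp (eta / 2 * x)))%R by ring.
    apply Rmult_le_compat; [now apply pow_le|exact Hx|now apply K|exact L].
Qed.

(** Taylor's estimate on the circle of radius 2 |w| + 1, and exp 1 <= 3. *)
Lemma exp_remainder : exists a : nat -> C, forall (m : nat) (w : C),
  (Cmod (Cexp w - csum (fun k => a k * w ^ k)%C m) <= 6 * exp (2 * Cmod w) * (/ 2) ^ m)%R.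
Proof.
  destruct (entire_taylor Cexp entire_Cexp) as [a Ha]. exists a. intros m w.
  assert (P := Cmod_ge_0 w).
  set (r := (2 * Cmod w + 1)%R).
  destruct (Ha r (exp r) ltac:(unfold r; lra)) as [_ K].
  { intros y _. rewrite Cmod_Cexp. apply exp_le.
    eapply Rle_trans; [apply Rle_abs|]. eapply Rle_trans; [apply re_le_Cmod|].
    rewrite Cmod_circle; unfold r; lra. }
  eapply Rle_trans; [apply K; unfold r; lra|].
  apply Rmult_le_compat.
  - generalize (exp_pos r). lra.
  - apply pow_le, Rmult_le_pos; [exact P|]. left. apply Rinv_0_lt_compat. unfold r. lra.
  - unfold r. rewrite exp_plus. generalize exp_le_3 (exp_pos (2 * Cmod w)). intros. nra.
  - apply pow_incr. split.
    + apply Rmult_le_pos; [exact P|]. left. apply Rinv_0_lt_compat. unfold r. lra.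
    + apply Rmult_le_reg_r with r; [unfold r; lra|].
      unfold Rdiv. rewrite Rmult_assoc, Rinv_l by (unfold r; lra). unfold r. lra.
Qed.

Section Weight.

Context {K : C -> Prop} {R0 : R} {H : C -> R} (HW : support_weight K R0 H).

Lemma sw_R0 : (0 <= R0)%R.
Proof. eapply Rle_trans; [apply Cmod_ge_0|]. apply (sw_bound _ _ _ HW _ (sw_zero _ _ _ HW)). Qed.

Lemma sw_pos (z : C) : (0 <= H z)%R.
Proof.
  assert (Q := sw_upper _ _ _ HW 0 z (sw_zero _ _ _ HW)).
  replace (0 * z) with (RtoC 0) in Q by ring. exact Q.
Qed.

Lemma Re_le_Cmod (z : C) : (Re z <= Cmod z)%R.
Proof. eapply Rle_trans; [apply Rle_abs|apply re_le_Cmod]. Qed.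

(** A supremum of real-linear forms of norm at most R0. *)
Lemma sw_lipschitz (a b : C) : (H a <= H b + R0 * Cmod (a - b))%R.
Proof.
  apply le_epsilon. intros e He.
  destruct (sw_approx _ _ _ HW a e He) as [s [Ks Hs]].
  assert (Q := sw_upper _ _ _ HW s b Ks).
  assert (Q2 := Re_le_Cmod (s * (a - b))). rewrite Cmod_mult in Q2.
  assert (Q3 := sw_bound _ _ _ HW s Ks).
  assert (E : (Re (s * a) = Re (s * b) + Re (s * (a - b)))%R) by (unfold Re; simpl; ring).
  generalize (Cmod_ge_0 (a - b)). intros. nra.
Qed.

Lemma sw_le_Cmod (a : C) : (H a <= R0 * Cmod a)%R.
Proof.
  assert (Q := sw_lipschitz a 0). replace (a - 0) with a in Q by ring.
  assert (Q0 : (H 0 <= 0)%R); [|lra].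
  apply le_epsilon. intros e He. destruct (sw_approx _ _ _ HW 0 e He) as [s [_ Hs]].
  replace (s * 0) with (RtoC 0) in Hs by ring. unfold Re in Hs; simpl in Hs. lra.
Qed.

Lemma weight_ge_1 (e : R) (t : C) : (0 <= e)%R -> (1 <= exp (H t + e * Cmod t))%R.
Proof.
  intros He. rewrite <- exp_0 at 1. apply exp_le. generalize (sw_pos t) (Cmod_ge_0 t). nra.
Qed.

Lemma dominated_pos (e M : R) (F : C -> C) : dominated H e M F -> (0 <= M)%R.
Proof.
  intros HF. assert (Q := HF 0). generalize (Cmod_ge_0 (F 0)) (exp_pos (H 0 + e * Cmod 0)).
  intros. nra.
Qed.

Lemma dominated_weaken (e e' M M' : R) (F : C -> C) :
  (e <= e')%R -> (M <= M')%R -> dominated H e M F -> dominated H e' M' F.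
Proof.
  intros He HM HF t. assert (HM0 := dominated_pos _ _ _ HF).
  eapply Rle_trans; [apply HF|]. apply Rmult_le_compat; [exact HM0|left; apply exp_pos|exact HM|].
  apply exp_le. generalize (Cmod_ge_0 t). nra.
Qed.

Lemma dominated_plus (e M N : R) (F G : C -> C) :
  dominated H e M F -> dominated H e N G -> dominated H e (M + N) (fun t => F t + G t).
Proof.
  intros HF HG t. eapply Rle_trans; [apply Cmod_triangle|].
  rewrite Rmult_plus_distr_r. apply Rplus_le_compat; auto.
Qed.

Lemma dominated_scal (e M : R) (c : C) (F : C -> C) :
  dominated H e M F -> dominated H e (Cmod c * M) (fun t => c * F t).
Proof.
  intros HF t. rewrite Cmod_mult, Rmult_assoc. apply Rmult_le_compat_l; [apply Cmod_ge_0|apply HF].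
Qed.

Lemma dominated_pow_mult (i : nat) (eta : R) : (0 < eta)%R -> exists B, (0 < B)%R /\
  forall e M F, dominated H e M F -> dominated H (e + eta) (B * M) (fun t => t ^ i * F t).
Proof.
  intros Heta. destruct (pow_le_exp i eta Heta) as [B [HB Q]].
  exists B. split; [exact HB|]. intros e M F HF t.
  rewrite Cmod_mult, Cmod_pow.
  replace (H t + (e + eta) * Cmod t)%R with (eta * Cmod t + (H t + e * Cmod t))%R by ring.
  rewrite exp_plus.
  replace (B * M * (exp (eta * Cmod t) * exp (H t + e * Cmod t)))%R with
    ((B * exp (eta * Cmod t)) * (M * exp (H t + e * Cmod t)))%R by ring.
  apply Rmult_le_compat; [apply pow_le, Cmod_ge_0|apply Cmod_ge_0|apply Q, Cmod_ge_0|apply HF].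
Qed.

(** The growth of the weight over a distance 3, the largest one between a point of the
    disc of radius 1 and a point of the circle of radius 2 with the same centre. *)
Definition near_factor (e : R) : R := exp (3 * (R0 + e)).

Lemma near_factor_pos (e : R) : (0 < near_factor e)%R.
Proof. apply exp_pos. Qed.

Lemma dominated_divdiff_near (e M : R) (F : C -> C) (z t : C) :
  (0 <= e)%R -> entire F -> dominated H e M F -> (Cmod (t - z) < 1)%R ->
  (Cmod (divdiff z F t) <= M * near_factor e * exp (H t + e * Cmod t))%R.
Proof.
  intros He HF HM Ht. apply (divdiff_bound_near z F); [exact HF| |exact Ht].
  intros s Hs. eapply Rle_trans; [apply HM|].
  rewrite Rmult_assoc. apply Rmult_le_compat_l; [exact (dominated_pos _ _ _ HM)|].
  unfold near_factor. rewrite <- exp_plus. apply exp_le.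
  assert (D : (Cmod (s - t) <= 3)%R).
  { replace (s - t) with ((s - z) - (t - z)) by ring.
    generalize (Cmod_minus_le (s - z) (t - z)). lra. }
  assert (Q1 := sw_lipschitz s t). assert (Q2 := Cmod_triangle_inv s t). assert (Q3 := sw_R0).
  nra.
Qed.

(** 1 / (t - z) with its pole cut out. It jumps at |t - z| = 1, which is harmless
    because the functionals below act on all dominated functions. *)
Definition trunc_kernel (z t : C) : C :=
  if Rlt_dec (Cmod (t - z)) 1 then 0 else / (t - z).
Definition divdiff_near (z : C) (F : C -> C) (t : C) : C :=
  if Rlt_dec (Cmod (t - z)) 1 then divdiff z F t else 0.

Lemma trunc_kernel_bound (z t : C) : (Cmod (trunc_kernel z t) <= 1)%R.
Proof.
  unfold trunc_kernel. destruct (Rlt_dec (Cmod (t - z)) 1) as [L|L].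
  - rewrite Cmod_0. lra.
  - rewrite Cmod_inv.
    + rewrite <- Rinv_1. apply Rinv_le_contravar; lra.
    + apply Cmod_gt_0. lra.
Qed.

Lemma divdiff_decompose (z : C) (F : C -> C) (t : C) :
  divdiff z F t = F t * trunc_kernel z t + (- F z) * trunc_kernel z t + divdiff_near z F t.
Proof.
  unfold trunc_kernel, divdiff_near. destruct (Rlt_dec (Cmod (t - z)) 1) as [L|L]; [ring|].
  unfold divdiff. destruct (Ceq_dec t z) as [->|N].
  - exfalso. apply L. replace (z - z) with (RtoC 0) by ring. rewrite Cmod_0. lra.
  - field. now apply Cneq_minus.
Qed.

Lemma dominated_trunc_kernel (e : R) (z : C) : (0 <= e)%R -> dominated H e 1 (trunc_kernel z).
Proof.
  intros He t. rewrite Rmult_1_l.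
  eapply Rle_trans; [apply trunc_kernel_bound|now apply weight_ge_1].
Qed.

Lemma dominated_mult_trunc_kernel (e M : R) (F : C -> C) (z : C) :
  dominated H e M F -> dominated H e M (fun t => F t * trunc_kernel z t).
Proof.
  intros HF t. rewrite Cmod_mult. eapply Rle_trans; [|apply HF].
  rewrite <- (Rmult_1_r (Cmod (F t))) at 2.
  apply Rmult_le_compat_l; [apply Cmod_ge_0|apply trunc_kernel_bound].
Qed.

Lemma dominated_divdiff_near_part (e M : R) (F : C -> C) (z : C) :
  (0 <= e)%R -> entire F -> dominated H e M F -> dominated H e (M * near_factor e) (divdiff_near z F).
Proof.
  intros He HF HM t. unfold divdiff_near. destruct (Rlt_dec (Cmod (t - z)) 1) as [L|L].
  - now apply dominated_divdiff_near.
  - rewrite Cmod_0. assert (Q := dominated_pos _ _ _ HM).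
    repeat apply Rmult_le_pos; [exact Q|left; apply exp_pos|left; apply exp_pos].
Qed.

Lemma dominated_divdiff (e M : R) (F : C -> C) (z : C) :
  (0 <= e)%R -> entire F -> dominated H e M F ->
  dominated H e (M * (1 + near_factor e) + Cmod (F z)) (divdiff z F).
Proof.
  intros He HF HM t. rewrite divdiff_decompose.
  assert (Q := dominated_plus _ _ _ _ _ (dominated_plus _ _ _ _ _ (dominated_mult_trunc_kernel _ _ _ z HM)
    (dominated_scal _ _ (- F z) _ (dominated_trunc_kernel e z He))) (dominated_divdiff_near_part _ _ _ z He HF HM) t).
  cbv beta in Q. rewrite Cmod_opp in Q.
  eapply Rle_trans; [exact Q|]. right. ring.
Qed.

Lemma dominated_at (e M : R) (F : C -> C) (z : C) :
  (0 <= e)%R -> dominated H e M F -> (Cmod (F z) <= M * exp ((R0 + e) * Cmod z))%R.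
Proof.
  intros He HM. eapply Rle_trans; [apply HM|].
  apply Rmult_le_compat_l; [exact (dominated_pos _ _ _ HM)|]. apply exp_le.
  generalize (sw_le_Cmod z). lra.
Qed.

Section Functional.

Context {delta A : R} {phi : (C -> C) -> C} (Hdelta : (0 < delta)%R).

Definition in_space (F : C -> C) : Prop := exists M, dominated H delta M F.

(** The domain is not restricted to entire functions, so that phi applies to truncated
    kernels. *)
Record bounded_functional : Prop := {
  bf_plus : forall F G, in_space F -> in_space G -> phi (fun t => F t + G t) = phi F + phi G;
  bf_scal : forall c F, in_space F -> phi (fun t => c * F t) = c * phi F;
  bf_bound : forall M F, dominated H delta M F -> (Cmod (phi F) <= A * M)%R }.

Context (Hphi : bounded_functional).

Lemma in_space_plus (F G : C -> C) : in_space F -> in_space G -> in_space (fun t => F t + G t).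
Proof. intros [M HM] [N HN]. eexists. now apply dominated_plus; [apply HM|apply HN]. Qed.

Lemma in_space_scal (c : C) (F : C -> C) : in_space F -> in_space (fun t => c * F t).
Proof. intros [M HM]. eexists. apply dominated_scal, HM. Qed.

Lemma in_space_divdiff (z : C) (F : C -> C) : entire F -> in_space F -> in_space (divdiff z F).
Proof. intros HF [M HM]. eexists. apply dominated_divdiff; [lra|exact HF|exact HM]. Qed.

Lemma bf_zero : phi (fun _ => 0) = 0.
Proof.
  assert (Q : dominated H delta 0 (fun _ => RtoC 0)) by (intros t; rewrite Cmod_0; lra).
  apply Cmod_eq_0. apply Rle_antisym; [|apply Cmod_ge_0].
  eapply Rle_trans; [apply (bf_bound Hphi _ _ Q)|]. lra.
Qed.

Lemma bf_A_pos : (0 <= A)%R.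
Proof.
  assert (Q : dominated H delta 1 (trunc_kernel 0)) by (apply dominated_trunc_kernel; lra).
  apply (bf_bound Hphi) in Q. generalize (Cmod_ge_0 (phi (trunc_kernel 0))). lra.
Qed.

Lemma bf_minus (F G : C -> C) : in_space F -> in_space G ->
  phi (fun t => F t - G t) = phi F - phi G.
Proof.
  intros HF HG. replace (fun t => F t - G t) with (fun t => F t + (- (1)) * G t)
    by fun_ring.
  rewrite (bf_plus Hphi), (bf_scal Hphi); [ring|exact HG|exact HF|now apply in_space_scal].
Qed.

Definition cauchy_transform (z : C) : C := phi (trunc_kernel z).

(** If phi were integration against a measure, phi (divdiff z F) would be the integral of
    F t / (t - z) minus F z times the Cauchy transform. The first integral is bounded in z
    after truncation, and so is the error made by truncating. *)
Lemma divdiff_cauchy_transform (M : R) (F : C -> C) (z : C) :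
  entire F -> dominated H delta M F ->
  (Cmod (phi (divdiff z F) + F z * cauchy_transform z) <= A * (M * (1 + near_factor delta)))%R.
Proof.
  intros HF HM. assert (D0 : (0 <= delta)%R) by lra.
  assert (C1 := dominated_mult_trunc_kernel _ _ _ z HM).
  assert (C2 := dominated_trunc_kernel delta z D0).
  assert (C3 := dominated_divdiff_near_part _ _ _ z D0 HF HM).
  assert (E : phi (divdiff z F) = phi (fun t => F t * trunc_kernel z t) + (- F z) * phi (trunc_kernel z)
     + phi (divdiff_near z F)).
  { rewrite <- (bf_scal Hphi) by now exists 1%R.
    rewrite <- !(bf_plus Hphi).
    - f_equal. apply functional_extensionality; intros t. apply divdiff_decompose.
    - apply in_space_plus; [now exists M|apply in_space_scal; now exists 1%R].
    - now exists (M * near_factor delta)%R.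
    - now exists M.
    - apply in_space_scal. now exists 1%R. }
  rewrite E. unfold cauchy_transform.
  replace (phi (fun t => F t * trunc_kernel z t) + (- F z) * phi (trunc_kernel z)
     + phi (divdiff_near z F) + F z * phi (trunc_kernel z)) with
     (phi (fun t => F t * trunc_kernel z t) + phi (divdiff_near z F)) by ring.
  eapply Rle_trans; [apply Cmod_triangle|].
  generalize (bf_bound Hphi _ _ C1) (bf_bound Hphi _ _ C3). lra.
Qed.

Lemma phi_divdiff_bound (M : R) (F : C -> C) (z : C) :
  entire F -> dominated H delta M F ->
  (Cmod (phi (divdiff z F)) <= A * (M * (1 + near_factor delta) + Cmod (F z)))%R.
Proof. intros HF HM. apply (bf_bound Hphi). apply dominated_divdiff; [lra|exact HF|exact HM]. Qed.

Lemma phi_divdiff_mult_id (F : C -> C) (z : C) :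
  entire F -> in_space F -> phi (divdiff z (fun t => t * F t)) = phi F + z * phi (divdiff z F).
Proof.
  intros HF HM. rewrite divdiff_mult_id by exact HF.
  assert (Q := in_space_divdiff z F HF HM).
  rewrite (bf_plus Hphi), (bf_scal Hphi); auto. now apply in_space_scal.
Qed.

Lemma phi_divdiff_resolvent (F : C -> C) (z w : C) :
  entire F -> in_space F ->
  phi (divdiff w F) - phi (divdiff z F) = (w - z) * phi (divdiff w (divdiff z F)).
Proof.
  intros HF HM. assert (Q1 := in_space_divdiff z F HF HM). assert (Q2 := in_space_divdiff w F HF HM).
  assert (Q3 := in_space_divdiff w _ (entire_divdiff z F HF) Q1).
  rewrite <- (bf_minus (divdiff w F)), <- (bf_scal Hphi) by assumption.
  f_equal. apply functional_extensionality; intros t. symmetry. now apply divdiff_resolvent.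
Qed.

(** The derivative at z is phi (divdiff z (divdiff z F)), by [divdiff_resolvent] used twice. *)
Lemma entire_phi_divdiff (F : C -> C) : entire F -> in_space F -> entire (fun z => phi (divdiff z F)).
Proof.
  intros HF HM. apply entire_cderiv. intros z.
  set (G := divdiff z F). assert (HG : entire G) by now apply entire_divdiff.
  assert (HGM : in_space G) by now apply in_space_divdiff.
  set (G2 := divdiff z G). assert (HG2 : entire G2) by now apply entire_divdiff.
  assert (HG2M : in_space G2) by now apply in_space_divdiff.
  destruct HG2M as [M2 HM2]. assert (M2p := dominated_pos _ _ _ HM2).
  set (B := (A * (M2 * (1 + near_factor delta) + M2 * exp ((R0 + delta) * (Cmod z + 1))))%R).
  assert (HB : (0 <= B)%R).
  { apply Rmult_le_pos; [apply bf_A_pos|]. generalize (near_factor_pos delta) (exp_pos ((R0 + delta) * (Cmod z + 1))).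
    intros. nra. }
  exists (phi G2). intros e He.
  exists (Rmin 1 (e / (B + 1))). split; [apply Rmin_pos; [lra|apply Rdiv_lt_0_compat; lra]|].
  intros w Hw.
  assert (L1 := Rlt_le_trans _ _ _ Hw (Rmin_l _ _)).
  assert (L2 := Rlt_le_trans _ _ _ Hw (Rmin_r _ _)).
  rewrite phi_divdiff_resolvent by assumption. fold G.
  replace ((w - z) * phi (divdiff w G) - phi G2 * (w - z)) with ((w - z) * (phi (divdiff w G) - phi G2)) by ring.
  unfold G2 at 1. rewrite phi_divdiff_resolvent by assumption. fold G2.
  rewrite !Cmod_mult, Rmult_comm. apply Rmult_le_compat_r; [apply Cmod_ge_0|].
  assert (Q : (Cmod (phi (divdiff w G2)) <= B)%R).
  { eapply Rle_trans; [apply (phi_divdiff_bound M2); assumption|].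
    apply Rmult_le_compat_l; [apply bf_A_pos|]. apply Rplus_le_compat_l.
    eapply Rle_trans; [apply (dominated_at delta M2); [lra|exact HM2]|].
    apply Rmult_le_compat_l; [exact M2p|]. apply exp_le. apply Rmult_le_compat_l.
    - generalize sw_R0. lra.
    - replace w with (z + (w - z)) by ring. generalize (Cmod_triangle z (w - z)). lra. }
  assert (Q2 : (Cmod (w - z) * (B + 1) <= e)%R).
  { apply Rle_trans with (e / (B + 1) * (B + 1))%R; [apply Rmult_le_compat_r; lra|].
    right. field. lra. }
  generalize (Cmod_ge_0 (w - z)) (Cmod_ge_0 (phi (divdiff w G2))). intros. nra.
Qed.

(** By the resolvent identity between 0 and z, the function z |-> phi (divdiff z F) is
    z^n times the same function for the n-th shift of F. So it is flat at 0. *)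
Lemma phi_divdiff_vanishes (F : C -> C) :
  entire F -> in_space F ->
  (forall n, phi (divdiff 0 (Nat.iter n (divdiff 0) F)) = 0) -> forall z, phi (divdiff z F) = 0.
Proof.
  intros HF HM Hn. apply entire_flat_zero; [now apply entire_phi_divdiff|].
  assert (IT : forall n, entire (Nat.iter n (divdiff 0) F) /\ in_space (Nat.iter n (divdiff 0) F)).
  { induction n as [|n [I1 I2]]; [now split|]. simpl. split; [now apply entire_divdiff|now apply in_space_divdiff]. }
  intros n. exists (fun z => phi (divdiff z (Nat.iter n (divdiff 0) F))). split.
  - apply entire_ccont, entire_phi_divdiff; apply IT.
  - intros z. induction n as [|n IH]; [simpl; ring|]. rewrite IH. destruct (IT n) as [I1 I2].
    assert (Q := phi_divdiff_resolvent _ 0 z I1 I2). rewrite Hn in Q.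
    replace (phi (divdiff z (Nat.iter n (divdiff 0) F)) - 0) with (phi (divdiff z (Nat.iter n (divdiff 0) F))) in Q by ring.
    rewrite Q. simpl. ring.
Qed.

Lemma in_space_pow (i : nat) : in_space (fun t => t ^ i).
Proof.
  destruct (dominated_pow_mult i delta Hdelta) as [B [_ Q]].
  assert (C1 : dominated H 0 1 (fun _ => 1)).
  { intros t. rewrite Cmod_1, Rmult_1_l. apply weight_ge_1. lra. }
  exists (B * 1)%R. assert (Q1 := Q _ _ _ C1). rewrite Rplus_0_l in Q1.
  intros t. specialize (Q1 t). cbv beta in Q1. now rewrite Cmult_1_r in Q1.
Qed.

(** Let t^N be the first monomial not killed by phi. Then phi (divdiff z t^(N+2)) equals
    c1 + c0 z with c0 <> 0, so by [divdiff_cauchy_transform] the Cauchy transform is at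
    least a constant times |z|^-(N+1) for large z. For F its product with F z is bounded;
    hence F grows at most like |z|^(N+1). *)
Lemma polynomial_case (N : nat) :
  (forall i, (i < N)%nat -> phi (fun t => t ^ i) = 0) -> phi (fun t => t ^ N) <> 0 ->
  forall F, entire F -> in_space F -> (forall z, phi (divdiff z F) = 0) ->
    exists a : nat -> C, forall z, F z = csum (fun k => a k * z ^ k) (S (S N)).
Proof.
  intros Hlow HN.
  assert (W : forall n z, phi (divdiff z (fun t => t ^ S n)) = phi (fun t => t ^ n) + z * phi (divdiff z (fun t => t ^ n))).
  { intros n z. apply (phi_divdiff_mult_id (fun t => t ^ n)); [apply entire_pow|apply in_space_pow]. }
  assert (W0 : forall n z, (n <= N)%nat -> phi (divdiff z (fun t => t ^ n)) = 0).
  { induction n as [|n IH]; intros z Hn.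
    - simpl. rewrite divdiff_const. apply bf_zero.
    - rewrite W, Hlow, IH by lia. ring. }
  set (c0 := phi (fun t => t ^ N)) in *. set (c1 := phi (fun t => t ^ S N)).
  assert (W2 : forall z, phi (divdiff z (fun t => t ^ S (S N))) = c1 + z * c0).
  { intros z. rewrite !W, W0 by lia. fold c0 c1. ring. }
  destruct (in_space_pow (S (S N))) as [Mp HMp].
  set (B := (A * (Mp * (1 + near_factor delta)))%R).
  assert (HB : forall z, (Cmod (c1 + z * c0 + z ^ S (S N) * cauchy_transform z) <= B)%R).
  { intros z. rewrite <- W2. apply (divdiff_cauchy_transform Mp (fun t => t ^ S (S N))); [apply entire_pow|exact HMp]. }
  assert (Pc : (0 < Cmod c0)%R) by (apply Cmod_gt_0; exact HN).
  set (rho := (2 * (B + Cmod c1) / Cmod c0 + 1)%R).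
  assert (B0 : (0 <= B)%R) by (eapply Rle_trans; [apply Cmod_ge_0|apply (HB 0)]).
  assert (Hrho : (1 <= rho)%R).
  { unfold rho. assert (0 <= 2 * (B + Cmod c1) / Cmod c0)%R; [|lra].
    apply Rmult_le_pos; [generalize (Cmod_ge_0 c1); lra|left; now apply Rinv_0_lt_compat]. }
  assert (low : forall z, (rho <= Cmod z)%R -> (Cmod c0 / 2 <= Cmod z ^ S N * Cmod (cauchy_transform z))%R).
  { intros z Hz. assert (Q := HB z).
    assert (Q2 : (Cmod z * Cmod c0 <= B + Cmod c1 + Cmod z ^ S (S N) * Cmod (cauchy_transform z))%R).
    { rewrite <- Cmod_pow, <- !Cmod_mult.
      replace (z * c0) with ((c1 + z * c0 + z ^ S (S N) * cauchy_transform z) - c1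
        - z ^ S (S N) * cauchy_transform z) by ring.
      eapply Rle_trans; [apply Cmod_minus_le|].
      generalize (Cmod_minus_le (c1 + z * c0 + z ^ S (S N) * cauchy_transform z) c1). lra. }
    assert (Q3 : (2 * (B + Cmod c1) <= Cmod z * Cmod c0)%R).
    { apply Rle_trans with (rho * Cmod c0)%R; [|apply Rmult_le_compat_r; lra].
      unfold rho. rewrite Rmult_plus_distr_r.
      replace (2 * (B + Cmod c1) / Cmod c0 * Cmod c0)%R with (2 * (B + Cmod c1))%R by (field; lra). lra. }
    apply Rmult_le_reg_l with (Cmod z); [lra|].
    change (Cmod z ^ S (S N))%R with (Cmod z * Cmod z ^ S N)%R in Q2. nra. }
  intros F HF [M HM] HF0.
  apply (liouville F (S N) rho (A * (M * (1 + near_factor delta)) * (2 / Cmod c0))); [exact HF|].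
  intros z Hz. assert (Q := divdiff_cauchy_transform M F z HF HM). rewrite HF0 in Q.
  rewrite Cplus_0_l, Cmod_mult in Q. specialize (low z Hz).
  assert (Pz : (0 <= Cmod z ^ S N)%R) by apply pow_le, Cmod_ge_0.
  assert (PF := Cmod_ge_0 (F z)).
  apply Rmult_le_reg_r with (Cmod c0 / 2)%R; [lra|].
  replace (A * (M * (1 + near_factor delta)) * (2 / Cmod c0) * Cmod z ^ S N * (Cmod c0 / 2))%R
    with (A * (M * (1 + near_factor delta)) * Cmod z ^ S N)%R by (field; lra).
  apply Rle_trans with (Cmod (F z) * (Cmod z ^ S N * Cmod (cauchy_transform z)))%R.
  - apply Rmult_le_compat_l; assumption.
  - replace (Cmod (F z) * (Cmod z ^ S N * Cmod (cauchy_transform z)))%R with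
      (Cmod (F z) * Cmod (cauchy_transform z) * Cmod z ^ S N)%R by ring.
    apply Rmult_le_compat_r; assumption.
Qed.

(** Half of the margin delta is kept in reserve, for powers of t and for small changes
    of mu. *)
Definition admissible (mu : C) : Prop :=
  forall t, (Re (mu * t) <= H t + delta / 2 * Cmod t)%R.

(** Since phi (divdiff z (t^(i+1) e_mu)) = phi (t^i e_mu) + z phi (divdiff z (t^i e_mu)),
    this amounts to phi (t^i e_mu) = 0 and phi (divdiff z e_mu) = 0 for all i and z;
    in this form one induction covers both. *)
Definition killed (mu : C) : Prop :=
  forall i z, phi (divdiff z (fun t => t ^ i * e_ mu t)) = 0.

Lemma entire_e (mu : C) : entire (e_ mu).
Proof.
  unfold e_. apply (entire_comp Cexp (fun t => mu * t)); [apply entire_Cexp|].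
  apply entire_mult; [apply entire_const|apply entire_id].
Qed.

Lemma dominated_e (mu : C) : admissible mu -> dominated H (delta / 2) 1 (e_ mu).
Proof.
  intros Hmu t. unfold e_. rewrite Cmod_Cexp, Rmult_1_l. apply exp_le, Hmu.
Qed.

(** The expansion of e_a multiplied by e_mu converges in the weighted norm because |a| is
    small compared with delta, and its partial sums combine the functions t^i e_mu. *)
Lemma killed_step (mu a : C) :
  admissible mu -> (Cmod a <= delta / 8)%R -> killed mu -> killed (mu + a).
Proof.
  intros Hmu Ha Hk i z.
  destruct exp_remainder as [cs Hcs].
  destruct (dominated_pow_mult i (delta / 4) ltac:(lra)) as [B [HB QB]].
  set (p := fun m t => csum (fun k => cs k * (a * t) ^ k) m).
  set (P := fun (m : nat) (t : C) => t ^ i * (e_ mu t * p m t)).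
  set (Er := fun (m : nat) (t : C) => t ^ i * (e_ mu t * (Cexp (a * t) - p m t))).
  assert (CE : forall m, dominated H delta (B * (6 * (/ 2) ^ m)) (Er m)).
  { intros m. apply (dominated_weaken (delta / 2 + delta / 4 + delta / 4) _ (B * (6 * (/ 2) ^ m)));
      [lra|apply Rle_refl|]. apply QB. intros t. rewrite Cmod_mult.
    assert (Q1 := dominated_e mu Hmu t). assert (Q2 := Hcs m (a * t)). rewrite Rmult_1_l in Q1.
    replace (H t + (delta / 2 + delta / 4) * Cmod t)%R with
      ((H t + delta / 2 * Cmod t) + delta / 4 * Cmod t)%R by field.
    rewrite exp_plus.
    replace (6 * (/ 2) ^ m * (exp (H t + delta / 2 * Cmod t) * exp (delta / 4 * Cmod t)))%R with
      (exp (H t + delta / 2 * Cmod t) * (6 * exp (delta / 4 * Cmod t) * (/ 2) ^ m))%R by ring.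
    apply Rmult_le_compat; try apply Cmod_ge_0; [exact Q1|].
    eapply Rle_trans; [exact Q2|]. apply Rmult_le_compat_r; [apply pow_le; lra|].
    apply Rmult_le_compat_l; [lra|]. apply exp_le. rewrite Cmod_mult.
    generalize (Cmod_ge_0 t). intros. nra. }
  assert (Smon : forall j, in_space (fun t => t ^ j * e_ mu t)).
  { intros j. destruct (dominated_pow_mult j (delta / 2) ltac:(lra)) as [B' [_ Q]].
    exists (B' * 1)%R. eapply dominated_weaken; [|apply Rle_refl|apply (Q _ _ _ (dominated_e mu Hmu))]. lra. }
  assert (Emon : forall j, entire (fun t => t ^ j * e_ mu t)).
  { intros j. apply entire_mult; [apply entire_pow|apply entire_e]. }
  assert (PP : forall m, entire (P m) /\ in_space (P m) /\ phi (divdiff z (P m)) = 0).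
  { induction m as [|m (I1 & I2 & I3)].
    - replace (P 0%nat) with (fun _ : C => RtoC 0) by (unfold P, p; simpl; fun_ring).
      split; [apply entire_const|]. split; [|rewrite divdiff_const; apply bf_zero].
      exists 0%R. intros t. rewrite Cmod_0. lra.
    - replace (P (S m)) with (fun t => P m t + cs m * a ^ m * (t ^ (i + m) * e_ mu t)).
      2:{ apply functional_extensionality; intros t. unfold P, p. simpl csum.
          rewrite Cpow_mult_l, Cpow_add_r. ring. }
      assert (E2 : entire (fun t => cs m * a ^ m * (t ^ (i + m) * e_ mu t))).
      { apply (entire_mult (fun _ => cs m * a ^ m)); [apply entire_const|apply Emon]. }
      assert (Q2 := in_space_divdiff z _ (Emon (i + m)%nat) (Smon (i + m)%nat)).
      assert (Q1 := in_space_divdiff z _ I1 I2).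
      split; [now apply entire_plus|]. split; [now apply in_space_plus, in_space_scal|].
      rewrite divdiff_plus, divdiff_scal by auto.
      rewrite (bf_plus Hphi), (bf_scal Hphi), I3, Hk; auto; [ring|now apply in_space_scal]. }
  assert (EE : forall m, entire (Er m)).
  { intros m. unfold Er. apply entire_mult; [apply entire_pow|]. apply entire_mult; [apply entire_e|].
    replace (fun t => Cexp (a * t) - p m t) with (fun t => Cexp (a * t) + (- (1)) * p m t) by fun_ring.
    apply entire_plus; [apply entire_e|]. apply (entire_mult (fun _ => - (1))); [apply entire_const|].
    unfold p. induction m as [|m IH]; [apply (entire_const 0)|]. simpl. apply entire_plus; [exact IH|].
    apply (entire_mult (fun _ => cs m)); [apply entire_const|].
    apply (entire_comp (fun w => w ^ m) (fun t => a * t)); [apply entire_pow|].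
    apply (entire_mult (fun _ => a)); [apply entire_const|apply entire_id]. }
  apply (eq_of_geometric _ _ (/ 2) (A * (B * 6 * (1 + near_factor delta + exp ((R0 + delta) * Cmod z)))));
    [lra| |].
  { generalize (near_factor_pos delta) (exp_pos ((R0 + delta) * Cmod z)) bf_A_pos. intros.
    repeat apply Rmult_le_pos; lra. }
  intros n. destruct (PP (S n)) as (I1 & I2 & I3).
  replace (fun t => t ^ i * e_ (mu + a) t) with (fun t => Er (S n) t + P (S n) t).
  2:{ apply functional_extensionality; intros t. unfold Er, P, e_.
      replace ((mu + a) * t) with (mu * t + a * t) by ring. rewrite Cexp_plus. ring. }
  assert (Q1 : in_space (divdiff z (Er (S n)))).
  { apply in_space_divdiff; [apply EE|]. eexists. apply CE. }
  rewrite divdiff_plus, (bf_plus Hphi), I3 by (auto; now apply in_space_divdiff).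
  replace (phi (divdiff z (Er (S n))) + 0 - 0) with (phi (divdiff z (Er (S n)))) by ring.
  eapply Rle_trans; [apply (phi_divdiff_bound _ _ z (EE (S n)) (CE (S n)))|].
  assert (Q := dominated_at delta _ _ z ltac:(lra) (CE (S n))).
  replace ((/ 2) ^ S n * (A * (B * 6 * (1 + near_factor delta + exp ((R0 + delta) * Cmod z)))))%R with
    (A * (B * (6 * (/ 2) ^ S n) * (1 + near_factor delta) +
      B * (6 * (/ 2) ^ S n) * exp ((R0 + delta) * Cmod z)))%R by ring.
  apply Rmult_le_compat_l; [apply bf_A_pos|]. lra.
Qed.

Lemma e_0 : e_ 0 = (fun _ => 1).
Proof.
  apply functional_extensionality; intros t. unfold e_.
  replace (0 * t) with (RtoC 0) by ring. apply Cexp_0.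
Qed.

(** The segment from 0 to mu is covered by steps of length at most delta / 8; it consists
    of admissible points because H >= 0. *)
Lemma killed_admissible (mu : C) :
  (forall i, phi (fun t => t ^ i) = 0) -> admissible mu -> killed mu.
Proof.
  intros Hpow Hmu.
  destruct (nfloor_ex (8 * Cmod mu / delta)) as [n0 [_ Hn]].
  { apply Rmult_le_pos; [generalize (Cmod_ge_0 mu); lra|left; now apply Rinv_0_lt_compat]. }
  set (n := S n0).
  assert (Hn' : (8 * Cmod mu / delta <= INR n)%R) by (unfold n; rewrite S_INR; lra).
  assert (Pn : (0 < INR n)%R) by (apply lt_0_INR; unfold n; lia).
  set (a := RtoC (/ INR n) * mu).
  assert (Ha : (Cmod a <= delta / 8)%R).
  { unfold a. rewrite Cmod_mult, Cmod_R, Rabs_right by (left; now apply Rinv_0_lt_compat).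
    apply Rmult_le_reg_l with (INR n); [exact Pn|]. rewrite <- Rmult_assoc, Rinv_r, Rmult_1_l by lra.
    apply Rmult_le_reg_r with (8 / delta)%R; [apply Rdiv_lt_0_compat; lra|].
    replace (INR n * (delta / 8) * (8 / delta))%R with (INR n) by (field; lra).
    replace (Cmod mu * (8 / delta))%R with (8 * Cmod mu / delta)%R by (field; lra). exact Hn'. }
  assert (adm : forall k, (k <= n)%nat -> admissible (RtoC (INR k) * a)).
  { intros k Hk t. unfold a.
    replace (RtoC (INR k) * (RtoC (/ INR n) * mu) * t) with (RtoC (INR k * / INR n) * (mu * t))
      by (rewrite RtoC_mult; ring).
    replace (Re (RtoC (INR k * / INR n) * (mu * t))) with (INR k * / INR n * Re (mu * t))%R
      by (unfold Re; simpl; ring).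
    assert (L : (0 <= INR k * / INR n <= 1)%R).
    { split; [apply Rmult_le_pos; [apply pos_INR|left; now apply Rinv_0_lt_compat]|].
      apply Rmult_le_reg_r with (INR n); [exact Pn|]. rewrite Rmult_assoc, Rinv_l, Rmult_1_l, Rmult_1_r by lra.
      now apply le_INR. }
    assert (Q := Hmu t). assert (Q2 := sw_pos t). assert (Q3 := Cmod_ge_0 t).
    assert (0 <= H t + delta / 2 * Cmod t)%R by nra. nra. }
  assert (Kk : forall k, (k <= n)%nat -> killed (RtoC (INR k) * a)).
  { induction k as [|k IH]; intros Hk.
    - simpl. replace (0 * a) with (RtoC 0) by ring. intros i z. rewrite e_0.
      replace (fun t => t ^ i * 1) with (fun t : C => t ^ i) by fun_ring.
      induction i as [|i IH]; [simpl; rewrite divdiff_const; apply bf_zero|].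
      rewrite (phi_divdiff_mult_id (fun t => t ^ i)), Hpow, IH by (apply entire_pow || apply in_space_pow). ring.
    - assert (E : RtoC (INR (S k)) * a = RtoC (INR k) * a + a) by (rewrite S_INR, RtoC_plus; ring).
      rewrite E. apply killed_step; auto with arith. }
  replace mu with (RtoC (INR n) * a); [now apply Kk|].
  unfold a. rewrite RtoC_inv by lra. field. intros E. apply RtoC_inj in E. lra.
Qed.

Lemma Re_rotate (z t : C) : z <> 0 ->
  (Re (RtoC (/ Cmod z) * Cconj z * t) <= Cmod t)%R.
Proof.
  intros Hz. assert (P : (0 < Cmod z)%R) by (apply Cmod_gt_0; exact Hz).
  eapply Rle_trans; [apply Re_le_Cmod|]. rewrite !Cmod_mult, Cmod_conj, Cmod_R, Rabs_right.
  - rewrite Rinv_l by lra. lra.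
  - left. now apply Rinv_0_lt_compat.
Qed.

(** Once phi (divdiff z e_mu) = 0, the product of e_mu z and the Cauchy transform is
    bounded, uniformly in mu. Take for mu a point of K where Re (mu z) nearly reaches H z,
    moved by delta / 2 in the direction of the conjugate of z. *)
Lemma cauchy_transform_decay :
  (forall i, phi (fun t => t ^ i) = 0) -> forall z,
  (Cmod (cauchy_transform z) <=
     A * (1 + near_factor delta) * exp (1 - (H z + delta / 2 * Cmod z)))%R.
Proof.
  intros Hpow z.
  assert (Hmu : exists mu, admissible mu /\ (H z + delta / 2 * Cmod z - 1 <= Re (mu * z))%R).
  { destruct (sw_approx _ _ _ HW z 1%R Rlt_0_1) as [s [Ks Hs]].
    destruct (Ceq_dec z 0) as [->|N].
    - exists s. split; [|rewrite Cmod_0; lra]. intros t.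
      generalize (sw_upper _ _ _ HW s t Ks) (Cmod_ge_0 t). intros. nra.
    - assert (P : (0 < Cmod z)%R) by (apply Cmod_gt_0; exact N).
      exists (s + RtoC (delta / 2) * (RtoC (/ Cmod z) * Cconj z)). split.
      + intros t. assert (Q1 := sw_upper _ _ _ HW s t Ks). assert (Q2 := Re_rotate z t N).
        replace (Re ((s + RtoC (delta / 2) * (RtoC (/ Cmod z) * Cconj z)) * t)) with
          (Re (s * t) + delta / 2 * Re (RtoC (/ Cmod z) * Cconj z * t))%R
          by (unfold Re; simpl; ring).
        nra.
      + replace ((s + RtoC (delta / 2) * (RtoC (/ Cmod z) * Cconj z)) * z) with
          (s * z + RtoC (delta / 2) * RtoC (/ Cmod z) * (z * Cconj z)) by ring.
        rewrite <- Cmod2_conj, <- !RtoC_mult.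
        replace (delta / 2 * / Cmod z * Cmod z ^ 2)%R with (delta / 2 * Cmod z)%R by (field; lra).
        replace (Re (s * z + RtoC (delta / 2 * Cmod z))) with (Re (s * z) + delta / 2 * Cmod z)%R
          by (unfold Re; simpl; ring). lra. }
  destruct Hmu as [mu [Hmu Hz]].
  assert (Kd := killed_admissible mu Hpow Hmu 0%nat z).
  replace (fun t => t ^ 0 * e_ mu t) with (e_ mu) in Kd by (simpl; fun_ring).
  assert (CT : dominated H delta 1 (e_ mu)).
  { eapply dominated_weaken; [|apply Rle_refl|apply (dominated_e mu Hmu)]. lra. }
  assert (Q := divdiff_cauchy_transform 1 (e_ mu) z (entire_e mu) CT).
  rewrite Kd, Cplus_0_l, Cmod_mult, Rmult_1_l in Q.
  unfold e_ in Q. rewrite Cmod_Cexp in Q.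
  set (w := (H z + delta / 2 * Cmod z)%R) in *.
  assert (L : (exp (w - 1) * Cmod (cauchy_transform z) <= A * (1 + near_factor delta))%R).
  { eapply Rle_trans; [|exact Q]. apply Rmult_le_compat_r; [apply Cmod_ge_0|]. apply exp_le. lra. }
  apply Rmult_le_reg_l with (exp (w - 1)); [apply exp_pos|].
  eapply Rle_trans; [exact L|]. right.
  replace (exp (w - 1) * (A * (1 + near_factor delta) * exp (1 - w)))%R with
    (A * (1 + near_factor delta) * (exp (w - 1) * exp (1 - w)))%R by ring.
  rewrite <- exp_plus. replace (w - 1 + (1 - w))%R with 0%R by ring. rewrite exp_0. ring.
Qed.

(** The product of F z and the Cauchy transform is bounded, by [cauchy_transform_decay];
    so is phi (divdiff z F), and Liouville's theorem applies. *)
Lemma phi_divdiff_constant (F : C -> C) (M : R) :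
  (forall i, phi (fun t => t ^ i) = 0) -> entire F -> dominated H (delta / 2) M F ->
  forall z, phi (divdiff z F) = phi (divdiff 0 F).
Proof.
  intros Hpow HF HM.
  assert (HM' : dominated H delta M F) by (eapply dominated_weaken; [|apply Rle_refl|exact HM]; lra).
  assert (HM0 := dominated_pos _ _ _ HM).
  assert (PA := bf_A_pos). assert (PN := near_factor_pos delta).
  set (B := (A * (M * (1 + near_factor delta)) + M * (A * (1 + near_factor delta) * exp 1))%R).
  destruct (liouville (fun z => phi (divdiff z F)) 0 0 B) as [a Ha].
  - apply entire_phi_divdiff; [exact HF|now exists M].
  - intros z _. rewrite pow_O, Rmult_1_r.
    replace (phi (divdiff z F)) with ((phi (divdiff z F) + F z * cauchy_transform z) - F z * cauchy_transform z) by ring.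
    eapply Rle_trans; [apply Cmod_minus_le|]. unfold B. apply Rplus_le_compat.
    + now apply divdiff_cauchy_transform.
    + rewrite Cmod_mult.
      apply Rle_trans with ((M * exp (H z + delta / 2 * Cmod z)) *
        (A * (1 + near_factor delta) * exp (1 - (H z + delta / 2 * Cmod z))))%R.
      * apply Rmult_le_compat; try apply Cmod_ge_0; [apply HM|now apply cauchy_transform_decay].
      * right. set (w := (H z + delta / 2 * Cmod z)%R).
        replace (M * exp w * (A * (1 + near_factor delta) * exp (1 - w)))%R with
          (M * (A * (1 + near_factor delta) * (exp w * exp (1 - w))))%R by ring.
        rewrite <- exp_plus. replace (w + (1 - w))%R with 1%R by ring. reflexivity.
  - intros z. rewrite (Ha z), (Ha 0). simpl. ring.
Qed.

(** In phi (divdiff z (t G)) = phi G + z phi (divdiff z G) both applications of phi to a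
    divided difference are constant in z, so phi (divdiff z G) = 0. The same for t G in
    place of G leaves phi G = 0. *)
Lemma vanishing_case (G : C -> C) (M : R) :
  (forall i, phi (fun t => t ^ i) = 0) -> entire G -> dominated H (delta / 8) M G -> phi G = 0.
Proof.
  intros Hpow HG HM.
  destruct (dominated_pow_mult 1 (delta / 8) ltac:(lra)) as [B [_ Q]].
  set (G1 := fun t => t * G t). set (G2 := fun t => t * G1 t).
  assert (E1 : entire G1) by (apply (entire_mult (fun t => t)); [apply entire_id|exact HG]).
  assert (E2 : entire G2) by (apply (entire_mult (fun t => t)); [apply entire_id|exact E1]).
  assert (X1 : dominated H (delta / 8 + delta / 8) (B * M) G1).
  { intros t. generalize (Q _ _ _ HM t). unfold G1. simpl. now rewrite Cmult_1_r. }
  assert (X2 : dominated H (delta / 8 + delta / 8 + delta / 8) (B * (B * M)) G2).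
  { intros t. generalize (Q _ _ _ X1 t). unfold G2. simpl. now rewrite Cmult_1_r. }
  assert (C0 : forall z, phi (divdiff z G) = phi (divdiff 0 G)).
  { apply (phi_divdiff_constant G M Hpow HG). eapply dominated_weaken; [|apply Rle_refl|exact HM]. lra. }
  assert (C1 : forall z, phi (divdiff z G1) = phi (divdiff 0 G1)).
  { apply (phi_divdiff_constant G1 (B * M) Hpow E1). eapply dominated_weaken; [|apply Rle_refl|exact X1]. lra. }
  assert (C2 : forall z, phi (divdiff z G2) = phi (divdiff 0 G2)).
  { apply (phi_divdiff_constant G2 (B * (B * M)) Hpow E2). eapply dominated_weaken; [|apply Rle_refl|exact X2]. lra. }
  assert (S0 : in_space G).
  { exists M. eapply dominated_weaken; [|apply Rle_refl|exact HM]. lra. }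
  assert (S1 : in_space G1).
  { eexists. eapply dominated_weaken; [|apply Rle_refl|exact X1]. lra. }
  assert (R1 : forall z, phi (divdiff z G1) = phi G + z * phi (divdiff z G))
    by (intros z; now apply phi_divdiff_mult_id).
  assert (R2 : forall z, phi (divdiff z G2) = phi G1 + z * phi (divdiff z G1))
    by (intros z; now apply phi_divdiff_mult_id).
  assert (Z1 : phi (divdiff 1 G1) = 0).
  { assert (U := R2 1). assert (V := R2 0). rewrite C2, V in U.
    rewrite Cmult_0_l, Cmult_1_l in U.
    replace (phi (divdiff 1 G1)) with (phi G1 + phi (divdiff 1 G1) - phi G1) by ring. rewrite <- U. ring. }
  assert (U := R1 0). rewrite <- (C1 1), Z1, Cmult_0_l in U.
  replace (phi G) with (phi G + 0) by ring. now symmetry.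
Qed.

End Functional.
End Weight.

Lemma inf_exists (E : R -> Prop) :
  (exists x, E x) -> (forall x, E x -> (0 <= x)%R) ->
  exists m, (forall x, E x -> (m <= x)%R) /\ (forall e, (0 < e)%R -> exists x, E x /\ (x < m + e)%R).
Proof.
  intros [x0 Hx0] Hpos.
  destruct (completeness (fun r => E (- r)%R)) as [m [Hm1 Hm2]].
  - exists 0%R. intros r Hr. apply Hpos in Hr. lra.
  - exists (- x0)%R. now rewrite Ropp_involutive.
  - exists (- m)%R. split.
    + intros x Hx. assert (Q : (- x <= m)%R) by (apply Hm1; now rewrite Ropp_involutive). lra.
    + intros e He. apply NNPP. intros N. apply (Rlt_irrefl m).
      apply Rle_lt_trans with (m - e)%R; [|lra]. apply Hm2. intros r Hr.
      apply Rnot_lt_le. intros Hlt. apply N. exists (- r)%R. split; [exact Hr|lra].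
Qed.

(** The distance to P is a seminorm for which G has norm at least eps0. A functional phi
    bounded by it vanishes on P and not at G, so [vanishing_case] provides a monomial that
    phi does not kill, and [polynomial_case] applies to every F in P; the degree bound
    depends on phi alone. *)
Theorem separated_subspace_polynomial (K : C -> Prop) (R0 : R) (H : C -> R) (delta eps0 : R)
    (P : (C -> C) -> Prop) (G : C -> C) :
  support_weight K R0 H -> (0 < delta)%R -> (0 < eps0)%R ->
  linear_subspace P ->
  (forall F, P F -> entire F /\ exists M, dominated H delta M F) ->
  (forall F, P F -> P (divdiff 0 F)) ->
  entire G -> (exists M, dominated H (delta / 8) M G) ->
  (forall F, P F -> ~ dominated H delta eps0 (fun t => G t - F t)) ->
  exists n, forall F, P F -> exists a : nat -> C, forall z, F z = csum (fun k => a k * z ^ k) n.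
Proof.
  intros HW Hdelta Heps [P0 [Pp Ps]] HP HD HG [MG HMG] Hsep.
  set (X := fun F : C -> C => exists M, dominated H delta M F).
  set (D := fun (F : C -> C) (M : R) => exists F0, P F0 /\ dominated H delta M (fun t => F t - F0 t)).
  assert (Dpos : forall F M, D F M -> (0 <= M)%R).
  { intros F M [F0 [_ Q]]. exact (dominated_pos _ _ _ Q). }
  assert (Dself : forall F M, dominated H delta M F -> D F M).
  { intros F M HM. exists (fun _ => 0). split; [exact P0|]. intros t.
    replace (F t - 0) with (F t) by ring. apply HM. }
  assert (Hm : forall F, exists m, X F -> (forall x, D F x -> (m <= x)%R) /\
     (forall e, (0 < e)%R -> exists x, D F x /\ (x < m + e)%R)).
  { intros F. destruct (classic (X F)) as [HX|HX].
    - destruct (inf_exists (D F)) as [m Hm]; [|apply Dpos|now exists m].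
      destruct HX as [M HM]. exists M. now apply Dself.
    - exists 0%R. intros HX'. contradiction. }
  set (d := fun F => proj1_sig (constructive_indefinite_description _ (Hm F))).
  assert (Hd : forall F, X F -> (forall x, D F x -> (d F <= x)%R) /\
     (forall e, (0 < e)%R -> exists x, D F x /\ (x < d F + e)%R)).
  { intros F. exact (proj2_sig (constructive_indefinite_description _ (Hm F))). }
  clearbody d. clear Hm.
  assert (Xp : forall F F', X F -> X F' -> X (fplus F F')).
  { intros F F' [M HM] [M' HM']. exists (M + M')%R. now apply dominated_plus. }
  assert (Xs : forall c F, X F -> X (fscal c F)).
  { intros c F [M HM]. exists (Cmod c * M)%R. now apply dominated_scal. }
  assert (XG : X G).
  { exists MG. eapply dominated_weaken; [|apply Rle_refl|exact HMG]. lra. }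
  destruct (hahn_banach X (fun F => d F / eps0)%R G) as (phi & phi_plus & phi_scal & phi_le & phi_G).
  - split; [exact Xp|exact Xs| |].
    + intros F F' HF HF'. apply Rmult_le_reg_r with eps0; [exact Heps|].
      replace ((d F / eps0 + d F' / eps0) * eps0)%R with (d F + d F')%R by (field; lra).
      replace (d (fplus F F') / eps0 * eps0)%R with (d (fplus F F')) by (field; lra).
      apply le_epsilon. intros e He.
      destruct (proj2 (Hd F HF) (e / 2)%R ltac:(lra)) as [x [[F0 [HF0 C0]] Hx]].
      destruct (proj2 (Hd F' HF') (e / 2)%R ltac:(lra)) as [x' [[F0' [HF0' C0']] Hx']].
      apply Rle_trans with (x + x')%R; [|lra]. apply (Hd _ (Xp _ _ HF HF')).
      exists (fun t => F0 t + F0' t). split; [now apply Pp|]. intros t.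
      replace (fplus F F' t - (F0 t + F0' t)) with ((F t - F0 t) + (F' t - F0' t))
        by (unfold fplus; ring). apply (dominated_plus _ _ _ _ _ C0 C0').
    + intros c F HF. apply Rmult_le_reg_r with eps0; [exact Heps|].
      replace (Cmod c * (d F / eps0) * eps0)%R with (Cmod c * d F)%R by (field; lra).
      replace (d (fscal c F) / eps0 * eps0)%R with (d (fscal c F)) by (field; lra).
      apply le_epsilon. intros e He. assert (Pc := Cmod_ge_0 c).
      destruct (proj2 (Hd F HF) (e / (Cmod c + 1))%R) as [x [[F0 [HF0 C0]] Hx]].
      { apply Rdiv_lt_0_compat; lra. }
      apply Rle_trans with (Cmod c * x)%R.
      * apply (Hd _ (Xs c _ HF)). exists (fun t => c * F0 t). split; [now apply Ps|]. intros t.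
        replace (fscal c F t - c * F0 t) with (c * (F t - F0 t)) by (unfold fscal; ring).
        apply (dominated_scal _ _ c _ C0).
      * assert (Q : (Cmod c * (e / (Cmod c + 1)) <= e)%R).
        { apply Rmult_le_reg_r with (Cmod c + 1)%R; [lra|].
          replace (Cmod c * (e / (Cmod c + 1)) * (Cmod c + 1))%R with (Cmod c * e)%R by (field; lra). nra. }
        nra.
  - exact XG.
  - apply Rmult_le_reg_r with eps0; [exact Heps|]. rewrite Rmult_1_l.
    replace (d G / eps0 * eps0)%R with (d G) by (field; lra).
    apply Rnot_lt_le. intros Hlt.
    destruct (proj2 (Hd G XG) (eps0 - d G)%R ltac:(lra)) as [x [[F0 [HF0 C0]] Hx]].
    apply (Hsep F0 HF0). eapply dominated_weaken; [apply Rle_refl| |exact C0]. lra.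
  - assert (Hphi : bounded_functional (H := H) (delta := delta) (A := / eps0) (phi := phi)).
    { split; [exact phi_plus|exact phi_scal|]. intros M F HM.
      assert (HX : X F) by now exists M.
      eapply Rle_trans; [now apply phi_le|]. rewrite Rmult_comm. apply Rmult_le_compat_r.
      - left. now apply Rinv_0_lt_compat.
      - apply (Hd F HX). now apply Dself. }
    assert (phi_P : forall F, P F -> phi F = 0).
    { intros F HF. destruct (HP F HF) as [_ HX]. apply Cmod_eq_0.
      apply Rle_antisym; [|apply Cmod_ge_0]. eapply Rle_trans; [now apply phi_le|].
      apply Rmult_le_reg_r with eps0; [exact Heps|]. rewrite Rmult_0_l.
      replace (d F / eps0 * eps0)%R with (d F) by (field; lra).
      apply (Hd F HX). exists F. split; [exact HF|]. intros t.
      replace (F t - F t) with (RtoC 0) by ring. rewrite Cmod_0. lra. }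
    destruct (classic (forall i, phi (fun t => t ^ i) = 0)) as [Hall|Hex].
    + exfalso. apply phi_G. exact (vanishing_case HW Hdelta Hphi G MG Hall HG HMG).
    + assert (HN : exists N, (forall i, (i < N)%nat -> phi (fun t => t ^ i) = 0) /\ phi (fun t => t ^ N) <> 0).
      { apply not_all_ex_not in Hex. destruct Hex as [i Hi].
        revert Hi. induction i as [i IH] using (well_founded_induction Nat.lt_wf_0). intros Hi.
        destruct (classic (exists j, (j < i)%nat /\ phi (fun t => t ^ j) <> 0)) as [[j [Hj Hj']]|Hno].
        - now apply (IH j).
        - exists i. split; [|exact Hi]. intros j Hj. apply NNPP. intros Hj'. apply Hno. eauto. }
      destruct HN as [N [Hlow HN]]. exists (S (S N)). intros F HF.
      destruct (HP F HF) as [EF XF].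
      apply (polynomial_case HW Hdelta Hphi N Hlow HN F EF XF).
      apply (phi_divdiff_vanishes HW Hdelta Hphi F EF XF). intros n. apply phi_P, HD.
      induction n as [|n IH]; [exact HF|]. simpl. now apply HD.
Qed.

(** * Weights of compact sets *)

Lemma compact_bounded (K : C -> Prop) : compact_set K -> exists R0, forall s, K s -> (Cmod s <= R0)%R.
Proof.
  intros HK.
  destruct (HK (fun U => exists m : nat, U = (fun s : C => (Cmod s < INR m)%R))) as [l [Hl1 Hl2]].
  - intros U [m ->] s Hs. apply (C_locally_iff s). exists (INR m - Cmod s)%R. split; [lra|].
    intros t Ht. generalize (Cmod_triangle (t - s) s). replace (t - s + s) with t by ring. lra.
  - intros s _. destruct (nfloor_ex (Cmod s) (Cmod_ge_0 s)) as [m [_ Hm]].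
    exists (fun s => (Cmod s < INR (S m))%R). split; [now exists (S m)|]. rewrite S_INR. lra.
  - assert (B : exists R0, forall U, In U l -> forall s, U s -> (Cmod s <= R0)%R).
    { clear Hl2 HK. induction l as [|U l IH].
      - exists 0%R. intros U [].
      - destruct IH as [R1 H1]; [intros V HV; apply Hl1; now right|].
        destruct (Hl1 U (or_introl eq_refl)) as [m Hm].
        exists (Rmax R1 (INR m)). intros V [<-|HV] s Hs.
        + rewrite Hm in Hs. eapply Rle_trans; [left; exact Hs|apply Rmax_r].
        + eapply Rle_trans; [now apply (H1 V)|apply Rmax_l]. }
    destruct B as [R0 HR0]. exists R0. intros s Hs. destruct (Hl2 s Hs) as [U [HU HUs]]. eauto.
Qed.

Lemma compact_singleton (c : C) : compact_set (fun s : C => s = c).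
Proof.
  intros F _ Hc. destruct (Hc c eq_refl) as [U [HU Uc]].
  exists (U :: nil). split.
  - intros V [<-|[]]. exact HU.
  - intros s ->. exists U. split; [now left|exact Uc].
Qed.

Lemma support_function_spec (K : C -> Prop) (R0 : R) (s0 : C) :
  K s0 -> (forall s, K s -> (Cmod s <= R0)%R) -> forall z,
  (forall s, K s -> (Re (s * z) <= real (support_function K z))%R) /\
  (forall eta, (0 < eta)%R -> exists s, K s /\ (real (support_function K z) - eta < Re (s * z))%R).
Proof.
  intros H0 HR z. unfold support_function.
  set (E := fun x : R => exists t : C, K t /\ x = Re (t * z)).
  destruct (Lub_Rbar_correct E) as [L1 L2].
  assert (ub : is_ub_Rbar E (Finite (R0 * Cmod z))).
  { intros x [t [Kt ->]]. change (Re (t * z) <= R0 * Cmod z)%R. eapply Rle_trans; [apply Re_le_Cmod|]. rewrite Cmod_mult.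
    apply Rmult_le_compat_r; [apply Cmod_ge_0|auto]. }
  assert (E0 : E (Re (s0 * z))) by (exists s0; auto).
  assert (U := L2 _ ub). assert (V := L1 _ E0).
  destruct (Lub_Rbar E) as [h| |]; [|destruct U|destruct V]. cbn [real]. split.
  - intros s Ks. apply (L1 (Re (s * z))). now exists s.
  - intros eta Heta. apply NNPP. intros N. apply (Rlt_irrefl h).
    apply Rle_lt_trans with (h - eta)%R; [|lra].
    apply (L2 (Finite (h - eta))). intros x [t [Kt ->]]. change (Re (t * z) <= h - eta)%R. apply Rnot_lt_le. intros Hlt.
    apply N. now exists t.
Qed.

Lemma weighted_norm_le (Qs : nat -> C -> Prop) (n k : nat) (f : C -> C) (M : R) :
  Rbar_le (weighted_norm Qs n k f) M <-> forall z, (Cmod (f z) <= M * exp (weight Qs n k z))%R.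
Proof.
  unfold weighted_norm. destruct (Lub_Rbar_correct
    (fun x : R => exists z : C, x = (Cmod (f z) / exp (weight Qs n k z))%R)) as [L1 L2].
  assert (D : forall z, (Cmod (f z) / exp (weight Qs n k z) <= M)%R <->
     (Cmod (f z) <= M * exp (weight Qs n k z))%R).
  { intros z. assert (P := exp_pos (weight Qs n k z)). split; intros H.
    - apply Rmult_le_reg_r with (/ exp (weight Qs n k z))%R; [now apply Rinv_0_lt_compat|].
      rewrite Rmult_assoc, Rinv_r, Rmult_1_r by lra. exact H.
    - apply Rmult_le_reg_r with (exp (weight Qs n k z)); [exact P|].
      unfold Rdiv. rewrite Rmult_assoc, Rinv_l, Rmult_1_r by lra. exact H. }
  split.
  - intros H z. apply D. apply (Rbar_le_trans _ _ (Finite M) (L1 _ (ex_intro _ z eq_refl)) H).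
  - intros H. apply L2. intros x [z ->]. apply D, H.
Qed.

Lemma weighted_norm_finite (Qs : nat -> C -> Prop) (n k : nat) (f : C -> C) :
  Rbar_lt (weighted_norm Qs n k f) p_infty <->
  exists M, forall z, (Cmod (f z) <= M * exp (weight Qs n k z))%R.
Proof.
  split.
  - intros H. assert (Q := fun M => weighted_norm_le Qs n k f M).
    destruct (weighted_norm Qs n k f) as [r| |]; [|destruct H|].
    + exists r. apply Q. simpl. lra.
    + exists 0%R. apply Q. exact I.
  - intros [M HM]. apply weighted_norm_le in HM.
    destruct (weighted_norm Qs n k f) as [r| |]; [exact I|destruct HM|exact I].
Qed.

Lemma weighted_norm_lt (Qs : nat -> C -> Prop) (n k : nat) (f : C -> C) (e : R) :
  Rbar_lt (weighted_norm Qs n k f) e -> forall z, (Cmod (f z) <= e * exp (weight Qs n k z))%R.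
Proof. intros H. apply weighted_norm_le. now apply Rbar_lt_le. Qed.

Lemma E_step_iff (Qs : nat -> C -> Prop) (n : nat) (f : C -> C) :
  E_step Qs n f <-> entire f /\ forall k, exists M, forall z, (Cmod (f z) <= M * exp (weight Qs n k z))%R.
Proof.
  unfold E_step. split; intros [H1 H2]; (split; [exact H1|]); intros k; now apply weighted_norm_finite.
Qed.

Lemma E_step_plus (Qs : nat -> C -> Prop) (n : nat) (f g : C -> C) :
  E_step Qs n f -> E_step Qs n g -> E_step Qs n (fun z => f z + g z).
Proof.
  rewrite !E_step_iff. intros [Ef Hf] [Eg Hg]. split; [now apply entire_plus|].
  intros k. destruct (Hf k) as [M HM]. destruct (Hg k) as [N HN]. exists (M + N)%R. intros z.
  eapply Rle_trans; [apply Cmod_triangle|]. rewrite Rmult_plus_distr_r. apply Rplus_le_compat; auto.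
Qed.

Lemma E_step_scal (Qs : nat -> C -> Prop) (n : nat) (c : C) (f : C -> C) :
  E_step Qs n f -> E_step Qs n (fun z => c * f z).
Proof.
  rewrite !E_step_iff. intros [Ef Hf]. split.
  - apply (entire_mult (fun _ => c)); [apply entire_const|exact Ef].
  - intros k. destruct (Hf k) as [M HM]. exists (Cmod c * M)%R. intros z.
    rewrite Cmod_mult, Rmult_assoc. apply Rmult_le_compat_l; [apply Cmod_ge_0|auto].
Qed.

(** * Multiplication by an exponential *)

Definition untwist (lambda : C) (f : C -> C) (t : C) : C := e_ (- lambda) t * f t.
Definition twist (lambda : C) (F : C -> C) (t : C) : C := e_ lambda t * F t.
#[export] Hint Unfold twist untwist : pointwise.

Lemma e_opp (lambda t : C) : e_ lambda t * e_ (- lambda) t = 1.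
Proof.
  unfold e_. rewrite <- Cexp_plus. replace (lambda * t + - lambda * t) with (RtoC 0) by ring. apply Cexp_0.
Qed.

Lemma twist_untwist (lambda : C) (f : C -> C) : twist lambda (untwist lambda f) = f.
Proof.
  apply functional_extensionality; intros t. unfold twist, untwist.
  rewrite Cmult_assoc, e_opp. ring.
Qed.

Lemma untwist_twist (lambda : C) (F : C -> C) : untwist lambda (twist lambda F) = F.
Proof.
  apply functional_extensionality; intros t. unfold twist, untwist.
  rewrite Cmult_assoc, (Cmult_comm (e_ (- lambda) t)), e_opp. ring.
Qed.

Lemma entire_twist (lambda : C) (F : C -> C) : entire F -> entire (twist lambda F).
Proof. intros HF. apply entire_mult; [apply entire_e|exact HF]. Qed.

Lemma entire_untwist (lambda : C) (f : C -> C) : entire f -> entire (untwist lambda f).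
Proof. intros HF. apply entire_mult; [apply entire_e|exact HF]. Qed.

Lemma has_cderiv_e_0 (nu : C) : has_cderiv (e_ nu) 0 nu.
Proof.
  unfold e_.
  assert (Q := has_cderiv_comp Cexp (fun t => 0 + nu * t) 0 _ _ (has_cderiv_affine 0 nu 0)
    (has_cderiv_Cexp _)). cbv beta in Q.
  replace (0 + nu * 0) with (RtoC 0) in Q by ring. rewrite Cexp_0, Cmult_1_l in Q.
  replace (fun t => Cexp (nu * t)) with (fun t => Cexp (0 + nu * t)); [exact Q|].
  apply functional_extensionality; intros t. f_equal. ring.
Qed.

Lemma e_at_0 (nu : C) : e_ nu 0 = 1.
Proof. unfold e_. replace (nu * 0) with (RtoC 0) by ring. apply Cexp_0. Qed.

(** Removes lambda from the operator: e_lambda factors out because it is 1 at 0, and at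
    t = 0 the derivative of e_lambda cancels in the product rule. *)
Lemma pommiez_twist (lambda : C) (F : C -> C) :
  entire F -> pommiez (e_ lambda) (twist lambda F) = twist lambda (divdiff 0 F).
Proof.
  intros HF. apply functional_extensionality; intros t. unfold pommiez, twist, divdiff.
  rewrite e_at_0. destruct (Ceq_dec t 0) as [->|N].
  - rewrite (has_cderiv_C_derive _ _ _ (has_cderiv_e_0 lambda)), e_at_0.
    assert (Q := has_cderiv_mult _ _ 0 _ _ (has_cderiv_e_0 lambda) (entire_C_derive F 0 HF)).
    cbv beta in Q. rewrite (has_cderiv_C_derive _ _ _ Q), e_at_0. ring.
  - replace (t - 0) with t by ring. field. exact N.
Qed.

Definition shifted_support (Qs : nat -> C -> Prop) (lambda : C) (n : nat) (z : C) : R :=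
  (real (support_function (Qs n) z) - Re (lambda * z))%R.

(** Twisting translates the support function, so the norms of a step become the
    conditions [dominated] for Q_n - lambda, a set that contains 0 as soon as lambda is in Q_n. *)
Lemma dominated_untwist (Qs : nat -> C -> Prop) (lambda : C) (n k : nat) (M : R) (f : C -> C) :
  dominated (shifted_support Qs lambda n) (/ INR (S k)) M (untwist lambda f) <->
  forall z, (Cmod (f z) <= M * exp (weight Qs n k z))%R.
Proof.
  assert (E : forall z, (exp (weight Qs n k z) =
     exp (Re (lambda * z)) * exp (shifted_support Qs lambda n z + / INR (S k) * Cmod z))%R).
  { intros z. rewrite <- exp_plus. f_equal. unfold weight, shifted_support, Rdiv. ring. }
  assert (U : forall z, (Cmod (f z) = exp (Re (lambda * z)) * Cmod (untwist lambda f z))%R).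
  { intros z. rewrite <- Cmod_Cexp, <- Cmod_mult. f_equal.
    symmetry. exact (f_equal (fun h => h z) (twist_untwist lambda f)). }
  split; intros H z; specialize (H z); assert (P := exp_pos (Re (lambda * z))).
  - rewrite E, U. replace (M * (exp (Re (lambda * z)) * exp (shifted_support Qs lambda n z + / INR (S k) * Cmod z)))%R
      with (exp (Re (lambda * z)) * (M * exp (shifted_support Qs lambda n z + / INR (S k) * Cmod z)))%R by ring.
    apply Rmult_le_compat_l; lra.
  - rewrite E, U in H. apply Rmult_le_reg_l with (exp (Re (lambda * z))); [exact P|]. lra.
Qed.

(** * Polynomials and the backward shift *)

Lemma csum_entire (a : nat -> C) (n : nat) : entire (fun t => csum (fun k => a k * t ^ k) n).
Proof.
  induction n as [|n IH]; [apply (entire_const 0)|]. simpl.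
  apply entire_plus; [exact IH|]. apply (entire_mult (fun _ => a n)); [apply entire_const|apply entire_pow].
Qed.

Lemma divdiff_0_csum (a : nat -> C) (n : nat) :
  divdiff 0 (fun t => csum (fun k => a k * t ^ k) (S n)) = (fun t => csum (fun k => a (S k) * t ^ k) n).
Proof.
  apply divdiff_unique; [apply csum_entire|apply entire_ccont, csum_entire|].
  intros t. induction n as [|n IH].
  - simpl. ring.
  - set (u := csum (fun k => a k * t ^ k) (S n)) in *.
    change (csum (fun k => a k * t ^ k) (S (S n))) with (u + a (S n) * t ^ S n).
    change (csum (fun k => a k * 0 ^ k) (S (S n))) with (csum (fun k => a k * 0 ^ k) (S n) + a (S n) * 0 ^ S n).
    change (csum (fun k => a (S k) * t ^ k) (S n)) with (csum (fun k => a (S k) * t ^ k) n + a (S n) * t ^ n).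
    replace (u + a (S n) * t ^ S n - (csum (fun k => a k * 0 ^ k) (S n) + a (S n) * 0 ^ S n)) with
      (u - csum (fun k => a k * 0 ^ k) (S n) + a (S n) * (t * t ^ n)) by (simpl; ring).
    rewrite <- IH. ring.
Qed.

Lemma iter_divdiff_csum (a : nat -> C) (n : nat) :
  Nat.iter n (divdiff 0) (fun t => csum (fun k => a k * t ^ k) n) = (fun _ => 0).
Proof.
  revert a. induction n as [|n IH]; intros a; [reflexivity|].
  rewrite Nat.iter_succ_r, divdiff_0_csum. apply IH.
Qed.

Lemma iter_divdiff_pow (n : nat) : Nat.iter n (divdiff 0) (fun t => t ^ n) = (fun _ => 1).
Proof.
  induction n as [|n IH]; [reflexivity|].
  rewrite Nat.iter_succ_r, <- IH. f_equal.
  transitivity (fun t => t ^ n + 0 * divdiff 0 (fun t => t ^ n) t); [|fun_ring].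
  exact (divdiff_mult_id 0 (fun t => t ^ n) (entire_pow n)).
Qed.

Lemma csum_top_zero (a : nat -> C) (m n : nat) (t : C) :
  (m <= n)%nat -> (forall k, (m <= k < n)%nat -> a k = 0) ->
  csum (fun k => a k * t ^ k) n = csum (fun k => a k * t ^ k) m.
Proof.
  intros Hmn Ha. induction n as [|n IH].
  - now replace m with 0%nat by lia.
  - destruct (Nat.eq_dec m (S n)) as [->|Hne]; [reflexivity|].
    simpl. rewrite IH, (Ha n) by (try lia; intros; apply Ha; lia). ring.
Qed.

(** Undo the shift n times; the coefficients are the values at 0 of the iterates. *)
Lemma iter_divdiff_polynomial (n : nat) : forall F : C -> C,
  (forall t, Nat.iter n (divdiff 0) F t = 0) ->
  exists a : nat -> C, forall t, F t = csum (fun k => a k * t ^ k) n.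
Proof.
  induction n as [|n IH]; intros F HF.
  - exists (fun _ => 0). exact HF.
  - destruct (IH (divdiff 0 F)) as [b Hb].
    { intros t. rewrite <- Nat.iter_succ_r. apply HF. }
    exists (fun k => match k with O => F 0 | S j => b j end). intros t.
    assert (Q := divdiff_spec 0 F t). rewrite Hb in Q.
    replace (F t) with (F t - F 0 + F 0) by ring. rewrite <- Q. clear.
    induction n as [|n IH]; [simpl; ring|].
    change (csum (fun k => match k with O => F 0 | S j => b j end * t ^ k) (S (S n))) with
      (csum (fun k => match k with O => F 0 | S j => b j end * t ^ k) (S n) + b n * t ^ S n).
    rewrite <- IH. simpl. ring.
Qed.

Lemma exp_poly_iff (n : nat) (lambda : C) (f : C -> C) :
  exp_poly n lambda f <->
  exists a : nat -> C, f = twist lambda (fun t => csum (fun k => a k * t ^ k) (S n)).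
Proof.
  split.
  - intros [p [[a ->] ->]]. exists a. apply functional_extensionality; intros t. unfold twist.
    f_equal. apply csum_sum_n.
  - intros [a ->]. exists (fun z => sum_n (fun k => a k * z ^ k) n). split; [now exists a|].
    apply functional_extensionality; intros t. unfold twist. f_equal. symmetry. apply csum_sum_n.
Qed.

Lemma exp_poly_csum (a : nat -> C) (m n : nat) (lambda : C) :
  (m <= S n)%nat -> exp_poly n lambda (twist lambda (fun t => csum (fun k => a k * t ^ k) m)).
Proof.
  intros Hmn. apply exp_poly_iff. exists (fun k => if Nat.ltb k m then a k else 0). f_equal.
  apply functional_extensionality; intros t.
  rewrite (csum_top_zero (fun k => if Nat.ltb k m then a k else 0) m (S n)); [|exact Hmn|].
  - apply csum_ext. intros k Hk. apply Nat.ltb_lt in Hk. now rewrite Hk.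
  - intros k Hk. replace (Nat.ltb k m) with false; [reflexivity|]. symmetry. apply Nat.ltb_ge. lia.
Qed.

(** * The exponential polynomials *)

Lemma dominated_iter_divdiff (K : C -> Prop) (R0 : R) (H : C -> R) (e M : R) (F : C -> C) (n : nat) :
  support_weight K R0 H -> (0 <= e)%R -> entire F -> dominated H e M F ->
  entire (Nat.iter n (divdiff 0) F) /\
  dominated H e (M * (2 + near_factor (R0 := R0) e) ^ n) (Nat.iter n (divdiff 0) F).
Proof.
  intros HW He HF HM. induction n as [|n [I1 I2]].
  - simpl. rewrite Rmult_1_r. now split.
  - simpl Nat.iter. split; [now apply entire_divdiff|].
    set (Mn := (M * (2 + near_factor (R0 := R0) e) ^ n)%R) in *.
    assert (Q := dominated_divdiff HW e Mn _ 0 He I1 I2).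
    assert (Q0 := dominated_at HW e Mn _ 0 He I2).
    rewrite Cmod_0, Rmult_0_r, exp_0, Rmult_1_r in Q0.
    eapply dominated_weaken; [apply Rle_refl| |exact Q].
    replace (M * (2 + near_factor (R0 := R0) e) ^ S n)%R with (Mn * (2 + near_factor (R0 := R0) e))%R
      by (unfold Mn; simpl; ring). lra.
Qed.

Lemma iter_divdiff_plus (n : nat) (F G : C -> C) : entire F -> entire G ->
  Nat.iter n (divdiff 0) (fun t => F t + G t) = (fun t => Nat.iter n (divdiff 0) F t + Nat.iter n (divdiff 0) G t).
Proof.
  revert F G. induction n as [|n IH]; intros F G HF HG; [reflexivity|].
  rewrite !Nat.iter_succ_r, divdiff_plus by assumption. apply IH; now apply entire_divdiff.
Qed.

Lemma iter_divdiff_scal (n : nat) (c : C) (F : C -> C) : entire F ->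
  Nat.iter n (divdiff 0) (fun t => c * F t) = (fun t => c * Nat.iter n (divdiff 0) F t).
Proof.
  revert F. induction n as [|n IH]; intros F HF; [reflexivity|].
  rewrite !Nat.iter_succ_r, divdiff_scal by assumption. apply IH; now apply entire_divdiff.
Qed.

Lemma untwist_plus (lambda : C) (f g : C -> C) :
  untwist lambda (fun t => f t + g t) = (fun t => untwist lambda f t + untwist lambda g t).
Proof. fun_ring. Qed.

Lemma untwist_scal (lambda c : C) (f : C -> C) :
  untwist lambda (fun t => c * f t) = (fun t => c * untwist lambda f t).
Proof. fun_ring. Qed.

Section Spaces.

Context {Q : C -> Prop} {Qs : nat -> C -> Prop} {lambda : C} {n0 : nat}
  (Hfund : fundamental_sequence Q Qs) (Hzero : Qs 0%nat (RtoC 0)) (Hn0 : Qs n0 lambda).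

Lemma fund_mono (n m : nat) : (n <= m)%nat -> subset (Qs n) (Qs m).
Proof.
  destruct Hfund as (_ & _ & Hs & _). induction 1 as [|m _ IH]; [now intros s Hs'|].
  intros s Hs'. apply Hs, IH, Hs'.
Qed.

Lemma fund_support (n : nat) (z : C) :
  (forall s, Qs n s -> (Re (s * z) <= real (support_function (Qs n) z))%R) /\
  (forall eta, (0 < eta)%R -> exists s, Qs n s /\ (real (support_function (Qs n) z) - eta < Re (s * z))%R).
Proof.
  destruct Hfund as (Hc & _). destruct (compact_bounded _ (Hc n)) as [R0 HR].
  apply (support_function_spec (Qs n) R0 0); [|exact HR].
  apply (fund_mono 0 n); [lia|exact Hzero].
Qed.

Lemma weight_mono (n m k : nat) (z : C) : (n <= m)%nat -> (weight Qs n k z <= weight Qs m k z)%R.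
Proof.
  intros Hnm. unfold weight. apply Rplus_le_compat_r. apply le_epsilon. intros e He.
  destruct (proj2 (fund_support n z) e He) as [s [Hs Hlt]].
  assert (Q1 := proj1 (fund_support m z) s (fund_mono n m Hnm s Hs)). lra.
Qed.

Lemma E_step_mono (n m : nat) (f : C -> C) : (n <= m)%nat -> E_step Qs n f -> E_step Qs m f.
Proof.
  rewrite !E_step_iff. intros Hnm [Ef Hf]. split; [exact Ef|]. intros k.
  destruct (Hf k) as [M HM]. exists M. intros z.
  assert (M0 : (0 <= M)%R).
  { generalize (HM z) (Cmod_ge_0 (f z)) (exp_pos (weight Qs n k z)). intros. nra. }
  eapply Rle_trans; [apply HM|]. apply Rmult_le_compat_l; [exact M0|].
  apply exp_le, weight_mono, Hnm.
Qed.

Lemma shifted_support_weight (n : nat) : (n0 <= n)%nat ->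
  exists R0, support_weight (fun s => Qs n (s + lambda)) R0 (shifted_support Qs lambda n).
Proof.
  intros Hn. destruct Hfund as (Hc & _). destruct (compact_bounded _ (Hc n)) as [R0 HR].
  assert (E : forall s z, (Re ((s + lambda) * z) = Re (s * z) + Re (lambda * z))%R)
    by (intros; unfold Re; simpl; ring).
  exists (R0 + Cmod lambda)%R. split.
  - replace (0 + lambda) with lambda by ring. now apply (fund_mono n0 n).
  - intros s Hs. assert (B := HR _ Hs). replace s with ((s + lambda) - lambda) by ring.
    eapply Rle_trans; [apply Cmod_minus_le|]. lra.
  - intros s z Hs. unfold shifted_support.
    assert (B := proj1 (fund_support n z) _ Hs). rewrite E in B. lra.
  - intros z eta Heta. destruct (proj2 (fund_support n z) eta Heta) as [s [Hs Hlt]].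
    exists (s - lambda). replace (s - lambda + lambda) with s by ring. split; [exact Hs|].
    unfold shifted_support. assert (E' := E (s - lambda) z).
    replace (s - lambda + lambda) with s in E' by ring. lra.
Qed.

Lemma E_step_untwist (n : nat) (f : C -> C) :
  E_step Qs n f <-> entire (untwist lambda f) /\
    forall k, exists M, dominated (shifted_support Qs lambda n) (/ INR (S k)) M (untwist lambda f).
Proof.
  rewrite E_step_iff. split; intros [H1 H2].
  - split; [now apply entire_untwist|]. intros k. destruct (H2 k) as [M HM].
    exists M. now apply dominated_untwist.
  - split.
    + rewrite <- (twist_untwist lambda f). now apply entire_twist.
    + intros k. destruct (H2 k) as [M HM]. exists M. exact (proj1 (dominated_untwist Qs lambda n k M f) HM).
Qed.

Lemma inv_INR_pos (k : nat) : (0 < / INR (S k))%R.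
Proof. apply Rinv_0_lt_compat, lt_0_INR. lia. Qed.

Lemma E_step_exp_poly (n m : nat) (f : C -> C) : (n0 <= n)%nat -> exp_poly m lambda f -> E_step Qs n f.
Proof.
  intros Hn Hf. apply exp_poly_iff in Hf. destruct Hf as [a ->].
  destruct (shifted_support_weight n Hn) as [R0 HW].
  apply E_step_untwist. rewrite untwist_twist. split; [apply csum_entire|]. intros k.
  change (in_space (H := shifted_support Qs lambda n) (delta := / INR (S k))
    (fun t => csum (fun j => a j * t ^ j) (S m))).
  induction (S m) as [|j IH].
  - exists 0%R. intros t. simpl csum. rewrite Cmod_0. lra.
  - simpl csum. apply in_space_plus; [exact IH|]. apply in_space_scal.
    apply (in_space_pow HW). apply inv_INR_pos.
Qed.

Lemma E_step_divdiff (n : nat) (F : C -> C) : (n0 <= n)%nat ->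
  E_step Qs n (twist lambda F) -> E_step Qs n (twist lambda (divdiff 0 F)).
Proof.
  rewrite !E_step_untwist, !untwist_twist. intros Hn [EF HF].
  destruct (shifted_support_weight n Hn) as [R0 HW].
  split; [now apply entire_divdiff|]. intros k. destruct (HF k) as [M HM].
  eexists. apply (dominated_divdiff HW); [left; apply inv_INR_pos|exact EF|exact HM].
Qed.

Lemma exp_poly_linear (n : nat) : linear_subspace (exp_poly n lambda).
Proof.
  split; [|split].
  - replace (fun _ : C => RtoC 0) with (twist lambda (fun t => csum (fun k => 0 * t ^ k) 0)) by (simpl; fun_ring).
    apply exp_poly_csum. lia.
  - intros f g Hf Hg. apply exp_poly_iff in Hf, Hg. destruct Hf as [a ->], Hg as [b ->].
    apply exp_poly_iff. exists (fun k => a k + b k). apply functional_extensionality; intros t. unfold twist.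
    rewrite (csum_ext (fun k => (a k + b k) * t ^ k) (fun k => a k * t ^ k + b k * t ^ k)) by (intros; ring).
    rewrite csum_plus. ring.
  - intros c f Hf. apply exp_poly_iff in Hf. destruct Hf as [a ->].
    apply exp_poly_iff. exists (fun k => c * a k). apply functional_extensionality; intros t. unfold twist.
    rewrite (csum_ext (fun k => c * a k * t ^ k) (fun k => c * (a k * t ^ k))) by (intros; ring).
    rewrite csum_scal. ring.
Qed.

Lemma exp_poly_not_full (n : nat) : ~ same_set (exp_poly n lambda) (E_lim Qs).
Proof.
  intros HS.
  assert (Hf : exp_poly n lambda (twist lambda (fun t => t ^ S n))).
  { apply HS. exists n0. apply E_step_untwist. rewrite untwist_twist. split; [apply entire_pow|].
    destruct (shifted_support_weight n0 (Nat.le_refl n0)) as [R0 HW].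
    intros k. apply (in_space_pow HW). apply inv_INR_pos. }
  apply exp_poly_iff in Hf. destruct Hf as [a Ha].
  assert (E := f_equal (fun f => Nat.iter (S n) (divdiff 0) (untwist lambda f) 0) Ha). cbv beta in E.
  rewrite !untwist_twist, iter_divdiff_pow, iter_divdiff_csum in E. apply RtoC_inj in E. lra.
Qed.

(** A function f outside the space has a nonzero value at some z after untwisting and
    n + 1 shifts, by [iter_divdiff_polynomial]. This value is a linear functional of f,
    continuous on every step by [dominated_iter_divdiff], so it stays nonzero when f is
    perturbed by a small function; on the space itself it is zero. *)
Lemma exp_poly_closed (n : nat) : lf_closed Qs (exp_poly n lambda).
Proof.
  split; [intros f Hf; exists n0; now apply (E_step_exp_poly n0 n)|].
  split; [now intros f [Hf _]|].
  intros f [Hf Hnf].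
  assert (Lent : forall g, E_lim Qs g -> entire (untwist lambda g)).
  { intros g [m Hg]. apply entire_untwist, Hg. }
  assert (Lplus : forall g h, E_lim Qs g -> E_lim Qs h -> E_lim Qs (fun z => g z + h z)).
  { intros g h [m Hg] [m' Hh]. exists (Nat.max m m').
    apply E_step_plus; [apply (E_step_mono m)|apply (E_step_mono m')]; auto; lia. }
  assert (Lscal : forall c g, E_lim Qs g -> E_lim Qs (fun z => c * g z)).
  { intros c g [m Hg]. exists m. now apply E_step_scal. }
  set (W := fun (g : C -> C) => Nat.iter (S n) (divdiff 0) (untwist lambda g)).
  assert (Hz : exists z, W f z <> 0).
  { apply NNPP. intros N. apply Hnf.
    destruct (iter_divdiff_polynomial (S n) (untwist lambda f)) as [a Ha].
    - intros t. apply NNPP. intros N'. apply N. now exists t.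
    - apply exp_poly_iff. exists a. rewrite <- (twist_untwist lambda f). f_equal.
      apply functional_extensionality; exact Ha. }
  destruct Hz as [z Hz]. assert (Pz : (0 < Cmod (W f z))%R) by (apply Cmod_gt_0; exact Hz).
  exists (fun g => E_lim Qs g /\ (Cmod (W g z) < Cmod (W f z))%R). split; [split; [|split]|].
  - now intros g [Hg _].
  - intros g h a b [Lg Hg] [Lh Hh] Hab. split; [apply Lplus; now apply Lscal|].
    unfold W. rewrite untwist_plus, !untwist_scal.
    rewrite iter_divdiff_plus; [|apply (entire_mult (fun _ => a)); [apply entire_const|now apply Lent]
       |apply (entire_mult (fun _ => b)); [apply entire_const|now apply Lent]].
    rewrite !iter_divdiff_scal by now apply Lent. fold (W g) (W h).
    eapply Rle_lt_trans; [apply Cmod_triangle|]. rewrite !Cmod_mult.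
    set (w := Cmod (W f z)) in *.
    generalize (Cmod_ge_0 a) (Cmod_ge_0 b) (Cmod_ge_0 (W g z)) (Cmod_ge_0 (W h z)). intros.
    set (mx := Rmax (Cmod (W g z)) (Cmod (W h z))).
    assert (Hm : (mx < w)%R) by now apply Rmax_lub_lt.
    assert (m1 : (Cmod (W g z) <= mx)%R) by apply Rmax_l.
    assert (m2 : (Cmod (W h z) <= mx)%R) by apply Rmax_r.
    apply Rle_lt_trans with mx; [|exact Hm].
    apply Rle_trans with (Cmod a * mx + Cmod b * mx)%R; [|nra].
    apply Rplus_le_compat; now apply Rmult_le_compat_l.
  - intros m. set (m' := Nat.max m n0).
    destruct (shifted_support_weight m' ltac:(lia)) as [R0 HW].
    set (D := ((2 + near_factor (R0 := R0) (/ INR 1)) ^ S n *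
      exp (shifted_support Qs lambda m' z + / INR 1 * Cmod z))%R).
    assert (HD : (0 < D)%R).
    { apply Rmult_lt_0_compat; [|apply exp_pos]. apply pow_lt.
      generalize (near_factor_pos (R0 := R0) (/ INR 1)). lra. }
    exists 0%nat, (Cmod (W f z) / 2 / D)%R. split; [apply Rdiv_lt_0_compat; lra|].
    intros g Hg Hsmall. assert (Lg : E_lim Qs g) by now exists m. split; [exact Lg|].
    assert (B := weighted_norm_lt _ _ _ _ _ (Hsmall 0%nat (Nat.le_refl 0))).
    set (eps := (Cmod (W f z) / 2 / D)%R) in *.
    assert (Pe : (0 < eps)%R) by (apply Rdiv_lt_0_compat; lra).
    assert (B' : dominated (shifted_support Qs lambda m') (/ INR 1) eps (untwist lambda g)).
    { apply dominated_untwist. intros t. eapply Rle_trans; [apply B|].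
      apply Rmult_le_compat_l; [lra|]. apply exp_le, weight_mono. lia. }
    destruct (dominated_iter_divdiff _ _ _ _ _ _ (S n) HW ltac:(left; apply (inv_INR_pos 0)) (Lent g Lg) B') as [_ Q1].
    specialize (Q1 z). fold (W g) in Q1. eapply Rle_lt_trans; [exact Q1|].
    rewrite Rmult_assoc. fold D. unfold eps.
    replace (Cmod (W f z) / 2 / D * D)%R with (Cmod (W f z) / 2)%R by (field; lra). lra.
  - intros g [Lg Hg]. split; [now apply Lplus|]. intros Hp.
    apply exp_poly_iff in Hp. destruct Hp as [a Ha].
    assert (E1 := f_equal W Ha). unfold W in E1. rewrite untwist_twist, iter_divdiff_csum, untwist_plus in E1.
    rewrite iter_divdiff_plus in E1 by now apply Lent.
    assert (E2 := f_equal (fun h => h z) E1). cbv beta in E2. fold (W f) (W g) in E2.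
    assert (E3 : W f z = - W g z).
    { replace (W f z) with (W f z + W g z - W g z) by ring. rewrite E2. ring. }
    rewrite E3, Cmod_opp in Hg. lra.
Qed.

Lemma exp_poly_invariant (n : nat) : invariant_under (pommiez (e_ lambda)) (exp_poly n lambda).
Proof.
  intros f Hf. apply exp_poly_iff in Hf. destruct Hf as [a ->].
  rewrite pommiez_twist by apply csum_entire. rewrite divdiff_0_csum.
  apply exp_poly_csum. lia.
Qed.

Theorem exp_poly_proper_closed_invariant (n : nat) :
  proper_closed_invariant_subspace Qs (e_ lambda) (exp_poly n lambda).
Proof.
  split; [apply exp_poly_closed|]. split; [apply exp_poly_linear|].
  split; [|split; [apply exp_poly_not_full|split; [apply exp_poly_closed|apply exp_poly_invariant]]].
  intros HS.
  assert (H1 : exp_poly n lambda (e_ lambda)).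
  { replace (e_ lambda) with (twist lambda (fun t => csum (fun k => 1 * t ^ k) 1)) by (simpl; fun_ring).
    apply exp_poly_csum. lia. }
  apply HS in H1. assert (Z := e_at_0 lambda). rewrite H1 in Z.
  assert (Z' : RtoC 0 = 1) by exact Z. apply RtoC_inj in Z'. lra.
Qed.

(** * Closed invariant subspaces *)

(** A neighbourhood of a function g outside P that misses P contains, within step n, a
    ball around g for one weighted norm; so g has a positive distance from the part of P
    in that step, and [separated_subspace_polynomial] applies. The bound N depends on n. *)
Lemma step_bounded_degree (P : (C -> C) -> Prop) :
  proper_closed_invariant_subspace Qs (e_ lambda) P ->
  exists n1, forall n, (n1 <= n)%nat -> exists N, forall f, P f -> E_step Qs n f ->
    exists a : nat -> C, f = twist lambda (fun t => csum (fun k => a k * t ^ k) N).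
Proof.
  intros (Psub & (P0 & Pp & Ps) & _ & Pne & (_ & _ & Popen) & Pinv).
  assert (Hg : exists g, E_lim Qs g /\ ~ P g).
  { apply NNPP. intros N. apply Pne. intros f. split; [apply Psub|]. intros Hf.
    apply NNPP. intros N'. apply N. now exists f. }
  destruct Hg as [g [[ng Hg] Hng]].
  destruct (Popen g (conj (ex_intro _ ng Hg) Hng)) as [U [[_ [_ HU]] HUP]].
  exists (Nat.max n0 ng). intros n Hn.
  destruct (shifted_support_weight n ltac:(lia)) as [R0 HW].
  assert (Hgn := E_step_mono ng n g ltac:(lia) Hg).
  destruct (HU n) as (k0 & eps & Heps & HUn).
  set (P' := fun F => E_step Qs n (twist lambda F) /\ P (twist lambda F)).
  assert (Tp : forall F G, twist lambda (fun t => F t + G t) = (fun t => twist lambda F t + twist lambda G t)).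
  { intros F G. fun_ring. }
  assert (Ts : forall c F, twist lambda (fun t => c * F t) = (fun t => c * twist lambda F t)).
  { intros c F. fun_ring. }
  destruct (separated_subspace_polynomial _ R0 (shifted_support Qs lambda n) (/ INR (S k0)) (eps / 2)
    P' (untwist lambda g) HW (inv_INR_pos k0) ltac:(lra)) as [N HN].
  - split; [|split].
    + assert (E0 : twist lambda (fun _ => 0) = (fun _ => 0)).
      { fun_ring. }
      unfold P'. rewrite E0. split; [|exact P0].
      replace (fun _ : C => RtoC 0) with (fun z => 0 * g z)
        by fun_ring.
      now apply E_step_scal.
    + intros F G [F1 F2] [G1 G2]. unfold P'. rewrite Tp. split; [now apply E_step_plus|now apply Pp].
    + intros c F [F1 F2]. unfold P'. rewrite Ts. split; [now apply E_step_scal|now apply Ps].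
  - intros F [F1 _]. destruct (proj1 (E_step_untwist n (twist lambda F)) F1) as [EF HF].
    rewrite untwist_twist in EF, HF. split; [exact EF|apply HF].
  - intros F [F1 F2]. assert (EF : entire F).
    { rewrite <- (untwist_twist lambda F). apply (proj1 (E_step_untwist n (twist lambda F)) F1). }
    split; [apply E_step_divdiff; [lia|exact F1]|]. rewrite <- pommiez_twist by exact EF. now apply Pinv.
  - apply entire_untwist, Hg.
  - destruct (proj2 (proj1 (E_step_untwist n g) Hgn) (8 * S k0 - 1)%nat) as [M HM].
    exists M. replace (/ INR (S k0) / 8)%R with (/ INR (S (8 * S k0 - 1)))%R; [exact HM|].
    replace (S (8 * S k0 - 1)) with (8 * S k0)%nat by lia. rewrite mult_INR.
    replace (INR 8) with 8%R by (simpl; ring). field. apply not_0_INR. lia.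
  - intros F [F1 F2] HC.
    set (u := fun t => twist lambda F t + (- (1)) * g t).
    assert (Hu : E_step Qs n u) by (apply E_step_plus; [exact F1|now apply E_step_scal]).
    assert (HUu : U u).
    { apply HUn; [exact Hu|]. intros k Hk.
      apply Rbar_le_lt_trans with (Finite (eps / 2)); [|simpl; lra].
      apply weighted_norm_le. apply (dominated_untwist Qs lambda).
      assert (E1 : untwist lambda u = (fun t => F t - untwist lambda g t)).
      { unfold u. rewrite untwist_plus, untwist_scal, untwist_twist.
        fun_ring. }
      assert (HC' : dominated (shifted_support Qs lambda n) (/ INR (S k)) (eps / 2)
        (fun t => untwist lambda g t - F t)).
      { eapply dominated_weaken; [|apply Rle_refl|exact HC].
        apply Rinv_le_contravar; [apply lt_0_INR; lia|apply le_INR; lia]. }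
      rewrite E1. intros t. rewrite Cmod_minus_sym. exact (HC' t). }
    destruct (HUP u HUu) as [_ K]. apply K.
    replace (fun z => g z + u z) with (twist lambda F); [exact F2|].
    unfold u; fun_ring.
  - exists N. intros f Hf Hfn. destruct (HN (untwist lambda f)) as [a Ha].
    + unfold P'. rewrite twist_untwist. now split.
    + exists a. rewrite <- (twist_untwist lambda f). f_equal. apply functional_extensionality; exact Ha.
Qed.

(** Every member of P is e_lambda times a polynomial, hence belongs to one fixed step
    whatever its degree; the bound for that step is valid for all of P. *)
Lemma bounded_degree (P : (C -> C) -> Prop) :
  proper_closed_invariant_subspace Qs (e_ lambda) P ->
  exists N, forall f, P f ->
    exists a : nat -> C, f = twist lambda (fun t => csum (fun k => a k * t ^ k) N).
Proof.
  intros HP. destruct (step_bounded_degree P HP) as [n1 Hn1].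
  set (n := Nat.max n0 n1). destruct (Hn1 n ltac:(lia)) as [N HN]. exists N.
  intros f Hf. apply HN; [exact Hf|].
  destruct HP as (Psub & _). destruct (Psub f Hf) as [m Hm].
  destruct (Hn1 (Nat.max n m) ltac:(lia)) as [N' HN'].
  destruct (HN' f Hf (E_step_mono m (Nat.max n m) f ltac:(lia) Hm)) as [a Ha].
  apply (E_step_exp_poly n N'); [lia|]. rewrite Ha. apply exp_poly_csum. lia.
Qed.

(** Let m be the largest degree in P. Shifting an element of degree m yields elements of
    all smaller degrees, and these span the polynomials of degree at most m. *)
Theorem classification (P : (C -> C) -> Prop) :
  proper_closed_invariant_subspace Qs (e_ lambda) P ->
  exists n, same_set P (exp_poly n lambda).
Proof.
  intros HP. destruct (bounded_degree P HP) as [N HN].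
  destruct HP as (_ & (P0 & Pp & Ps) & Pnz & _ & _ & Pinv).
  set (pl := fun (a : nat -> C) (n : nat) => twist lambda (fun t => csum (fun k => a k * t ^ k) n)).
  set (deg := fun m => (m < N)%nat /\ exists a, P (pl a (S m)) /\ a m <> 0).
  assert (top : forall a n, (n <= N)%nat -> P (pl a n) -> (pl a n = (fun _ => 0)) \/
    exists m, deg m /\ pl a n = pl a (S m)).
  { intros a n Hn Hpl. induction n as [|n IH].
    - left. apply functional_extensionality; intros t. unfold pl, twist. simpl. ring.
    - destruct (Ceq_dec (a n) 0) as [E|E].
      + assert (E' : pl a (S n) = pl a n).
        { unfold pl. f_equal. apply functional_extensionality; intros t.
          apply (csum_top_zero a n (S n)); [lia|]. intros k Hk. now replace k with n by lia. }
        rewrite E' in Hpl |- *. apply IH; [lia|exact Hpl].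
      + right. exists n. split; [|reflexivity]. split; [lia|]. now exists a. }
  assert (Hex : exists m, deg m).
  { apply NNPP. intros No. apply Pnz. intros f. split; [|now intros ->].
    intros Hf. destruct (HN f Hf) as [a Ha]. fold (pl a N) in Ha. subst f.
    destruct (top a N (Nat.le_refl N) Hf) as [E|[m [Hm _]]]; [exact E|]. elim No. now exists m. }
  assert (Hmax : exists m, deg m /\ forall m', deg m' -> (m' <= m)%nat).
  { destruct Hex as [m0 Hm0].
    assert (G : forall j m, (N - m <= j)%nat -> deg m -> exists m, deg m /\ forall m', deg m' -> (m' <= m)%nat).
    { induction j as [|j IH]; intros m Hj Hm.
      - exfalso. destruct Hm. lia.
      - destruct (classic (exists m', deg m' /\ (m < m')%nat)) as [[m' [D' L]]|No].
        + apply (IH m'); [lia|exact D'].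
        + exists m. split; [exact Hm|]. intros m' D'. apply Nat.le_ngt. intros L. apply No. now exists m'. }
    exact (G (N - m0)%nat m0 (Nat.le_refl _) Hm0). }
  destruct Hmax as [m [[HmN [a [Ha Ham]]] Hmax]]. exists m.
  (* iterating the shift produces elements of P of every degree below m *)
  assert (low : forall i, (i <= m)%nat -> exists b, P (pl b (S (m - i))) /\ b (m - i)%nat <> 0).
  { induction i as [|i IH]; intros Hi.
    - exists a. now rewrite Nat.sub_0_r.
    - destruct (IH ltac:(lia)) as [b [Hb Hb']]. exists (fun k => b (S k)).
      replace (S (m - S i)) with (m - i)%nat by lia. split; [|exact Hb'].
      apply Pinv in Hb. unfold pl in Hb. rewrite pommiez_twist in Hb by apply csum_entire.
      rewrite divdiff_0_csum in Hb. exact Hb. }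
  assert (all : forall n, (n <= S m)%nat -> forall c, P (pl c n)).
  { induction n as [|n IH]; intros Hn c.
    - replace (pl c 0%nat) with (fun _ : C => RtoC 0); [exact P0|].
      apply functional_extensionality; intros t. unfold pl, twist. simpl. ring.
    - destruct (low (m - n)%nat ltac:(lia)) as [b [Hb Hbn]].
      replace (m - (m - n))%nat with n in Hb, Hbn by lia.
      set (r := c n / b n).
      replace (pl c (S n)) with (fun t => r * pl b (S n) t + pl (fun k => c k + (- r) * b k) n t).
      + apply Pp; [now apply Ps|]. apply IH. lia.
      + apply functional_extensionality; intros t. unfold pl, twist.
        rewrite (csum_ext (fun k => (c k + (- r) * b k) * t ^ k) (fun k => c k * t ^ k + (- r) * (b k * t ^ k)))
          by (intros; ring).
        rewrite csum_plus, csum_scal. simpl csum. unfold r. field. exact Hbn. }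
  intros f. split.
  - intros Hf. destruct (HN f Hf) as [b Hb]. fold (pl b N) in Hb. subst f.
    destruct (top b N (Nat.le_refl N) Hf) as [E|[m' [Hm' E]]]; rewrite E.
    + apply (exp_poly_linear m).
    + specialize (Hmax m' Hm'). apply exp_poly_csum. lia.
  - intros Hf. apply exp_poly_iff in Hf. destruct Hf as [b ->]. apply (all (S m) (Nat.le_refl _)).
Qed.

End Spaces.

Theorem corollary20 :
  forall (Q : C -> Prop) (Qs : nat -> C -> Prop) (lambda : C),
    convex_set Q -> locally_closed Q -> Q (RtoC 0) ->
    fundamental_sequence Q Qs ->
    (forall n : nat, convex_set (Qs n)) -> Qs 0%nat (RtoC 0) ->
    Q lambda ->
    (forall n : nat,
       proper_closed_invariant_subspace Qs (e_ lambda) (exp_poly n lambda)) /\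
    (forall P : (C -> C) -> Prop,
       proper_closed_invariant_subspace Qs (e_ lambda) P ->
       exists n : nat, same_set P (exp_poly n lambda)).
Proof.
  intros Q Qs lambda _ _ _ Hfund _ Hzero Hlambda.
  assert (Hn0 : exists n0, Qs n0 lambda).
  { destruct Hfund as (_ & _ & _ & Hc).
    destruct (Hc (fun s => s = lambda) (compact_singleton lambda)) as [n0 Hn0].
    - now intros s ->.
    - exists n0. now apply Hn0. }
  destruct Hn0 as [n0 Hn0]. split.
  - intros n. exact (exp_poly_proper_closed_invariant Hfund Hzero Hn0 n).
  - intros P HP. exact (classification Hfund Hzero Hn0 P HP).
Qed.
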